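(* Let $E\subset\mathbb{R}$ be the middle-third Cantor set obtained from dissecting the interval $[-1/2,1/2]$, let $\mu$ be the Cantor measure on $E$, and let $\alpha=\frac{\log2}{\log3}$. Let $\chi\in C_c^\infty(\mathbb{R})$ be a (nonzero) bump function with $\hat\chi\ge0$. For $\delta>0$ let $$m_\delta(\xi)=\int_{\mathbb{R}}\frac{\chi(\xi-\eta)}{|\xi-\eta|^{\alpha-\delta}}\,d\mu(\eta).$$ Let $$c(1)=\lim_{n\to\infty}\left(\int_0^1\prod_{j=0}^{n-1}|\cos(\pi3^jt)|\,dt\right)^{1/n}.$$ Then $m_\delta$ is an $L^1$-Fourier multiplier if and only if $$\delta>\frac{\log2}{\log3}+\frac{\log c(1)}{\log3}=0.236\cdots.$$
   Context: The Cantor measure $\mu$ is the standard self-similar probability measure on $E$; its Fourier transform is $\hat\mu(x)=\int_{\mathbb{R}}e^{-\pi ix\xi}\,d\mu(\xi)=\prod_{j=1}^\infty\cos(\pi3^{-j}x)$. For $\delta>0$ the function $m_\delta$ is bounded. An $L^p$-Fourier multiplier is a function $m(\xi)$ for which there is a constant $C$ such that $\|\mathcal{F}^{-1}(m(\xi)\hat f(\xi))\|_{L^p(\mathbb{R})}\le C\|f\|_{L^p(\mathbb{R})}$ for all $f$, where $\mathcal{F}^{-1}$ denotes the inverse Fourier transform. The limit defining $c(1)$ exists. *)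

(* Defs.v *)
From HB Require Import structures.
From mathcomp Require Import all_boot all_order all_algebra.
From mathcomp Require Import all_classical all_reals all_analysis.
From mathcomp.real_closed Require Export complex.

Set Implicit Arguments.
Unset Strict Implicit.
Unset Printing Implicit Defensive.

Import Order.TTheory GRing.Theory Num.Theory.
Import numFieldNormedType.Exports.

Local Open Scope classical_set_scope.
Local Open Scope ring_scope.
Local Open Scope complex_scope.

Section ComplexIntegral.
Context {d : measure_display} {T : measurableType d} {R : realType}.
Variable mu : {measure set T -> \bar R}.

Definition cintegrable (f : T -> R[i]) : Prop :=
  mu.-integrable setT (fun x => (complex.Re (f x))%:E) /\
  mu.-integrable setT (fun x => (complex.Im (f x))%:E).

(* Meaningful only when [cintegrable f] holds. *)
Definition cintegral (f : T -> R[i]) : R[i] :=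
  (\int[mu]_x complex.Re (f x)) +i* (\int[mu]_x complex.Im (f x)).

End ComplexIntegral.

Section FunctionClasses.
Context {R : realType}.

Definition smooth (g : R -> R) : Prop :=
  forall (n : nat) (x : R), derivable (derive1n n g) x 1.

Definition rapidly_decreasing (g : R -> R) : Prop :=
  forall k n : nat, exists M : R,
    forall x : R, `|x| ^+ k * `|derive1n n g x| <= M.

Definition csmooth (f : R -> R[i]) : Prop :=
  smooth (fun x => complex.Re (f x)) /\ smooth (fun x => complex.Im (f x)).

Definition test_function (f : R -> R[i]) : Prop :=
  csmooth f /\ compact (closure [set x : R | f x != 0]).

Definition schwartz (f : R -> R[i]) : Prop :=
  [/\ csmooth f,
      rapidly_decreasing (fun x => complex.Re (f x)) &
      rapidly_decreasing (fun x => complex.Im (f x))].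

End FunctionClasses.

Section Fourier.
Context {R : realType}.

Definition cis (t : R) : R[i] := cos t +i* sin t.

Definition fourier (f : R -> R[i]) (xi : R) : R[i] :=
  cintegral lebesgue_measure (fun x => cis (- (pi * x * xi)) * f x).

(* The factor 1/2 comes from the frequency normalisation e^(-i pi x xi). *)
Definition inv_fourier (g : R -> R[i]) (x : R) : R[i] :=
  (2^-1)%:C * cintegral lebesgue_measure (fun xi => cis (pi * x * xi) * g xi).

Definition cLnorm (p : R) (f : R -> R[i]) : \bar R :=
  Lnorm lebesgue_measure p%:E (fun x => (ComplexField.Normc.normc (f x))%:E).

(* As usual for 1 <= p < oo, the estimate is tested on the Schwartz class,
   which is dense in L^p; integrability of m * fhat makes the inverse
   transform an absolutely convergent integral. *)
Definition Lp_fourier_multiplier (p : R) (m : R -> R[i]) : Prop :=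
  exists C : R, forall f : R -> R[i], schwartz f ->
    cintegrable lebesgue_measure (fun xi => m xi * fourier f xi) /\
    (cLnorm p (inv_fourier (fun xi => (m xi * fourier f xi)%R))
       <= C%:E * cLnorm p f)%E.

End Fourier.

Section Cantor.
Context {R : realType}.

Definition remove_middle_third (I : R * R) : seq (R * R) :=
  let l := (I.2 - I.1) / 3 in [:: (I.1, I.1 + l); (I.2 - l, I.2)].

Fixpoint cantor_intervals (n : nat) : seq (R * R) :=
  if n is n'.+1 then flatten (map remove_middle_third (cantor_intervals n'))
  else [:: (- 2^-1, 2^-1)].

Definition cantor_stage (n : nat) : set R :=
  [set x | exists2 I, I \in cantor_intervals n & x \in `[I.1, I.2]].

Definition cantor_set : set R := \bigcap_n cantor_stage n.

(* The maps x |-> (x - 1)/3 and x |-> (x + 1)/3 send [-1/2, 1/2] onto its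
   left and right thirds. *)
Definition cantor_measure (mu : probability (measurableTypeR R) R) : Prop :=
  mu cantor_set = 1%E /\
  forall A : set (measurableTypeR R), measurable A ->
    mu A = ((2^-1)%:E * mu ((fun x : R => ((x - 1) / 3)%R) @^-1` A) +
            (2^-1)%:E * mu ((fun x : R => ((x + 1) / 3)%R) @^-1` A))%E.

Definition alpha : R := ln 2 / ln 3.

(* The singularity eta = xi is a single point, hence mu-null. *)
Definition m_delta (mu : probability (measurableTypeR R) R) (chi : R -> R[i])
    (delta xi : R) : R[i] :=
  cintegral mu (fun eta : measurableTypeR R =>
    chi (xi - eta) / (`|xi - eta| `^ (alpha - delta))%:C).

Definition c1 : R :=
  limn (fun n : nat =>
    (\int[lebesgue_measure]_(t in `[0, 1])
       \prod_(0 <= j < n) `|cos (pi * 3 ^+ j * t)|) `^ (n%:R^-1)).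

End Cantor.

Arguments alpha R : clear implicits.
Arguments c1 R : clear implicits.

(* Main.v *)
(* Since m = h * mu with h(u) = chi(u) |u|^(delta - alpha) is integrable, m is an
   L^1 multiplier iff its inverse Fourier transform K is integrable (test on an
   approximate identity and apply Fatou), and 2 K(x) is the product of the Fourier
   transforms H(x) of h and muhat(x) of mu.  One has |H(x)| <= C |x|^(-s) for |x| >= 1,
   where s = min(1, 1 + delta - alpha), from the L^1 modulus of continuity of h; and
   when delta < alpha, writing |u|^(delta - alpha) as a superposition of Fejer
   kernels and using that the Fourier transform of chi is nonnegative gives
   H(x) >= c x^(-s) for large x.

   Self-similarity gives muhat(3x) = cos(pi x) muhat(x), so the integral of |muhat|
   over [0, 3^n] is comparable to 3^n I_n, where I_n is the integral of the product
   of the |cos(pi 3^j t)|, j < n.  A transfer operator L satisfies I_n = int L^n 1;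
   the suprema of L^n 1 are submultiplicative, and a uniform Lipschitz estimate makes
   them comparable to I_n.  Hence c(1)^n / C <= I_n <= C_b b^n for every b > c(1),
   and K is integrable iff 3^(1 - s) c(1) < 1, which is the stated condition.  The
   numerical value follows from applying L to a positive trial function. *)

Require Import Defs.
From HB Require Import structures.
From mathcomp Require Import all_boot all_order all_algebra.
From mathcomp Require Import all_classical all_reals all_analysis.
From mathcomp.real_closed Require Import complex.
From mathcomp Require Import measurable_realfun ring lra.

Set Implicit Arguments.
Unset Strict Implicit.
Unset Printing Implicit Defensive.

Import Order.TTheory GRing.Theory Num.Theory.
Import numFieldNormedType.Exports.

Local Open Scope classical_set_scope.
Local Open Scope ring_scope.
Local Open Scope complex_scope.

(** * Lebesgue integrals: affine substitution and Fubini *)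

(** The strict inequality comes from an asymmetry: the lower bound for I_n is c(1)^n up to a
    constant, with no loss in the base, while the upper bound needs a slightly larger base. Hence
    the critical delta is excluded, and above it there is room for the loss. Comparing I_n with the
    suprema takes a Lipschitz constant for L^n 1 proportional to the supremum itself. Such a
    constant reproduces itself because the inverse branches of tripling contract by 3 and L 1 >= 1/2
    keeps a supremum within a factor 2 of the next one.

    The lower bound for H is available only for delta < alpha. For delta >= alpha the inequality to
    be derived holds outright: c(1) < 1, so alpha already exceeds the threshold. The same fact makes
    the case s = 1 harmless, where 3^(1 - s) c(1) is just c(1).

    Complex integrals are treated through real and imaginary parts, which costs a factor 2 in the
    triangle inequality and affects constants only. The approximate identity is built from |chi|^2,
    a nonnegative test function that the hypotheses supply. The numerical part is exact: cosines are
    enclosed between rationals, and all that is left are rational inequalities. *)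

Section affine.
Context {R : realType}.
Notation leb := (@lebesgue_measure R).

Lemma measurable_affine (a b : R) :
  measurable_fun setT ((fun x => a * x + b) : measurableTypeR R -> measurableTypeR R).
Proof. by apply: measurable_realfun.measurable_funD => //; exact: mulrl_measurable. Qed.

(** Both sides are measures in [A], so by uniqueness of Lebesgue measure it is enough to compare
    them on half-open intervals. For negative [a] the preimage is closed on the left and open on the
    right, with the same length. *)
Lemma lebesgue_measure_affine (a b : R) (A : set (measurableTypeR R)) : a != 0 -> measurable A ->
  leb A = (`|a|%:E * pushforward leb (fun x => a * x + b)%R A)%E.
Proof.
move=> a0 mA.
pose phi := (fun x => a * x + b) : measurableTypeR R -> measurableTypeR R.
have mphi : measurable_fun setT phi := measurable_affine a b.
pose k : {nonneg R} := NngNum (normr_ge0 a).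
pose m : {measure set (measurableTypeR R) -> \bar R} := mscale k (pushforward leb phi).
rewrite (@lebesgue_measure_unique R (m mphi) _ A)// => _ [[c d]] _ <-.
change (leb `]c, d] = (`|a|%:E * leb (phi @^-1` `]c, d]))%E).
have [ap|an|aE] := ltgtP a 0; last by rewrite aE eqxx in a0.
- have -> : phi @^-1` `]c, d] = `[(d - b) / a, (c - b) / a[%classic.
    apply/seteqP; split => x /=; rewrite !in_itv/= ler_ndivrMr// ltr_ndivlMr//;
    by rewrite /phi lerBrDr ltrBlDr ![x * a]mulrC andbC.
  rewrite !lebesgue_measure_itv/= !lte_fin ltr_nM2r ?invr_lt0// ltrD2r.
  case: ifPn => cd; last by rewrite mule0.
  by rewrite -!EFinD -EFinM; congr EFin; rewrite ltr0_norm//; field.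
- have -> : phi @^-1` `]c, d] = `](c - b) / a, (d - b) / a]%classic.
    apply/seteqP; split => x /=; rewrite !in_itv/= ler_pdivlMr// ltr_pdivrMr//;
    by rewrite /phi lerBrDr ltrBlDr ![x * a]mulrC.
  rewrite !lebesgue_measure_itv/= !lte_fin ltr_pM2r ?invr_gt0// ltrD2r.
  case: ifPn => cd; last by rewrite mule0.
  by rewrite -!EFinD -EFinM; congr EFin; rewrite gtr0_norm//; field; rewrite gt_eqF.
Qed.

Lemma ge0_integral_affine (a b : R) (f : R -> \bar R) : a != 0 ->
  measurable_fun setT f -> (forall x, 0 <= f x)%E ->
  (\int[leb]_x f x = `|a|%:E * \int[leb]_x f (a * x + b)%R)%E.
Proof.
move=> a0 mf f0.
pose phi := (fun x => a * x + b) : measurableTypeR R -> measurableTypeR R.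
have mphi : measurable_fun setT phi := measurable_affine a b.
pose k : {nonneg R} := NngNum (normr_ge0 a).
pose m : {measure set (measurableTypeR R) -> \bar R} := pushforward leb phi.
have := @ge0_integral_pushforward _ _ _ _ R phi mphi leb setT f measurableT mf (fun x _ => f0 x).
rewrite preimage_setT => <-.
rewrite -[RHS](@ge0_integral_mscale _ _ _ (m mphi) _ measurableT k f)//.
by apply: eq_measure_integral => A mA _; exact: (lebesgue_measure_affine b a0).
Qed.

Lemma integrable_affine (a b : R) (f : R -> \bar R) : a != 0 ->
  leb.-integrable setT f -> leb.-integrable setT (fun x => f (a * x + b)%R).
Proof.
move=> a0 /integrableP[mf foo]; apply/integrableP; split.
  apply: (@measurableT_comp _ _ _ (measurableTypeR R) (measurableTypeR R) _ f) => //.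
  exact: measurable_affine.
move: foo; rewrite (ge0_integral_affine b a0)//; last exact: measurableT_comp.
have a0' : (0 < `|a|)%R by rewrite normr_gt0.
by rewrite !ltey; apply: contraNN => /eqP ->; rewrite gt0_muley.
Qed.

Lemma integral_affine (a b : R) (f : R -> \bar R) : a != 0 ->
  leb.-integrable setT f ->
  (\int[leb]_x f x = `|a|%:E * \int[leb]_x f (a * x + b)%R)%E.
Proof.
move=> a0 intf; have mf : measurable_fun setT f := measurable_int _ intf.
rewrite [LHS]integralE [in RHS]integralE.
have intg := integrable_affine b a0 intf.
rewrite muleBr//; last exact: integrable_add_def.
rewrite (ge0_integral_affine b a0 (measurable_funepos mf))//.
rewrite (ge0_integral_affine b a0 (measurable_funeneg mf))//.
congr (_ - _)%E; congr (_ * _)%E; apply: eq_integral => x _.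
  by rewrite unlock.
by rewrite unlock.
Qed.

Lemma Rintegral_affine (a b : R) (f : R -> R) : a != 0 ->
  leb.-integrable setT (EFin \o f) ->
  \int[leb]_x f x = `|a| * \int[leb]_x f (a * x + b).
Proof.
move=> a0 intf; rewrite /Rintegral (integral_affine b a0 intf) fineM//.
by apply: integrable_fin_num => //; exact: (integrable_affine b a0 intf).
Qed.
End affine.

Section Rfubini.
Context d1 d2 (T1 : measurableType d1) (T2 : measurableType d2) (R : realType).
Variables (m1 : {sigma_finite_measure set T1 -> \bar R})
          (m2 : {sigma_finite_measure set T2 -> \bar R}).
Variable f : T1 * T2 -> R.
Hypothesis intf : (m1 \x m2)%E.-integrable setT (EFin \o f).

(** The inner integral may be infinite on a null set of [x]. There [fine] makes it 0, so it stays
    dominated by the integrable [fubini_F]. *)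
Lemma integrable_Rintegral1 :
  m1.-integrable setT (fun x => (\int[m2]_y f (x, y))%:E).
Proof.
have iF := integrable_fubini_F intf.
apply: le_integrable iF => //.
  apply/measurable_EFinP; apply: measurableT_comp => //.
  exact: (measurable_fubini_F intf).
move=> x _; rewrite /Rintegral /fubini_F /=.
by case: (\int[m2]_y _)%E => [r| |] /=; rewrite ?lexx ?leey.
Qed.

Let integrable_fubini_G : m2.-integrable setT (fubini_G m1 (EFin \o f)).
Proof.
have mf : measurable_fun setT (EFin \o f) := measurable_int _ intf.
apply/integrableP; split; first exact: (measurable_fubini_G intf).
apply: le_lt_trans ((integrable21ltyP m1 m2 mf).1 intf).
apply: ge0_le_integral => //.
- by apply: measurableT_comp => //; exact: (measurable_fubini_G intf).
- by apply: (@measurable_fun_fubini_tonelli_G _ _ _ _ _ m1 (abse \o (EFin \o f))) ; [apply: measurableT_comp => //|move=> z; exact: abse_ge0].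
- move=> y _; apply: le_abse_integral => //.
  exact: measurableT_comp mf _.
Qed.

Lemma integrable_Rintegral2 :
  m2.-integrable setT (fun y => (\int[m1]_x f (x, y))%:E).
Proof.
have iF := integrable_fubini_G.
apply: le_integrable iF => //.
  apply/measurable_EFinP; apply: measurableT_comp => //.
  exact: (measurable_fubini_G intf).
move=> x _; rewrite /Rintegral /fubini_G /=.
by case: (\int[m1]_y _)%E => [r| |] /=; rewrite ?lexx ?leey.
Qed.

Lemma Rfubini1 : \int[m1]_x (\int[m2]_y f (x, y)) =
  fine (\int[(m1 \x m2)%E]_z (f z)%:E).
Proof.
rewrite -(integral12_prod_meas1 intf) {1}/Rintegral; congr fine.
apply: ae_eq_integral => //.
- exact: measurable_int integrable_Rintegral1.
- exact: measurable_int (integrable_fubini_F intf).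
have := integrable_ae measurableT (integrable_fubini_F intf).
by apply: filterS => x /(_ I) fx _; rewrite /Rintegral fineK.
Qed.

Lemma Rfubini2 : \int[m2]_y (\int[m1]_x f (x, y)) =
  fine (\int[(m1 \x m2)%E]_z (f z)%:E).
Proof.
rewrite -(integral21_prod_meas1 intf) {1}/Rintegral; congr fine.
apply: ae_eq_integral => //.
- exact: measurable_int integrable_Rintegral2.
- exact: measurable_int (integrable_fubini_G).
have := integrable_ae measurableT (integrable_fubini_G).
by apply: filterS => x /(_ I) fx _; rewrite /Rintegral fineK.
Qed.

Lemma Rfubini : \int[m1]_x (\int[m2]_y f (x, y)) =
  \int[m2]_y (\int[m1]_x f (x, y)).
Proof. by rewrite Rfubini1 Rfubini2. Qed.
End Rfubini.

(** * Complex-valued integrals *)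

Notation normc := ComplexField.Normc.normc.

Section complex_basics.
Context {R : realType}.
Implicit Types x y z : R[i].

Lemma complexReM x y : complex.Re (x * y) =
  complex.Re x * complex.Re y - complex.Im x * complex.Im y.
Proof. by case: x y => [a b] [c d]. Qed.

Lemma complexImM x y : complex.Im (x * y) =
  complex.Re x * complex.Im y + complex.Im x * complex.Re y.
Proof. by case: x y => [a b] [c d]. Qed.

Lemma normc_Re x : `|complex.Re x| <= normc x.
Proof.
by case: x => a b /=; rewrite -sqrtr_sqr ler_wsqrtr// lerDl sqr_ge0.
Qed.

Lemma normc_Im x : `|complex.Im x| <= normc x.
Proof.
by case: x => a b /=; rewrite -sqrtr_sqr ler_wsqrtr// lerDr sqr_ge0.
Qed.

Lemma normc_ge0 x : 0 <= normc x.
Proof. by case: x => a b /=; exact: sqrtr_ge0. Qed.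

Lemma normc_ReIm x : normc x <= `|complex.Re x| + `|complex.Im x|.
Proof.
case: x => a b /=; rewrite -[leRHS]ger0_norm ?addr_ge0// -sqrtr_sqr ler_wsqrtr//.
by rewrite sqrrD !real_normK ?num_real// -addrA lerD2l addrC lerDl mulrn_wge0 ?mulr_ge0.
Qed.

Lemma normc_real (a : R) : normc a%:C = `|a|.
Proof. by rewrite /= expr0n addr0 sqrtr_sqr. Qed.

Lemma normc_cis (t : R) : normc (cis t) = 1.
Proof. by rewrite /= cos2Dsin2 sqrtr1. Qed.

Lemma cisD (s t : R) : cis (s + t) = cis s * cis t.
Proof. by rewrite /cis cosD sinD; congr Complex; rewrite addrC. Qed.

Lemma cis0 : cis (0 : R) = 1.
Proof. by rewrite /cis cos0 sin0. Qed.

Lemma cispi : cis (pi : R) = -1.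
Proof. by rewrite /cis cospi sinpi; congr Complex; rewrite oppr0. Qed.
End complex_basics.

Section cintegral_theory.
Context d (T : measurableType d) (R : realType).
Variable mu : {measure set T -> \bar R}.
Implicit Types f g : T -> R[i].

Definition cmeasurable f := measurable_fun setT (fun x => complex.Re (f x)) /\
  measurable_fun setT (fun x => complex.Im (f x)).

Lemma cmeasurableM f g : cmeasurable f -> cmeasurable g ->
  cmeasurable (fun x => f x * g x).
Proof.
move=> [f1 f2] [g1 g2]; split.
- under eq_fun do rewrite complexReM.
  by apply: measurable_funB; exact: measurable_funM.
- under eq_fun do rewrite complexImM.
  by apply: measurable_funD; exact: measurable_funM.
Qed.

Lemma cmeasurableD f g : cmeasurable f -> cmeasurable g ->
  cmeasurable (fun x => f x + g x).
Proof.
move=> [f1 f2] [g1 g2]; split.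
- have -> : (fun x => complex.Re (f x + g x)) = (fun x => complex.Re (f x) + complex.Re (g x)).
    by apply/funext => x; case: (f x) (g x) => [? ?] [? ?].
  exact: measurable_funD.
- have -> : (fun x => complex.Im (f x + g x)) = (fun x => complex.Im (f x) + complex.Im (g x)).
    by apply/funext => x; case: (f x) (g x) => [? ?] [? ?].
  exact: measurable_funD.
Qed.

Lemma cmeasurable_cst (c : R[i]) : cmeasurable (fun=> c).
Proof. by split; exact: measurable_cst. Qed.

Lemma cmeasurable_real (f : T -> R) : measurable_fun setT f ->
  cmeasurable (fun x => (f x)%:C).
Proof. by move=> mf; split => //=; exact: measurable_cst. Qed.

Lemma cmeasurable_cis (f : T -> R) : measurable_fun setT f ->
  cmeasurable (fun x => cis (f x)).
Proof.
move=> mf; split => /=; apply: measurableT_comp mf.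
- by apply: continuous_measurable_fun; exact: continuous_cos.
- by apply: continuous_measurable_fun; exact: continuous_sin.
Qed.

Lemma measurable_normc f : cmeasurable f -> measurable_fun setT (fun x => normc (f x)).
Proof.
move=> [f1 f2].
have -> : (fun x => normc (f x)) =
    (fun x => Num.sqrt (complex.Re (f x) ^+ 2 + complex.Im (f x) ^+ 2)).
  by apply/funext => x; case: (f x).
apply: measurableT_comp; first exact: (continuous_measurable_fun (@sqrt_continuous R)).
by apply: measurable_funD; exact: measurable_funX.
Qed.

Lemma cintegrable_cmeasurable f : cintegrable mu f -> cmeasurable f.
Proof.
move=> [f1 f2]; split; apply/measurable_EFinP.
- exact: measurable_int f1.
- exact: measurable_int f2.
Qed.

Lemma cintegrable_normc f : cintegrable mu f ->
  mu.-integrable setT (fun x => (normc (f x))%:E).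
Proof.
move=> intf; have [f1 f2] := intf.
have mf := measurable_normc (cintegrable_cmeasurable intf).
apply: le_integrable (integrableD measurableT (integrable_abse f1) (integrable_abse f2)) => //.
  exact/measurable_EFinP.
move=> x _ /=; rewrite lee_fin ger0_norm ?normc_ge0// (le_trans (normc_ReIm _))//.
by rewrite ler_norm.
Qed.

Lemma cintegrable_le f (g : T -> R) : cmeasurable f ->
  mu.-integrable setT (EFin \o g) -> (forall x, normc (f x) <= g x) -> cintegrable mu f.
Proof.
move=> [f1 f2] ig fg; split.
- apply: le_integrable ig => //; first exact/measurable_EFinP.
  by move=> x _ /=; rewrite lee_fin (le_trans (normc_Re _))// (le_trans (fg _))// ler_norm.
- apply: le_integrable ig => //; first exact/measurable_EFinP.
  by move=> x _ /=; rewrite lee_fin (le_trans (normc_Im _))// (le_trans (fg _))// ler_norm.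
Qed.

Lemma cintegrableP f : cmeasurable f ->
  cintegrable mu f <-> (\int[mu]_x (normc (f x))%:E < +oo)%E.
Proof.
move=> mf; split=> [intf|foo].
  have /integrableP[_] := cintegrable_normc intf.
  by under eq_integral do rewrite gee0_abs ?lee_fin ?normc_ge0//.
apply: (@cintegrable_le _ (fun x => normc (f x))) => //.
apply/integrableP; split; first by apply/measurable_EFinP; exact: measurable_normc.
by rewrite (eq_integral (fun x => (normc (f x))%:E))// => x _; rewrite /= ger0_norm// normc_ge0.
Qed.

Lemma cintegrableM_bounded f g (B : R) : cmeasurable g -> (forall x, normc (g x) <= B) ->
  cintegrable mu f -> cintegrable mu (fun x => g x * f x).
Proof.
move=> mg gB intf; have mf := cintegrable_cmeasurable intf.
apply: (@cintegrable_le _ (fun x => B * normc (f x))); first exact: cmeasurableM.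
- by have := integrableZl measurableT B (cintegrable_normc intf).
- move=> x; rewrite ComplexField.Normc.normcM ler_wpM2r ?normc_ge0//.
Qed.

Lemma cintegrableZ (c : R[i]) f : cintegrable mu f -> cintegrable mu (fun x => c * f x).
Proof. by apply: (@cintegrableM_bounded _ (fun=> c) (normc c)) => //; exact: cmeasurable_cst. Qed.

Lemma cintegralZ (c : R[i]) f : cintegrable mu f ->
  cintegral mu (fun x => c * f x) = c * cintegral mu f.
Proof.
move=> [f1 f2]; rewrite /cintegral; case: c => a b /=.
have E1 : forall x, complex.Re ((a +i* b) * f x) = a * complex.Re (f x) - b * complex.Im (f x).
  by move=> x; rewrite complexReM.
have E2 : forall x, complex.Im ((a +i* b) * f x) = a * complex.Im (f x) + b * complex.Re (f x).
  by move=> x; rewrite complexImM.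
under eq_Rintegral do rewrite E1.
under [X in _ +i* X]eq_Rintegral do rewrite E2.
rewrite RintegralB//; [|exact: integrableZl f1|exact: integrableZl f2].
rewrite RintegralD//; [|exact: integrableZl f2|exact: integrableZl f1].
by rewrite !RintegralZl.
Qed.

Lemma cintegrableD f g : cintegrable mu f -> cintegrable mu g ->
  cintegrable mu (fun x => f x + g x).
Proof.
move=> [f1 f2] [g1 g2]; split.
- apply: eq_integrable (integrableD measurableT f1 g1) => // x _ /=.
  by case: (f x) (g x) => [? ?] [? ?].
- apply: eq_integrable (integrableD measurableT f2 g2) => // x _ /=.
  by case: (f x) (g x) => [? ?] [? ?].
Qed.

Lemma cintegralD f g : cintegrable mu f -> cintegrable mu g ->
  cintegral mu (fun x => f x + g x) = cintegral mu f + cintegral mu g.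
Proof.
move=> [f1 f2] [g1 g2]; rewrite /cintegral.
have E1 : forall x, complex.Re (f x + g x) = complex.Re (f x) + complex.Re (g x).
  by move=> x; case: (f x) (g x) => [? ?] [? ?].
have E2 : forall x, complex.Im (f x + g x) = complex.Im (f x) + complex.Im (g x).
  by move=> x; case: (f x) (g x) => [? ?] [? ?].
under eq_Rintegral do rewrite E1.
under [X in _ +i* X]eq_Rintegral do rewrite E2.
by rewrite !RintegralD.
Qed.

Lemma eq_cintegral f g : f =1 g -> cintegral mu f = cintegral mu g.
Proof. by move=> /funext ->. Qed.

(** The real and the imaginary part are each bounded by the integral of the modulus, whence the
    factor 2, which enters only through constants. *)
Lemma normc_cintegral_le f : cintegrable mu f ->
  ((normc (cintegral mu f))%:E <= 2%:E * \int[mu]_x (normc (f x))%:E)%E.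
Proof.
move=> intf; have [f1 f2] := intf.
have mn : measurable_fun setT (fun x => (normc (f x))%:E).
  by apply/measurable_EFinP/measurable_normc/cintegrable_cmeasurable.
apply: (@le_trans _ _ (`|\int[mu]_x complex.Re (f x)|%:E + `|\int[mu]_x complex.Im (f x)|%:E)%E).
  by rewrite -EFinD lee_fin normc_ReIm.
rewrite (_ : 2%:E = 1 + 1 :> \bar R)%E; last by rewrite -EFinD.
rewrite ge0_muleDl// !mul1e leeD//.
- rewrite EFin_normr_Rintegral//.
  apply: le_trans (le_abse_integral _ _ (measurable_int _ f1)) _ => //.
  apply: ge0_le_integral => //; first by apply: measurableT_comp => //; exact: measurable_int f1.
  - by move=> x _; rewrite /= lee_fin normc_Re.
- rewrite EFin_normr_Rintegral//.
  apply: le_trans (le_abse_integral _ _ (measurable_int _ f2)) _ => //.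
  apply: ge0_le_integral => //; first by apply: measurableT_comp => //; exact: measurable_int f2.
  - by move=> x _; rewrite /= lee_fin normc_Im.
Qed.

Lemma ae_eq_cintegral f g : cmeasurable f -> cmeasurable g ->
  {ae mu, forall x, f x = g x} -> cintegral mu f = cintegral mu g.
Proof.
move=> [f1 f2] [g1 g2] fg; rewrite /cintegral /Rintegral.
congr (fine _ +i* fine _); apply: ae_eq_integral => //; try exact/measurable_EFinP.
- by apply: filterS fg => x -> .
- by apply: filterS fg => x -> .
Qed.
End cintegral_theory.

Section cfubini.
Context d1 d2 (T1 : measurableType d1) (T2 : measurableType d2) (R : realType).
Variables (m1 : {sigma_finite_measure set T1 -> \bar R})
          (m2 : {sigma_finite_measure set T2 -> \bar R}).
Implicit Type F : T1 * T2 -> R[i].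

Lemma cintegrable_fubini1 F : cintegrable (m1 \x m2)%E F ->
  cintegrable m1 (fun x => cintegral m2 (fun y => F (x, y))).
Proof.
move=> [F1 F2]; split => /=; [exact: integrable_Rintegral1 F1|exact: integrable_Rintegral1 F2].
Qed.

Lemma cintegrable_fubini2 F : cintegrable (m1 \x m2)%E F ->
  cintegrable m2 (fun y => cintegral m1 (fun x => F (x, y))).
Proof.
move=> [F1 F2]; split => /=; [exact: integrable_Rintegral2 F1|exact: integrable_Rintegral2 F2].
Qed.

Lemma cfubini F : cintegrable (m1 \x m2)%E F ->
  cintegral m1 (fun x => cintegral m2 (fun y => F (x, y))) =
  cintegral m2 (fun y => cintegral m1 (fun x => F (x, y))).
Proof.
move=> [F1 F2]; rewrite /cintegral /=.
by rewrite (Rfubini F1) (Rfubini F2).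
Qed.

Lemma cintegrable_ae1 F : cintegrable (m1 \x m2)%E F ->
  {ae m1, forall x, cintegrable m2 (fun y => F (x, y))}.
Proof.
move=> [F1 F2]; have := ae_integrable1 F1; have := ae_integrable1 F2.
by apply: filterS2 => x H1 H2; split.
Qed.

Lemma cintegrable_prodP F : cmeasurable F ->
  cintegrable (m1 \x m2)%E F <-> (\int[m1]_x \int[m2]_y (normc (F (x, y)))%:E < +oo)%E.
Proof.
move=> mF; rewrite (cintegrableP _ mF).
rewrite fubini_tonelli1//; last by move=> z; rewrite lee_fin normc_ge0.
by apply/measurable_EFinP; exact: measurable_normc.
Qed.

Lemma cmeasurable_fst (f : T1 -> R[i]) : cmeasurable f -> cmeasurable (fun z : T1 * T2 => f z.1).
Proof. by move=> [f1 f2]; split; [exact: measurableT_comp f1 _|exact: measurableT_comp f2 _]. Qed.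

Lemma cmeasurable_snd (f : T2 -> R[i]) : cmeasurable f -> cmeasurable (fun z : T1 * T2 => f z.2).
Proof. by move=> [f1 f2]; split; [exact: measurableT_comp f1 _|exact: measurableT_comp f2 _]. Qed.

Lemma cintegrable_prod f g : cintegrable m1 f -> cintegrable m2 g ->
  cintegrable (m1 \x m2)%E (fun z => f z.1 * g z.2).
Proof.
move=> intf intg; have mf := cintegrable_cmeasurable intf.
have mg := cintegrable_cmeasurable intg.
apply/cintegrable_prodP.
  by apply: cmeasurableM; [exact: cmeasurable_fst|exact: cmeasurable_snd].
have E x : (\int[m2]_y (normc (f x * g y))%:E = (normc (f x))%:E * \int[m2]_y (normc (g y))%:E)%E.
  under eq_integral do rewrite ComplexField.Normc.normcM EFinM.
  rewrite ge0_integralZl ?lee_fin ?normc_ge0//; last by move=> y _; rewrite lee_fin normc_ge0.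
  by apply/measurable_EFinP; exact: measurable_normc.
under eq_integral do rewrite /= E.
rewrite ge0_integralZr//.
- move/(cintegrableP _ mf) : intf => foo; move/(cintegrableP _ mg) : intg => goo.
  by apply: lte_mul_pinfty => //; rewrite ?ge0_fin_numE//; apply: integral_ge0 => x _; rewrite lee_fin normc_ge0.
- by apply/measurable_EFinP; exact: measurable_normc.
- by move=> x _; rewrite lee_fin normc_ge0.
- by apply: integral_ge0 => x _; rewrite lee_fin normc_ge0.
Qed.
End cfubini.

Section cintegral_affine.
Context {R : realType}.
Notation leb := (@lebesgue_measure R).

Lemma cintegrable_affine (a b : R) (f : R -> R[i]) : a != 0 ->
  cintegrable leb f -> cintegrable leb (fun x => f (a * x + b)).
Proof.
move=> a0 [f1 f2]; split;
  [exact: (integrable_affine b a0 f1)|exact: (integrable_affine b a0 f2)].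
Qed.

Lemma cintegral_affine (a b : R) (f : R -> R[i]) : a != 0 -> cintegrable leb f ->
  cintegral leb f = `|a|%:C * cintegral leb (fun x => f (a * x + b)).
Proof.
move=> a0 [f1 f2]; rewrite /cintegral (Rintegral_affine b a0 f1) (Rintegral_affine b a0 f2).
by simpc.
Qed.
End cintegral_affine.

(** * L^1 multipliers and integrable kernels *)

Section schwartz_l1.
Context {R : realType}.
Notation leb := (@lebesgue_measure R).

Lemma integrable_oneDsqrV : leb.-integrable setT (fun x : R => ((1 + x ^+ 2)^-1)%:E).
Proof.
have c : continuous (fun x : R => (oneDsqr x)^-1) by exact: continuous_oneDsqrV.
have p (x : R) : 0 < 1 + x ^+ 2 by rewrite ltr_pwDl ?sqr_ge0.
apply/integrableP; split.
  by apply/measurable_EFinP; apply: continuous_measurable_fun; exact: c.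
under eq_integral do rewrite gee0_abs ?lee_fin ?invr_ge0 ?(ltW (p _))//.
rewrite (@ge0_symfun_integralT R (fun x => (oneDsqr x)^-1))//.
- have := integral0y_oneDsqr R; rewrite set_itvcy => ->.
  by rewrite -EFinM ltry.
- by move=> x /=; rewrite /oneDsqr sqrrN.
Qed.

Lemma smooth_continuous (g : R -> R) : smooth g -> continuous g.
Proof.
by move=> sg x; apply/differentiable_continuous/derivable1_diffP; exact: (sg 0%N x).
Qed.

Lemma rapidly_decreasing_bound (g : R -> R) : rapidly_decreasing g ->
  exists M : R, forall x, `|g x| <= M * (1 + x ^+ 2)^-1.
Proof.
move=> rg; have [M0 H0] := rg 0%N 0%N; have [M2 H2] := rg 2%N 0%N.
exists (M0 + M2) => x; have p : 0 < 1 + x ^+ 2 by rewrite ltr_pwDl ?sqr_ge0.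
rewrite ler_pdivlMr// mulrDr mulr1 lerD//.
  by have := H0 x; rewrite expr0 mul1r.
by have := H2 x; rewrite real_normK ?num_real// mulrC.
Qed.

Lemma schwartz_cintegrable (f : R -> R[i]) : schwartz f -> cintegrable leb f.
Proof.
move=> [[s1 s2] /rapidly_decreasing_bound[M1 r1] /rapidly_decreasing_bound[M2 r2]].
split.
- apply: (le_integrable measurableT _ _ (integrableZl measurableT M1 integrable_oneDsqrV)).
    by apply/measurable_EFinP; apply: continuous_measurable_fun; exact: smooth_continuous.
  by move=> x _; rewrite /= lee_fin (le_trans (r1 _))// ler_norm.
- apply: (le_integrable measurableT _ _ (integrableZl measurableT M2 integrable_oneDsqrV)).
    by apply/measurable_EFinP; apply: continuous_measurable_fun; exact: smooth_continuous.
  by move=> x _; rewrite /= lee_fin (le_trans (r2 _))// ler_norm.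
Qed.
End schwartz_l1.

Section convolution.
Context {R : realType}.
Notation leb := (@lebesgue_measure R).
Implicit Types m f : R -> R[i].

Lemma measurable_mulr3 (x : R) : measurable_fun setT (fun xi : R => pi * x * xi).
Proof. by apply: measurable_funM. Qed.

Lemma continuous_mulr3 (xi : R) : continuous (fun x : R => pi * x * xi).
Proof.
move=> x; apply: (@cvgM _ _ _ _ (fun x => pi * x) (fun=> xi)); last exact: cvg_cst.
by apply: (@cvgM _ _ _ _ (fun=> pi) id); [exact: cvg_cst|exact: cvg_id].
Qed.

Lemma half_mul2 : (2^-1 : R)%:C * 2 = 1.
Proof. by rewrite fmorphV/= rmorph_nat mulVf// pnatr_eq0. Qed.

Lemma cintegrable_cis m (x : R) : cintegrable leb m ->
  cintegrable leb (fun xi => cis (pi * x * xi) * m xi).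
Proof.
apply: (@cintegrableM_bounded _ _ _ _ _ _ 1) => [|y]; last by rewrite normc_cis.
by apply: cmeasurable_cis; exact: measurable_mulr3.
Qed.

(** Integrated in the second variable, this kernel gives the integrand of the inverse transform of
    [m * fourier f]; integrated in the first, it gives twice the convolution integrand of [f] and
    [inv_fourier m]. Fubini then yields the convolution theorem. *)
Lemma cintegrable_conv_kernel m f (x : R) : cintegrable leb m -> cintegrable leb f ->
  cintegrable (leb \x leb)%E (fun z : R * R => cis (pi * x * z.1 - pi * z.2 * z.1) * (m z.1 * f z.2)).
Proof.
move=> intm intf.
apply: (@cintegrableM_bounded _ _ _ _ _ _ 1) => [|y|]; last exact: cintegrable_prod.
  apply: cmeasurable_cis; apply: measurable_funB.
    by apply: measurable_funM => //; exact: measurable_fst.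
  apply: measurable_funM => //; first by apply: measurable_funM => //; exact: measurable_snd.
by rewrite normc_cis.
Qed.

Lemma conv_kernel_xi m f (x xi : R) : cintegrable leb f ->
  cintegral leb (fun y => cis (pi * x * xi - pi * y * xi) * (m xi * f y)) =
  cis (pi * x * xi) * (m xi * fourier f xi).
Proof.
move=> intf; rewrite /fourier -cintegralZ; last first.
  under eq_fun do rewrite -mulrAC -mulNr -mulrN.
  exact: cintegrable_cis.
rewrite -cintegralZ; last first.
  apply: cintegrableZ; under eq_fun do rewrite -mulrAC -mulNr -mulrN.
  exact: cintegrable_cis.
by apply: eq_cintegral => y; rewrite cisD -!mulrA; congr (_ * _); rewrite mulrCA.
Qed.

Lemma conv_kernel_y m f (x y : R) : cintegrable leb m ->
  cintegral leb (fun xi => cis (pi * x * xi - pi * y * xi) * (m xi * f y)) =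
  2 * (f y * inv_fourier m (x - y)).
Proof.
move=> intm; rewrite /inv_fourier [f y * _]mulrCA [RHS]mulrA.
rewrite [2 * _]mulrC half_mul2 mul1r -cintegralZ; last exact: cintegrable_cis.
by apply: eq_cintegral => xi; rewrite [RHS]mulrCA [f y * m xi]mulrC -mulrBl -mulrBr.
Qed.

(** At [x = 0] the outer phase of the convolution kernel is 1, so this product is a partial integral
    of an integrable function of two variables. *)
Lemma cintegrable_mul_fourier m f : cintegrable leb m -> cintegrable leb f ->
  cintegrable leb (fun xi => m xi * fourier f xi).
Proof.
move=> intm intf; have := cintegrable_fubini1 (cintegrable_conv_kernel 0 intm intf).
rewrite (_ : (fun x => _) = (fun xi => m xi * fourier f xi))//.
apply/funext => xi; rewrite (conv_kernel_xi m 0 xi intf).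
by rewrite mulr0 mul0r cis0 mul1r.
Qed.

Lemma cintegrable_conv m f (x : R) : cintegrable leb m -> cintegrable leb f ->
  cintegrable leb (fun y => f y * inv_fourier m (x - y)).
Proof.
move=> intm intf; have := cintegrable_fubini2 (cintegrable_conv_kernel x intm intf).
move=> /(cintegrableZ 2^-1); congr cintegrable; apply/funext => y.
by rewrite (conv_kernel_y f x y intm) mulrA mulVf ?mul1r// pnatr_eq0.
Qed.

Lemma inv_fourier_mul_fourier m f (x : R) : cintegrable leb m -> cintegrable leb f ->
  inv_fourier (fun xi => m xi * fourier f xi) x =
  cintegral leb (fun y => f y * inv_fourier m (x - y)).
Proof.
move=> intm intf; have E := cfubini (cintegrable_conv_kernel x intm intf).
rewrite {1}/inv_fourier.
have -> : cintegral leb (fun xi => cis (pi * x * xi) * (m xi * fourier f xi)) =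
    cintegral leb (fun y => 2 * (f y * inv_fourier m (x - y))).
  transitivity (cintegral leb (fun xi => cintegral leb (fun y =>
      cis (pi * x * xi - pi * y * xi) * (m xi * f y)))).
    by apply: eq_cintegral => xi; rewrite (conv_kernel_xi m x xi intf).
  transitivity (cintegral leb (fun y => cintegral leb (fun xi =>
      cis (pi * x * xi - pi * y * xi) * (m xi * f y)))); first exact: E.
  by apply: eq_cintegral => y; rewrite (conv_kernel_y f x y intm).
rewrite cintegralZ; last exact: cintegrable_conv.
by rewrite [LHS]mulrA half_mul2 mul1r.
Qed.

(** The factor 1/2 of the inversion formula cancels the 2 of [normc_cintegral_le]. *)
Lemma normc_inv_fourier_le m (x : R) : cintegrable leb m ->
  ((normc (inv_fourier m x))%:E <= \int[leb]_y (normc (m y))%:E)%E.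
Proof.
move=> intm; rewrite /inv_fourier ComplexField.Normc.normcM normc_real.
rewrite EFinM (le_trans (lee_wpmul2l _ (normc_cintegral_le (cintegrable_cis x intm))))//.
rewrite muleA -EFinM (ger0_norm (ltW _))// mulVf// mul1e.
by under eq_integral do rewrite ComplexField.Normc.normcM normc_cis mul1r.
Qed.

(** Continuity under the integral sign, with majorant [normc (m xi)]. It also supplies the
    measurability of every inverse transform below. *)
Lemma inv_fourier_continuous m : cintegrable leb m ->
  continuous (fun x => complex.Re (inv_fourier m x)) /\
  continuous (fun x => complex.Im (inv_fourier m x)).
Proof.
move=> intm; have [m1 m2] := intm.
have E x : inv_fourier m x =
   2^-1 * (\int[leb]_xi complex.Re (cis (pi * x * xi) * m xi)) +i*
   (2^-1 * (\int[leb]_xi complex.Im (cis (pi * x * xi) * m xi))).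
  by rewrite /inv_fourier /cintegral; simpc.
have H (P : R[i] -> R) : P = @complex.Re R \/ P = @complex.Im R ->
    continuous (fun x => \int[leb]_xi P (cis (pi * x * xi) * m xi)).
  move=> HP x.
  have xI : x \in `](x - 1), (x + 1)[%classic by rewrite inE/= in_itv/= ltrBlDr ltrDl ltr01.
  apply: (@continuity_under_integral _ _ _ leb (fun x xi => P (cis (pi * x * xi) * m xi))
    setT measurableT (x - 1) (x + 1) _ _ (fun xi => normc (m xi))) => //.
  - move=> y _; have [i1 i2] := cintegrable_cis y intm.
    by case: HP => ->.
  - apply: aeW => xi _ y _.
    have c1 : {for y, continuous (fun x : R => cos (pi * x * xi))}.
      apply: (@continuous_comp _ _ _ (fun x => pi * x * xi) cos); last exact: continuous_cos.
      exact: continuous_mulr3.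
    have c2 : {for y, continuous (fun x : R => sin (pi * x * xi))}.
      apply: (@continuous_comp _ _ _ (fun x => pi * x * xi) sin); last exact: continuous_sin.
      exact: continuous_mulr3.
    case: HP => ->.
      under eq_fun do rewrite complexReM/=.
      by apply: cvgB; apply: cvgM; [exact: c1|exact: cvg_cst|exact: c2|exact: cvg_cst].
    under eq_fun do rewrite complexImM/=.
    by apply: cvgD; apply: cvgM; [exact: c1|exact: cvg_cst|exact: c2|exact: cvg_cst].
  - exact: cintegrable_normc.
  - move=> y _; apply: aeW => xi _.
    have -> : normc (m xi) = normc (cis (pi * y * xi) * m xi).
      by rewrite ComplexField.Normc.normcM normc_cis mul1r.
    by case: HP => ->; [exact: normc_Re|exact: normc_Im].
split => x.
- have -> : (fun x => complex.Re (inv_fourier m x)) = (fun x => 2^-1 * (\int[leb]_xi complex.Re (cis (pi * x * xi) * m xi))).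
    by apply/funext => y; rewrite E.
  by apply: cvgM; [exact: cvg_cst|apply: (H (@complex.Re R)); left].
- have -> : (fun x => complex.Im (inv_fourier m x)) = (fun x => 2^-1 * (\int[leb]_xi complex.Im (cis (pi * x * xi) * m xi))).
    by apply/funext => y; rewrite E.
  by apply: cvgM; [exact: cvg_cst|apply: (H (@complex.Im R)); right].
Qed.
End convolution.

Section multiplier.
Context {R : realType}.
Notation leb := (@lebesgue_measure R).
Implicit Types m f : R -> R[i].

Lemma cLnorm1 f : cLnorm 1 f = (\int[leb]_x (normc (f x))%:E)%E.
Proof.
by rewrite /cLnorm Lnorm1; apply: eq_integral => x _; rewrite gee0_abs// lee_fin normc_ge0.
Qed.

Lemma cintegral_normc_fin f : cintegrable leb f ->
  (\int[leb]_x (normc (f x))%:E)%E \is a fin_num.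
Proof. by move=> intf; exact: integrable_fin_num (cintegrable_normc intf). Qed.

Lemma measurable_convolution_kernel (f K : measurableTypeR R -> R) :
  measurable_fun setT f -> measurable_fun setT K ->
  measurable_fun setT (fun z : measurableTypeR R * measurableTypeR R => (f z.2 * K (z.1 - z.2))%:E).
Proof.
move=> mf mK; apply/measurable_EFinP; apply: measurable_funM.
  exact: measurableT_comp mf measurable_snd.
by apply: measurableT_comp mK _; exact: measurable_funB.
Qed.

Lemma ge0_integral_convolution (f K : R -> R) :
  measurable_fun setT f -> measurable_fun setT K ->
  (forall x, 0 <= f x) -> (forall x, 0 <= K x) ->
  (\int[leb]_x \int[leb]_y (f y * K (x - y))%:E =
   \int[leb]_x (f x)%:E * \int[leb]_x (K x)%:E)%E.
Proof.
move=> mf mK f0 K0.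
pose g (z : measurableTypeR R * measurableTypeR R) := ((f z.2 * K (z.1 - z.2))%:E : \bar R).
have mg : measurable_fun setT g := measurable_convolution_kernel mf mK.
have g0 z : (0 <= g z)%E by rewrite lee_fin mulr_ge0.
transitivity (\int[leb]_y \int[leb]_x g (x, y))%E; first exact: (fubini_tonelli g mg g0).
rewrite -ge0_integralZr//; last 3 first.
- exact/measurable_EFinP.
- by move=> x _; rewrite lee_fin.
- by apply: integral_ge0 => x _; rewrite lee_fin.
apply: eq_integral => y _; rewrite /g /=.
under eq_integral do rewrite EFinM.
rewrite ge0_integralZl//.
- congr (_ * _)%E; rewrite (@ge0_integral_affine R 1 (- y) (fun x => (K x)%:E))//.
  + by rewrite normr1 mul1e; apply: eq_integral => x _; rewrite mul1r.
  exact/measurable_EFinP.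
- by apply/measurable_EFinP; apply: measurableT_comp mK _; exact: measurable_funB.
- by move=> x _; rewrite lee_fin.
- by rewrite lee_fin.
Qed.

(** Young's inequality: the multiplier acts as convolution with its inverse transform, and Tonelli
    with translation invariance bounds the norm of the convolution. *)
Lemma L1_multiplier_of_kernel m : cintegrable leb m ->
  cintegrable leb (inv_fourier m) -> Lp_fourier_multiplier 1 m.
Proof.
move=> intm intK; set K := inv_fourier m in intK *.
pose nK := (\int[leb]_x (normc (K x))%:E)%E.
have nKfin : nK \is a fin_num by exact: cintegral_normc_fin.
have nK0 : (0 <= nK)%E by apply: integral_ge0 => x _; rewrite lee_fin normc_ge0.
exists (2 * fine nK) => f /schwartz_cintegrable intf; split.
  exact: cintegrable_mul_fourier.
have mK := measurable_normc (cintegrable_cmeasurable intK).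
have mf := measurable_normc (cintegrable_cmeasurable intf).
have nf0 x : 0 <= normc (f x) := normc_ge0 _.
have nK0' x : 0 <= normc (K x) := normc_ge0 _.
have mg := measurable_convolution_kernel mf mK.
pose g (z : measurableTypeR R * measurableTypeR R) := ((normc (f z.2) * normc (K (z.1 - z.2)))%:E : \bar R).
have g0 z : (0 <= g z)%E by rewrite lee_fin mulr_ge0.
have step1 x : ((normc (inv_fourier (fun xi => m xi * fourier f xi) x))%:E <=
    2%:E * \int[leb]_y g (x, y))%E.
  rewrite inv_fourier_mul_fourier//.
  apply: le_trans (normc_cintegral_le (cintegrable_conv x intm intf)) _.
  rewrite lee_wpmul2l// le_eqVlt; apply/orP; left; apply/eqP.
  by apply: eq_integral => y _; rewrite ComplexField.Normc.normcM.
rewrite !cLnorm1.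
apply: (@le_trans _ _ (\int[leb]_x (2%:E * \int[leb]_y g (x, y)))%E).
  apply: ge0_le_integral => //.
  - by move=> x _; rewrite lee_fin normc_ge0.
  - apply/measurable_EFinP; apply: measurable_normc.
    have [c1 c2] := inv_fourier_continuous (cintegrable_mul_fourier intm intf).
    by split; exact: continuous_measurable_fun.
  - by apply: measurable_funeM; exact: measurable_fun_fubini_tonelli_F.
rewrite ge0_integralZl//; last 2 first.
- exact: measurable_fun_fubini_tonelli_F.
- by move=> x _; exact: integral_ge0.
have E := ge0_integral_convolution mf mK nf0 nK0'.
rewrite EFinM fineK// -muleA; apply: lee_wpmul2l; first by [].
by rewrite muleC -/nK in E; rewrite -E; exact: lexx.
Qed.

Lemma limn_einf_le_cst (u : (\bar R)^nat) (M : \bar R) :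
  (forall n, u n <= M)%E -> (limn_einf u <= M)%E.
Proof.
move=> uM; rewrite limn_einf_lim; apply: lime_le; first exact: is_cvg_einfs.
apply: nearW => n; rewrite /einfs; apply: ereal_inf_le.
by exists (u n) => //; exists n => /=.
Qed.

Lemma cvg_Rintegral_dominated (f_ : nat -> R -> R) (f g : R -> R) :
  (forall n, measurable_fun setT (f_ n)) -> measurable_fun setT f ->
  (forall x, f_ n x @[n --> \oo] --> f x) ->
  leb.-integrable setT (EFin \o g) -> (forall n x, `|f_ n x| <= g x) ->
  \int[leb]_x f_ n x @[n --> \oo] --> \int[leb]_x f x.
Proof.
move=> mf_ mf cf ig fg.
have [|||||i1 _ i2] := @dominated_convergence _ _ R leb setT measurableT
  (fun n x => (f_ n x)%:E) (EFin \o f) (EFin \o g).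
- by move=> n; apply/measurable_EFinP; exact: mf_.
- by apply/measurable_EFinP; exact: mf.
- by apply: aeW => x _; apply: cvg_EFin; [exact: nearW|exact: cf].
- exact: ig.
- by apply: aeW => x n _; rewrite /= lee_fin.
apply: fine_cvg; rewrite fineK//.
exact: integrable_fin_num i1.
Qed.

(* Fatou's lemma along the approximate identity [k phi (k x)]. *)
Lemma kernel_of_L1_multiplier m (phi : R -> R) : cintegrable leb m ->
  (forall k : nat, schwartz (fun x => (phi (k.+1%:R * x))%:C)) ->
  (forall x, 0 <= phi x) -> 0 < \int[leb]_x phi x ->
  Lp_fourier_multiplier 1 m -> cintegrable leb (inv_fourier m).
Proof.
move=> intm sphi phi0 iphi0 [C HC].
have mphi : cintegrable leb (fun x => (phi x)%:C).
  have := schwartz_cintegrable (sphi 0%N); congr cintegrable.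
  by apply/funext => x; rewrite mul1r.
have iphi : leb.-integrable setT (EFin \o phi) by case: mphi.
set K := inv_fourier m; set I := \int[leb]_x phi x in iphi0 *.
pose nm := fine (\int[leb]_x (normc (m x))%:E)%E.
have KB x : normc (K x) <= nm.
  rewrite -lee_fin fineK; last exact: cintegral_normc_fin.
  exact: normc_inv_fourier_le.
have [cK1 cK2] := inv_fourier_continuous intm.
(* Fatou's lemma is applied to real functions: [P] is the real or the imaginary part, and both
   commute with multiplication by reals and with integration. *)
suff H (P : R[i] -> R) : P = @complex.Re R \/ P = @complex.Im R ->
    continuous (fun x => P (K x)) -> leb.-integrable setT (fun x => (P (K x))%:E).
  by split; [apply: (H (@complex.Re R)) => //; left|apply: (H (@complex.Im R)) => //; right].
move=> HP cP.
have PB z : `|P z| <= normc z by case: HP => ->; [exact: normc_Re|exact: normc_Im].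
have PM (a : R) z : P (a%:C * z) = a * P z by case: HP => ->; case: z => [b c] /=; simpc.
have PI f : P (cintegral leb f) = \int[leb]_x P (f x) by case: HP => ->.
have PIi f : cintegrable leb f -> leb.-integrable setT (fun x => (P (f x))%:E).
  by case: HP => -> [].
(* This is [P] of the convolution of [K] with the approximate identity, after the substitution that
   moves the scale [k.+1] from [phi] to [K]. *)
pose G (k : nat) x := \int[leb]_t (phi t * P (K (x - t / k.+1%:R))).
have kp (k : nat) : 0 < k.+1%:R :> R by rewrite ltr0n.
pose fk (k : nat) := fun x => ((phi (k.+1%:R * x))%:C : R[i]).
have intfk k : cintegrable leb (fk k) by exact/schwartz_cintegrable/sphi.
have GE k x : G k x = k.+1%:R * P (inv_fourier (fun xi => m xi * fourier (fk k) xi) x).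
  rewrite inv_fourier_mul_fourier// PI.
  have ic := PIi _ (cintegrable_conv x intm (intfk k)).
  have k0 : k.+1%:R^-1 != 0 :> R by rewrite invr_eq0 pnatr_eq0.
  rewrite (@Rintegral_affine _ (k.+1%:R^-1) 0 _ k0 ic) ger0_norm ?invr_ge0//.
  rewrite mulrA divff ?pnatr_eq0// mul1r; apply: eq_Rintegral => t _.
  by rewrite addr0 /fk PM mulrA divff ?pnatr_eq0// mul1r [_^-1 * t]mulrC.
have cvgG x : G k x @[k --> \oo] --> P (K x) * I.
  rewrite -RintegralZl//.
  under [X in _ --> X]eq_Rintegral do rewrite mulrC.
  have mphi' : measurable_fun setT phi by apply/measurable_EFinP; exact: measurable_int iphi.
  apply: (@cvg_Rintegral_dominated _ _ (fun t => nm * phi t)).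
  - move=> n; apply: measurable_funM => //.
    apply: continuous_measurable_fun => t.
    apply: (@cvg_comp _ _ _ (fun t => x - t / n.+1%:R) (fun y => P (K y)) _ (nbhs (x - t / n.+1%:R))); last exact: cP.
    apply: cvgB; first exact: cvg_cst.
    by apply: cvgM; [exact: cvg_id|exact: cvg_cst].
  - by apply: measurable_funM.
  - move=> t; apply: cvgM; first exact: cvg_cst.
    apply: (@cvg_comp _ _ _ (fun n : nat => x - t / n.+1%:R) (fun y => P (K y)) _ (nbhs x)); last exact: cP.
    have : (x - t / n.+1%:R) @[n --> \oo] --> x - t * 0; last by rewrite mulr0 subr0.
    apply: cvgB; first exact: cvg_cst.
    by apply: cvgM; [exact: cvg_cst|exact: cvg_harmonic].
  - exact: (integrableZl measurableT nm iphi).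
  - move=> n t; rewrite normrM (ger0_norm (phi0 t)) mulrC ler_wpM2r//.
    exact: le_trans (PB _) (KB _).
(* The norm of [fk k] is [I / k.+1], so the multiplier bound times [k.+1] bounds the norm of every
   [G k] by [C * I], uniformly in [k]. *)
have IK : (\int[leb]_x `|P (K x) * I|%:E <= (C * I)%:E)%E.
  have contG k : continuous (G k).
    have := inv_fourier_continuous (cintegrable_mul_fourier intm (intfk k)) => -[c1 c2].
    have -> : G k = (fun x => k.+1%:R * P (inv_fourier (fun xi => m xi * fourier (fk k) xi) x)).
      by apply/funext => x; rewrite GE.
    by case: HP => -> x; apply: cvgM; [exact: cvg_cst|exact: c1|exact: cvg_cst|exact: c2].
  have := @fatou _ _ R leb setT measurableT (fun k x => `|G k x|%:E).
  have -> : (fun x => limn_einf (fun n => `|G n x|%:E)) = (fun x => `|P (K x) * I|%:E).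
    apply/funext => x; apply: (cvg_limn_einf_sup _).1.
    by apply: cvg_EFin; [exact: nearW|apply: cvg_norm; exact: cvgG].
  move=> H; apply: le_trans (H _ _) _.
  - move=> k; apply/measurable_EFinP; apply: measurableT_comp => //.
    exact: continuous_measurable_fun.
  - by move=> k x _; rewrite lee_fin.
  apply: limn_einf_le_cst => k.
  have [_] := HC _ (sphi k); rewrite !cLnorm1 => Hk.
  apply: (@le_trans _ _ (k.+1%:R%:E * (C%:E * \int[leb]_x (normc (fk k x))%:E))%E).
    apply: le_trans (lee_wpmul2l _ Hk); last by rewrite lee_fin.
    rewrite -ge0_integralZl//; last 2 first.
    + apply/measurable_EFinP/measurable_normc.
      by have [c1 c2] := inv_fourier_continuous (cintegrable_mul_fourier intm (intfk k));
        split; exact: continuous_measurable_fun.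
    + by move=> x _; rewrite lee_fin normc_ge0.
    apply: ge0_le_integral => //.
    + by apply/measurable_EFinP; apply: measurableT_comp => //; exact: continuous_measurable_fun.
    + apply: measurable_funeM; apply/measurable_EFinP/measurable_normc.
      by have [c1 c2] := inv_fourier_continuous (cintegrable_mul_fourier intm (intfk k));
        split; exact: continuous_measurable_fun.
    + by move=> x _; rewrite -EFinM lee_fin GE normrM ger0_norm// ler_wpM2l.
  rewrite muleCA EFinM.
  suff -> : (k.+1%:R%:E * \int[leb]_x (normc (fk k x))%:E = I%:E :> \bar R)%E by [].
  rewrite /I /Rintegral fineK; last exact: integrable_fin_num iphi.
  rewrite (@ge0_integral_affine R k.+1%:R 0 (EFin \o phi))//.
  - rewrite ger0_norm//; congr (_ * _)%E; apply: eq_integral => x _.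
    by rewrite /fk normc_real ger0_norm// /= addr0.
  - exact: measurable_int iphi.
apply/integrableP; split.
  by apply/measurable_EFinP; exact: continuous_measurable_fun.
have : (I%:E * \int[leb]_x `|(P (K x))%:E| < +oo)%E.
  rewrite -ge0_integralZl//; last 2 first.
  - by apply/measurable_EFinP; apply: measurableT_comp => //; exact: continuous_measurable_fun.
  - by rewrite lee_fin ltW.
  apply: le_lt_trans (ltry (C * I)); apply: le_trans IK.
  rewrite le_eqVlt; apply/orP; left; apply/eqP; apply: eq_integral => x _.
  by rewrite normrM (gtr0_norm iphi0) mulrC.
by rewrite !ltey; apply: contraNN => /eqP ->; rewrite gt0_muley.
Qed.
End multiplier.

(** * Smooth functions with compact support *)

Section smooth_algebra.
Context {R : realType}.
Implicit Types f g : R -> R.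

(** The recursion replaces [f] by its first derivative instead of looking at the last one, so that
    the sum, Leibniz and dilation rules go through by induction on [n]. *)
Fixpoint derivable_upto (n : nat) f : Prop :=
  if n is n'.+1 then (forall x, derivable f x 1) /\ derivable_upto n' (derive1 f)
  else forall x, derivable f x 1.

Lemma smoothP f : smooth f <-> forall n, derivable_upto n f.
Proof.
split=> [sf n|H].
  elim: n f sf => [|n IH] f sf /=; first exact: (sf 0%N).
  by split; [exact: (sf 0%N)|apply: IH => k x; rewrite -derive1Sn].
move=> n; elim: n f H => [|n IH] f H x; first exact: (H 0%N).
by rewrite derive1Sn; apply: IH => k; have [] := H k.+1.
Qed.

Lemma derivable_uptoS n f : derivable_upto n.+1 f -> derivable_upto n f.
Proof.
elim: n f => [|n IH] f [H1 H2]; first exact: H1.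
by split=> //; exact: IH.
Qed.

Lemma derivable_uptoD n f g : derivable_upto n f -> derivable_upto n g ->
  derivable_upto n (f \+ g).
Proof.
elim: n f g => [|n IH] f g /=; first by move=> df dg x; exact: derivableD.
move=> [df Df] [dg Dg]; split; first by move=> x; exact: derivableD.
have -> : derive1 (f \+ g) = derive1 f \+ derive1 g.
  by apply/funext => x; rewrite /= !derive1E; exact: (deriveD (df x) (dg x)).
exact: IH.
Qed.

Lemma derivable_uptoM n f g : derivable_upto n f -> derivable_upto n g ->
  derivable_upto n (f \* g).
Proof.
elim: n f g => [|n IH] f g; first by move=> df dg x; exact: derivableM.
move=> Df Dg; have df := derivable_uptoS Df; have dg := derivable_uptoS Dg.
move: Df Dg => [df1 Df] [dg1 Dg]; split; first by move=> x; exact: derivableM.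
have -> : derive1 (f \* g) = (f \* derive1 g) \+ (g \* derive1 f).
  by apply/funext => x; rewrite /= !derive1E; exact: (deriveM (df1 x) (dg1 x)).
by apply: derivable_uptoD; exact: IH.
Qed.

Lemma derivable_upto_cst n (c : R) : derivable_upto n (fun=> c).
Proof.
elim: n c => [|n IH] c /=; first by move=> x; exact: derivable_cst.
split; first by move=> x; exact: derivable_cst.
have -> : derive1 (fun=> c) = fun=> 0 by apply/funext => x; rewrite derive1_cst.
exact: IH.
Qed.

Lemma is_derive_scale (a : R) f x : derivable f (a * x) 1 ->
  is_derive x 1 (fun x => f (a * x)) (derive1 f (a * x) * a).
Proof.
move=> df; apply: (@is_derive1_comp _ f (fun x => a * x)).
  by rewrite derive1E; exact: derivableP.
by have := @is_deriveZ R R R id a x 1 1 (is_derive_id x 1); rewrite /GRing.scale/= mulr1.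
Qed.

Lemma derivable_scale (a : R) f x : derivable f (a * x) 1 -> derivable (fun x => f (a * x)) x 1.
Proof. by move=> /is_derive_scale[]. Qed.

Lemma derive1_scale (a : R) f x : derivable f (a * x) 1 ->
  derive1 (fun x => f (a * x)) x = a * derive1 f (a * x).
Proof.
move=> df; rewrite mulrC [LHS]derive1E; have H := is_derive_scale df; exact: derive_val.
Qed.

Lemma derivable_upto_scale n (a : R) f : derivable_upto n f ->
  derivable_upto n (fun x => f (a * x)).
Proof.
elim: n f => [|n IH] f /=; first by move=> df x; exact: derivable_scale.
move=> [df Df]; split; first by move=> x; exact: derivable_scale.
have -> : derive1 (fun x => f (a * x)) = (fun=> a) \* (fun x => derive1 f (a * x)).
  by apply/funext => x; rewrite derive1_scale.
by apply: derivable_uptoM; [exact: derivable_upto_cst|exact: IH].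
Qed.

Lemma smooth_sqrD f g (a : R) : smooth f -> smooth g ->
  smooth (fun x => f (a * x) ^+ 2 + g (a * x) ^+ 2).
Proof.
move=> /smoothP sf /smoothP sg; apply/smoothP => n.
by apply: derivable_uptoD; apply: derivable_uptoM; exact: derivable_upto_scale.
Qed.

Lemma derive1n_support f (M : R) n : (forall x, M < `|x| -> f x = 0) ->
  forall x, M < `|x| -> derive1n n f x = 0.
Proof.
move=> f0; elim: n => [//|n IH] x Mx; rewrite derive1nS derive1E.
rewrite (@near_eq_derive _ _ _ _ (fun=> 0)); first by rewrite derive_cst.
near=> y; apply: IH; near: y.
by apply: (@cvgr_gt _ _ _ _ (fun y : R => `|y|) `|x|) => //; exact: norm_continuous.
Unshelve. all: by end_near. Qed.

Lemma compact_support_rapidly_decreasing f (M : R) : smooth f ->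
  (forall x, M < `|x| -> f x = 0) -> rapidly_decreasing f.
Proof.
move=> sf f0 k n; pose g x := `|x| ^+ k * `|derive1n n f x|.
have cg : continuous g.
  move=> x; apply: cvgM.
    apply: (@continuous_comp _ _ _ (fun x : R => `|x|) (fun y => y ^+ k)); first exact: norm_continuous.
    exact: exprn_continuous.
  apply: cvg_norm; apply/differentiable_continuous/derivable1_diffP; exact: sf.
have [M0|M0] := leP 0 M; last first.
  exists 0 => x; rewrite (derive1n_support _ f0) ?normr0 ?mulr0//.
  exact: lt_le_trans M0 _.
have MM : - M <= M by rewrite (le_trans _ M0)// oppr_le0.
have [c _ Hc] := EVT_max MM (continuous_subspaceT cg).
exists (Num.max (g c) 0) => x; have [xM|Mx] := leP `|x| M.
  by rewrite le_max; apply/orP; left; apply: Hc; rewrite in_itv/= -ler_norml.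
by rewrite (derive1n_support _ f0)// normr0 mulr0 le_max lexx orbT.
Qed.
End smooth_algebra.

Section test_function_facts.
Context {R : realType}.
Notation leb := (@lebesgue_measure R).
Variable chi : R -> R[i].
Hypothesis hchi : test_function chi.

(** The radius is taken at least 1 so that the shifts [t <= 1] used in the modulus of continuity
    never exceed it. *)
Lemma test_function_support : exists2 M : R, 1 <= M & forall x, M < `|x| -> chi x = 0.
Proof.
have [_ /compact_bounded[M0 [_ HM]]] := hchi.
exists (Num.max 1 (M0 + 1)); first by rewrite le_max lexx.
move=> x; rewrite gt_max => /andP[_ Mx].
apply/eqP; apply/negP => /negP x0.
have := HM (M0 + 1) ltac:(by rewrite ltrDl) x.
have : closure [set x : R | chi x != 0] x by apply: subset_closure.
by move=> /[swap] /[apply] /=; rewrite leNgt Mx.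
Qed.

Lemma test_function_continuous : continuous (fun x => complex.Re (chi x)) /\
  continuous (fun x => complex.Im (chi x)).
Proof. by have [[s1 s2] _] := hchi; split; [exact: smooth_continuous s1|exact: smooth_continuous s2]. Qed.

(** The squared modulus of [chi] is smooth, compactly supported and nonnegative. It is the profile
    of the approximate identity, a role that [chi] itself, complex-valued and possibly of varying
    sign, cannot play. *)
Definition chi_sqr (x : R) := complex.Re (chi x) ^+ 2 + complex.Im (chi x) ^+ 2.

Lemma schwartz_chi_sqr (k : nat) : schwartz (fun x => (chi_sqr (k.+1%:R * x))%:C).
Proof.
have [[s1 s2] _] := hchi; have [M M1 HM] := test_function_support.
have s : smooth (fun x => chi_sqr (k.+1%:R * x))
  by have H := @smooth_sqrD _ _ _ k.+1%:R s1 s2; rewrite /chi_sqr; apply H.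
have z : smooth (fun=> 0 : R) by apply/smoothP => n; exact: derivable_upto_cst.
split; [by split| |exact: (@compact_support_rapidly_decreasing _ (fun=> 0) M z)].
apply: (@compact_support_rapidly_decreasing _ _ M) => //= x Mx.
rewrite /chi_sqr HM ?expr0n ?addr0// normrM ger0_norm//.
by rewrite (lt_le_trans Mx)// ler_peMl// ler1n.
Qed.
End test_function_facts.

Section positive_integral.
Context {R : realType}.
Notation leb := (@lebesgue_measure R).

Lemma Rintegral_ge_box (f : R -> R) (c a b : R) : leb.-integrable setT (EFin \o f) ->
  (forall x, 0 <= f x) -> 0 <= c -> a <= b -> (forall x, a <= x <= b -> c <= f x) ->
  c * (b - a) <= \int[leb]_x f x.
Proof.
move=> intf f0 c0 ab cf.
rewrite -lee_fin /Rintegral fineK; last exact: integrable_fin_num.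
have mf := measurable_int _ intf.
apply: (@le_trans _ _ (\int[leb]_(x in `[a, b]) (f x)%:E)%E); last first.
  by apply: ge0_subset_integral => // x _; rewrite lee_fin.
have L : leb `[a, b] = (b - a)%:E.
  rewrite lebesgue_measure_itv/= lte_fin.
  move: ab; rewrite le_eqVlt => /predU1P[->|->]; last by rewrite EFinB.
  by rewrite ltxx subrr.
rewrite EFinM -L -integral_cst//.
by apply: ge0_le_integral => //; exact: measurable_funTS.
Qed.

Lemma Rintegral_gt0 (f : R -> R) (x0 : R) : continuous f -> (forall x, 0 <= f x) ->
  leb.-integrable setT (EFin \o f) -> 0 < f x0 -> 0 < \int[leb]_x f x.
Proof.
move=> cf f0 intf fx0.
have : \forall x \near x0, f x0 / 2 < f x.
  have /cvgrPdist_lt/(_ (f x0 / 2)) := cf x0.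
  move=> /(_ (divr_gt0 fx0 (ltr0n _ 2))); apply: filterS => x.
  by rewrite ltr_norml => /andP[_ ?]; lra.
move=> /nbhs_ballP[e e0 He]; have {}e0 : 0 < e := e0.
apply: (@lt_le_trans _ _ (f x0 / 2 * ((x0 + e / 2) - (x0 - e / 2)))).
  by rewrite mulr_gt0 ?divr_gt0//; lra.
apply: Rintegral_ge_box => //; first by rewrite divr_ge0// ltW.
  by lra.
move=> x /andP[x1 x2]; rewrite ltW//; apply: He.
by rewrite /ball/= ltr_norml; apply/andP; split; lra.
Qed.
End positive_integral.

Section multiplier_iff.
Context {R : realType}.
Notation leb := (@lebesgue_measure R).

Lemma L1_multiplierP (m chi : R -> R[i]) : test_function chi ->
  (exists x, chi x <> 0) -> cintegrable leb m ->
  Lp_fourier_multiplier 1 m <-> cintegrable leb (inv_fourier m).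
Proof.
move=> hchi [x0 chix0] intm; split; last exact: L1_multiplier_of_kernel.
have [c1 c2] := test_function_continuous hchi.
have p0 x : 0 <= chi_sqr chi x by rewrite addr_ge0 ?sqr_ge0.
apply: (@kernel_of_L1_multiplier _ _ (chi_sqr chi)) => //; first exact: schwartz_chi_sqr.
apply: (@Rintegral_gt0 _ _ x0) => //.
- by move=> x; apply: cvgD; apply: cvgM; [exact: c1|exact: c1|exact: c2|exact: c2].
- have [H _] := schwartz_cintegrable (schwartz_chi_sqr hchi 0).
  by apply: eq_integrable H => // x _ /=; rewrite mul1r.
rewrite lt_neqAle p0 andbT eq_sym /chi_sqr paddr_eq0 ?sqr_ge0// !sqrf_eq0.
apply/negP => /andP[/eqP a /eqP b]; apply: chix0.
by move: a b; case: (chi x0) => a b /= -> ->.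
Qed.
End multiplier_iff.

(** * The kernel of the convolution of a measure with a singular function *)

Section measure_convolution.
Context {R : realType}.
Notation leb := (@lebesgue_measure R).
Variables (mu : probability (measurableTypeR R) R) (h : R -> R[i]).
Hypothesis inth : cintegrable leb h.

Let m (xi : R) : R[i] := cintegral mu (fun eta : measurableTypeR R => h (xi - eta)).

(** Translation invariance makes the integral over the first variable equal to the norm of [h],
    whatever the second one is, and [mu] has mass 1. *)
Lemma cintegrable_convolution_kernel (x : R) :
  cintegrable (leb \x mu)%E (fun z : measurableTypeR R * measurableTypeR R =>
    cis (pi * x * z.1) * h (z.1 - z.2)).
Proof.
have mh := cintegrable_cmeasurable inth.
have mF : cmeasurable (fun z : measurableTypeR R * measurableTypeR R => h (z.1 - z.2)).
  have ms : measurable_fun setT (fun z : measurableTypeR R * measurableTypeR R => z.1 - z.2).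
    exact: measurable_funB.
  by move: mh => [h1 h2]; split; [exact: measurableT_comp h1 ms|exact: measurableT_comp h2 ms].
apply: (@cintegrableM_bounded _ _ _ _ _ _ 1) => [|z|].
- apply: cmeasurable_cis; apply: measurableT_comp measurable_fst; exact: measurable_mulr3.
- by rewrite normc_cis.
apply/cintegrable_prodP => //.
pose g (z : measurableTypeR R * measurableTypeR R) := ((normc (h (z.1 - z.2)))%:E : \bar R).
have mg : measurable_fun setT g by apply/measurable_EFinP; exact: measurable_normc.
have g0 z : (0 <= g z)%E by rewrite lee_fin normc_ge0.
suff -> : (\int[leb]_x \int[mu]_y (normc (h ((x, y).1 - (x, y).2)))%:E =
    \int[leb]_x (normc (h x))%:E)%E.
  exact/(cintegrableP _ mh).
transitivity (\int[mu]_y \int[leb]_x g (x, y))%E; first exact: (fubini_tonelli g mg g0).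
have E y : (\int[leb]_x g (x, y) = \int[leb]_x (normc (h x))%:E)%E.
  rewrite [RHS](@ge0_integral_affine R 1 (- y) (fun x => (normc (h x))%:E))//.
  - by rewrite normr1 mul1e; apply: eq_integral => u _; rewrite mul1r.
  - by apply/measurable_EFinP; exact: measurable_normc.
  - by move=> u; rewrite lee_fin normc_ge0.
under eq_integral do rewrite E.
have := @integral_cst _ _ R mu setT measurableT (\int[leb]_x (normc (h x))%:E)%E.
by move=> ->; rewrite -[RHS]mule1; congr (_ * _)%E; exact: probability_setT.
Qed.

Lemma cintegrable_measure_convolution : cintegrable leb m.
Proof.
have := cintegrable_fubini1 (cintegrable_convolution_kernel 0).
congr cintegrable; apply/funext => xi; apply: eq_cintegral => eta.
by rewrite mulr0 mul0r cis0 mul1r.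
Qed.

Lemma inv_fourier_measure_convolution (x : R) : inv_fourier m x =
  (2^-1)%:C * (cintegral mu (fun eta : measurableTypeR R => cis (pi * x * eta)) *
    cintegral leb (fun u => cis (pi * x * u) * h u)).
Proof.
have iK := cintegrable_convolution_kernel x.
rewrite /inv_fourier; congr (_ * _).
transitivity (cintegral leb (fun xi => cintegral mu (fun eta : measurableTypeR R =>
    cis (pi * x * xi) * h (xi - eta)))).
  (* Pulling the phase out of the inner integral requires [h (xi - eta)] to be [mu]-integrable in
     [eta], which Fubini grants only for almost every [xi]. *)
  apply: ae_eq_cintegral.
  - apply: cmeasurableM; first by apply: cmeasurable_cis; exact: measurable_mulr3.
    exact: cintegrable_cmeasurable cintegrable_measure_convolution.
  - exact: cintegrable_cmeasurable (cintegrable_fubini1 iK).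
  have := cintegrable_ae1 (cintegrable_convolution_kernel 0).
  apply: filterS => xi /= H; rewrite /m -cintegralZ//.
  move: H; congr cintegrable; apply/funext => eta.
  by rewrite mulr0 mul0r cis0 mul1r.
transitivity (cintegral mu (fun eta : measurableTypeR R => cintegral leb (fun xi =>
    cis (pi * x * xi) * h (xi - eta)))); first exact: (cfubini iK).
rewrite [RHS]mulrC -cintegralZ; last first.
  apply: (@cintegrable_le _ _ _ mu _ (fun=> 1)).
  - by apply: cmeasurable_cis; exact: measurable_mulr3.
  - exact: finite_measure_integrable_cst.
  - by move=> eta; rewrite normc_cis.
apply: eq_cintegral => eta.
have ih : cintegrable leb (fun xi : R => cis (pi * x * xi) * h (xi - eta)).
  apply: cintegrable_cis.
  have := @cintegrable_affine R 1 (- eta) h (oner_neq0 _) inth.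
  by congr cintegrable; apply/funext => u; rewrite mul1r.
rewrite (@cintegral_affine R 1 eta _ (oner_neq0 _) ih) normr1 mul1r [RHS]mulrC -cintegralZ.
  apply: eq_cintegral => u; rewrite mul1r addrK mulrA -cisD; congr (cis _ * _).
  by rewrite mulrDr addrC.
exact: cintegrable_cis.
Qed.
End measure_convolution.

Lemma le_eq_integral d (T : measurableType d) (R : realType)
    (mu : {measure set T -> \bar R}) (D : set T) (f g : T -> \bar R) :
  {in D, f =1 g} -> (\int[mu]_(x in D) f x <= \int[mu]_(x in D) g x)%E.
Proof. by move=> /eq_integral ->. Qed.

(** * Integrals of powers up to the singularity *)

Section power_integral.
Context {R : realType}.
Notation leb := (@lebesgue_measure R).

Lemma ge0_integral_affine_set (a b : R) (D : set R) (f : R -> \bar R) : a != 0 ->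
  measurable D -> measurable_fun setT f -> (forall x, 0 <= f x)%E ->
  (\int[leb]_(x in D) f x =
   `|a|%:E * \int[leb]_(x in (fun x => (a * x + b)%R) @^-1` D) f (a * x + b)%R)%E.
Proof.
move=> a0 mD mf f0; rewrite [LHS]integral_mkcond [in RHS]integral_mkcond.
rewrite (@ge0_integral_affine R a b)//.
- by apply/measurable_restrict => //; rewrite setTI; exact: measurable_funTS.
- by move=> x; rewrite erestrict_ge0.
Qed.

Lemma measurable_powR_norm (p : R) : measurable_fun setT (fun u : R => `|u| `^ p).
Proof. exact: (measurableT_comp (@measurable_powR R p) (@normr_measurable R setT)). Qed.

Variable p : R.
Hypothesis p1 : -1 < p.

Lemma integral_powR_pos (a b : R) : 0 < a -> a < b ->
  (\int[leb]_(u in `[a, b]) (u `^ p)%:E = ((b `^ (p + 1) - a `^ (p + 1)) / (p + 1))%:E)%E.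
Proof.
move=> a0 ab.
have p10 : p + 1 != 0 by rewrite gt_eqF// -ltrBlDr sub0r.
pose F (u : R) := u `^ (p + 1) / (p + 1).
have dF (x : R) : 0 < x -> is_derive x 1 F (x `^ p).
  move=> x0; have H := is_derive1_powR (p + 1) x0.
  have := @is_deriveZ R R R (fun u => u `^ (p + 1)) (p + 1)^-1 x 1 _ H.
  rewrite addrK /GRing.scale/= mulKf// => H'.
  have -> : F = (p + 1)^-1 \*: (fun u => u `^ (p + 1)).
    by apply/funext => u; rewrite /F mulrC.
  exact: H'.
have cF (x : R) : 0 < x -> {for x, continuous F}.
  move=> x0; apply/differentiable_continuous/derivable1_diffP.
  by have [] := dF _ x0.
rewrite (@continuous_FTC2 R (fun u => u `^ p) F)//.
- by rewrite -EFinB /F -mulrBl.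
- apply: continuous_in_subspaceT => x; rewrite inE/= in_itv/= => /andP[ax _].
  apply/differentiable_continuous/derivable1_diffP.
  by have [] := is_derive1_powR p (lt_le_trans a0 ax).
- split.
  + by move=> x; rewrite in_itv/= => /andP[ax _]; have [] := dF _ (lt_trans a0 ax).
  + by apply: cvg_at_right_filter; exact: cF.
  + by apply: cvg_at_left_filter; apply: cF; exact: lt_trans ab.
- move=> x; rewrite in_itv/= => /andP[ax _]; rewrite derive1E.
  by have [_ <-] := dF _ (lt_trans a0 ax).
Qed.

(** The fundamental theorem of calculus is applied on compact intervals away from 0, and monotone
    convergence carries the bound to the singularity. *)
Lemma integral_powR_oc_le (b : R) : 0 < b ->
  (\int[leb]_(u in `]0%R, b]) (u `^ p)%:E <= (b `^ (p + 1) / (p + 1))%:E)%E.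
Proof.
move=> b0.
have p10 : 0 < p + 1 by rewrite -ltrBlDr sub0r.
have mf : measurable_fun setT (fun u : R => (u `^ p)%:E).
  by apply/measurable_EFinP; exact: measurable_powR.
(* Dividing by [n.+2] rather than [n.+1] keeps the left endpoint strictly below [b], as
   [integral_powR_pos] requires. *)
pose A (n : nat) : set R := `[b / n.+2%:R, b]%classic.
have bn (n : nat) : 0 < b / n.+2%:R by rewrite divr_gt0.
have UA : \bigcup_n A n = `]0, b]%classic.
  apply/seteqP; split=> [x [n _]|x]; rewrite /A /= !in_itv/=.
    by move=> /andP[x1 ->]; rewrite (lt_le_trans (bn n)).
  move=> /andP[x0 xb]; have := @archi_boundP R (b / x) (divr_ge0 (ltW b0) (ltW x0)).
  set n := Num.bound _ => Hn; exists n => //=; rewrite in_itv/= xb andbT.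
  rewrite ler_pdivrMr// mulrC -ler_pdivrMr// (le_trans (ltW Hn))// ler_nat.
  by rewrite (leq_trans (leqnSn _)).
have ndA : nondecreasing_seq A.
  apply/nondecreasing_seqP => n; apply/subsetPset => x; rewrite /A /= !in_itv/=.
  move=> /andP[x1 ->]; rewrite andbT (le_trans _ x1)// ler_pM2l// lef_pV2 ?posrE//.
  by rewrite ler_nat.
have H := @ge0_nondecreasing_set_cvg_integral _ (measurableTypeR R) R A (fun u => (u `^ p)%:E) leb.
rewrite UA in H; apply: (cvge_to_le (H _ _ _ _)) => //.
- by move=> n; exact: measurable_itv.
- by move=> n; exact: measurable_funTS.
- by move=> n x _; rewrite lee_fin powR_ge0.
apply: nearW => n; rewrite /A integral_powR_pos//; last first.
  by rewrite ltr_pdivrMr// ltr_pMr// ltr1n.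
by rewrite lee_fin ler_pM2r ?invr_gt0// lerBlDr lerDl powR_ge0.
Qed.
End power_integral.

(** * Decay of the Fourier transform of the singular function *)

Section shift_modulus.
Context {R : realType}.
Notation leb := (@lebesgue_measure R).
Variables (p M : R).
Hypotheses (p1 : -1 < p) (M1 : 1 <= M).
Let k (u : R) : R := `|u| `^ p.
Let F (b : R) := b `^ (p + 1) / (p + 1).
(** Bounds [k] between [M] and [M + t] for nonnegative [p]: this is the piece that remains beyond
    [M] after telescoping. *)
Let CM := Num.max 1 ((M + 1) `^ p).

Let p10 : 0 < p + 1. Proof. by rewrite -ltrBlDr sub0r. Qed.

Let k0 u : 0 <= k u. Proof. exact: powR_ge0. Qed.

Let mk : measurable_fun setT (fun u => (k u)%:E).
Proof. by apply/measurable_EFinP; exact: measurable_powR_norm. Qed.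

Let mkt (t : R) : measurable_fun setT (fun u : R => k (u + t)).
Proof.
apply: (@measurableT_comp _ _ _ _ _ _ k _ (fun u : R => u + t)); first exact: measurable_powR_norm.
exact: measurable_funD.
Qed.

Let mdiff (t : R) : measurable_fun setT (fun u : R => `|k u - k (u + t)|%:E).
Proof.
apply/measurable_EFinP; apply: measurableT_comp => //; apply: measurable_funB => //.
exact: measurable_powR_norm.
Qed.

Let ek0 u : (0 <= (k u)%:E)%E. Proof. by rewrite lee_fin. Qed.

Let kN u : k (- u) = k u. Proof. by rewrite /k normrN. Qed.

Let F_ge0 b : 0 <= F b. Proof. by rewrite divr_ge0 ?powR_ge0// ltW. Qed.

Let int_k_pos (b : R) : 0 < b -> (\int[leb]_(u in `]0%R, b]) (k u)%:E <= (F b)%:E)%E.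
Proof.
move=> b0; apply: le_trans (integral_powR_oc_le p1 b0); apply: le_eq_integral => u.
by rewrite inE/= in_itv/= => /andP[u0 _]; rewrite /k gtr0_norm.
Qed.

Let int_k_neg (b : R) : 0 < b -> (\int[leb]_(u in `[(- b)%R, 0%R]) (k u)%:E <= (F b)%:E)%E.
Proof.
move=> b0; rewrite (@ge0_integral_affine_set _ (-1) 0)// ?oppr_eq0 ?oner_eq0//.
rewrite normrN normr1 mul1e.
have -> : (fun x : R => -1 * x + 0) @^-1` `[- b, 0] = `[0, b]%classic.
  apply/seteqP; split => x /=; rewrite !in_itv/= addr0 mulN1r => /andP[x1 x2];
    apply/andP; split; lra.
under eq_integral do rewrite addr0 mulN1r kN.
rewrite -integral_itv_obnd_cbnd; first exact: int_k_pos.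
exact: measurable_funTS.
Qed.

Let kmono (t u : R) : 0 < t -> 0 < u -> if 0 <= p then k u <= k (u + t) else k (u + t) <= k u.
Proof.
move=> t0 u0; rewrite /k !gtr0_norm ?addr_gt0//; have uut : u <= u + t by rewrite lerDl ltW.
have [u0' ut0'] : 0 <= u /\ 0 <= u + t by split; [exact: ltW|rewrite addr_ge0// ltW].
case: ifPn => [p0|]; first by apply: ge0_ler_powR.
rewrite -ltNge => p0; have : u `^ (- p) <= (u + t) `^ (- p).
  by apply: ge0_ler_powR; rewrite ?nnegrE// oppr_ge0 ltW.
by rewrite !powRN lef_pV2// ?posrE powR_gt0// addr_gt0.
Qed.

(* [k] is monotone on the half-line, so the integrand has constant sign and the
   integral telescopes. *)
Let mono_shift (t : R) : 0 < t <= 1 ->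
  (\int[leb]_(u in `]0%R, M]) `|k u - k (u + t)|%:E <= (F t + t * CM)%:E)%E.
Proof.
move=> /andP[t0 t1].
have tM : t <= M by exact: le_trans t1 M1.
pose I (a b : R) := (\int[leb]_(u in `]a, b]) (k u)%:E)%E.
have I_add a b c : a <= b -> b <= c -> I a c = (I a b + I b c)%E.
  move=> ab bc; rewrite /I (@itv_bndbnd_setU _ _ (BRight a) (BRight b) (BRight c)) ?bnd_simp//.
  rewrite ge0_integral_setU//; first exact: measurable_funTS.
  by apply/disj_setPS => y [/=]; rewrite !in_itv/= => /andP[_ yb] /andP[]; rewrite ltNge yb.
have I_ge0 a b : (0 <= I a b)%E by apply: integral_ge0.
have I_mono a b c d : a <= b -> c <= d -> (I b c <= I a d)%E.
  move=> ab cd; apply: ge0_subset_integral => //; first exact: measurable_funTS.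
  by move=> x /=; rewrite !in_itv/= => /andP[bx xc]; rewrite (le_lt_trans ab)// (le_trans xc).
have I0fin (b : R) : 0 < b -> I 0 b \is a fin_num.
  by move=> b0; rewrite ge0_fin_numE//; apply: le_lt_trans (int_k_pos b0) (ltry _).
have shiftE : (\int[leb]_(u in `]0%R, M]) (k (u + t)%R)%:E = I t (M + t)%R)%E.
  rewrite /I [RHS](@ge0_integral_affine_set _ 1 t)// ?oner_eq0// normr1 mul1e.
  have -> : (fun x : R => 1 * x + t) @^-1` `]t, M + t] = `]0, M]%classic.
    by apply/seteqP; split => x /=; rewrite !in_itv/= mul1r lerD2r ltrDr.
  by apply: eq_integral => u _; rewrite mul1r.
have mA := mdiff t.
set A := (\int[leb]_(u in _) _)%E.
have M0 : 0 < M by exact: lt_le_trans M1.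
have mA0 : measurable_fun `]0, M]%classic (fun u : R => `|k u - k (u + t)|%:E).
  exact: measurable_funTS.
have mk0 : measurable_fun `]0, M]%classic (fun u : R => (k u)%:E) by exact: measurable_funTS.
have mkt0 : measurable_fun `]0, M]%classic (fun u : R => (k (u + t))%:E).
  by apply: measurable_funTS; exact/measurable_EFinP.
(* Both cases are stated as sums of nonnegative extended reals, where no difference has to be given
   a meaning; the common finite part is cancelled at the end. *)
have pos_case : 0 <= p -> (A + I 0%R M = I t (M + t)%R)%E.
  move=> p0; rewrite -shiftE -ge0_integralD//; apply: eq_integral => u.
  rewrite inE/= in_itv/= => /andP[u0 uM]; rewrite -EFinD; congr EFin.
  have := kmono t0 u0; rewrite p0 => kk.
  by rewrite distrC ger0_norm ?subr_ge0// subrK.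
have neg_case : p < 0 -> (A + I t (M + t)%R = I 0%R M)%E.
  move=> p0; rewrite -shiftE -ge0_integralD//; apply: eq_integral => u.
  rewrite inE/= in_itv/= => /andP[u0 uM]; rewrite -EFinD; congr EFin.
  have := kmono t0 u0; rewrite leNgt p0/= => kk.
  by rewrite ger0_norm ?subr_ge0// subrK.
have top_le : 0 <= p -> (I M (M + t)%R <= (t * CM)%:E)%E.
  move=> p0; apply: (@le_trans _ _ (\int[leb]_(u in `]M, (M + t)%R]) (cst CM%:E) u)%E).
    apply: ge0_le_integral => //; first exact: measurable_funTS.
    move=> u /=; rewrite in_itv/= => /andP[Mu uMt]; rewrite lee_fin /k.
    have u0 := lt_trans M0 Mu.
    rewrite gtr0_norm// /CM le_max; apply/orP; right.
    apply: ge0_ler_powR; rewrite ?nnegrE ?(ltW u0) ?addr_ge0 ?(ltW M0)//.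
    by rewrite (le_trans uMt)// lerD2l.
  rewrite integral_cst//= lebesgue_measure_itv/= lte_fin ltrDl t0 -EFinB addrAC subrr add0r.
  by rewrite -EFinM lee_fin mulrC.
have bot_le : (I 0%R t <= (F t)%:E)%E by exact: int_k_pos.
have CM0 : 0 <= t * CM by rewrite mulr_ge0 ?(ltW t0)// le_max ler01.
have Ft0 := F_ge0 t.
have Mt : M <= M + t by rewrite lerDl ltW.
have t0' := ltW t0.
have fin0 := I0fin _ M0.
clear mA0 mk0 mkt0 mA shiftE I0fin.
clearbody A I.
have [p0|p0] := leP 0 p.
- suff : (A + I 0%R M <= I M (M + t)%R + I 0%R M)%E.
    rewrite leeD2rE// => H; apply: le_trans H _; apply: le_trans (top_le p0) _.
    by rewrite lee_fin lerDr.
  rewrite pos_case// (I_add t M (M + t))// addeC; apply: leeD; first exact: lexx.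
  exact: I_mono.
- suff : (A + I t M <= I 0%R t + I t M)%E.
    rewrite leeD2rE => [H|].
      by apply: le_trans H _; apply: le_trans bot_le _; rewrite lee_fin lerDl.
    rewrite ge0_fin_numE; last exact: I_ge0.
    apply: le_lt_trans (I_mono 0 t M M t0' (lexx _)) _.
    by rewrite -ge0_fin_numE//; exact: I_ge0.
  rewrite -I_add// -neg_case//; apply: leeD; first exact: lexx.
  by apply: I_mono.
Qed.

(** The interval is cut at [- t] and 0. The reflection of [u] into [- t - u] reduces the left piece
    to the right one, and [mono_shift] bounds each by [F t + t * CM]. Between [- t] and 0 the two
    singularities sit at the ends, and the plain triangle inequality costs [2 * F t]. *)
Lemma shift_modulus_powR (t : R) : 0 < t <= 1 ->
  (\int[leb]_(u in `[(- M)%R, M]) `|k u - k (u + t)|%:E <= (4 * F t + 2 * (t * CM))%:E)%E.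
Proof.
move=> t01; have /andP[t0 t1] := t01.
have tM : t <= M by exact: le_trans t1 M1.
have M0 : 0 < M by exact: lt_le_trans M1.
pose f (u : R) := (`|k u - k (u + t)|%:E : \bar R).
have mf : measurable_fun setT f := mdiff t.
have f0 u : (0 <= f u)%E by rewrite lee_fin.
have -> : `[- M, M]%classic = `[- M, - t[%classic `|` (`[- t, 0]%classic `|` `]0, M]%classic).
  rewrite -(@itv_bndbnd_setU _ _ (BLeft (- t)) (BRight 0) (BRight M)) ?bnd_simp ?oppr_le0 ?ltW//.
  rewrite -(@itv_bndbnd_setU _ _ (BLeft (- M)) (BLeft (- t)) (BRight M)) ?bnd_simp ?lerN2//.
  lra.
have dj1 : [disjoint `[- M, - t[%classic & `[- t, 0]%classic `|` `]0, M]%classic].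
  apply/disj_setPS => y [/=]; rewrite !in_itv/= => /andP[_ yt] [/andP[]|/andP[]]; lra.
have dj2 : [disjoint `[- t, 0]%classic & `]0, M]%classic].
  by apply/disj_setPS => y [/=]; rewrite !in_itv/= => /andP[_ yt] /andP[]; lra.
rewrite ge0_integral_setU//; last 2 first.
- exact: measurableU.
- exact: measurable_funTS.
rewrite [X in (_ + X)%E]ge0_integral_setU//; last exact: measurable_funTS.
have H3 := mono_shift t01.
have H1 : (\int[leb]_(u in `[(- M)%R, (- t)%R[) f u <= (F t + t * CM)%:E)%E.
  rewrite (@ge0_integral_affine_set _ (-1) (- t))// ?oppr_eq0 ?oner_eq0//.
  rewrite normrN normr1 mul1e; apply: le_trans H3.
  apply: (@le_trans _ _ (\int[leb]_(u in (fun x : R => (-1 * x + - t)%R) @^-1` `[(- M)%R, (- t)%R[) f u)%E).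
    rewrite le_eqVlt; apply/orP; left; apply/eqP; apply: eq_integral => u _.
    rewrite /f mulN1r -opprD kN distrC; congr (`|_ - _|%:E).
    by rewrite opprD subrK kN.
  apply: ge0_subset_integral => //.
  - rewrite -[X in measurable X]setTI; exact: measurable_affine.
  - exact: measurable_funTS.
  - by move=> x /=; rewrite !in_itv/= mulN1r => /andP[]; lra.
have H2 : (\int[leb]_(u in `[(- t)%R, 0%R]) f u <= (2 * F t)%:E)%E.
  apply: (@le_trans _ _ (\int[leb]_(u in `[(- t)%R, 0%R]) ((k u)%:E + (k (u + t))%:E))%E).
    apply: ge0_le_integral => //.
    - exact: measurable_funTS.
    - apply: measurable_funTS; apply: emeasurable_funD => //; apply/measurable_EFinP; exact: mkt.
    - move=> u _; rewrite -EFinD lee_fin (le_trans (ler_normB _ _))// !ger0_norm//.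
  rewrite ge0_integralD//; last 2 first.
  - exact: measurable_funTS.
  - by apply: measurable_funTS; apply/measurable_EFinP; exact: mkt.
  rewrite mulr_natl mulr2n EFinD; apply: leeD; first exact: int_k_neg.
  apply: le_trans (int_k_pos t0).
  rewrite [leRHS](@integral_itv_obnd_cbnd R); last exact: measurable_funTS.
  rewrite [leRHS](@ge0_integral_affine_set _ 1 t)// ?oner_eq0// normr1 mul1e.
  have -> : (fun x : R => 1 * x + t) @^-1` `[0, t] = `[- t, 0]%classic.
    by apply/seteqP; split => x /=; rewrite !in_itv/= mul1r => /andP[] *; apply/andP; split; lra.
  by rewrite le_eqVlt; apply/orP; left; apply/eqP; apply: eq_integral => u _; rewrite mul1r.
have -> : 4 * F t + 2 * (t * CM) = (F t + t * CM) + (2 * F t + (F t + t * CM)) by ring.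
by rewrite !EFinD -!EFinD (EFinD (F t + t * CM)) leeD// EFinD leeD.
Qed.

Lemma integral_powR_norm_le (b : R) : 0 < b ->
  (\int[leb]_(u in `[(- b)%R, b]) (k u)%:E <= (2 * F b)%:E)%E.
Proof.
move=> b0.
rewrite (@itv_bndbnd_setU _ _ (BLeft (- b)) (BRight 0) (BRight b)) ?bnd_simp ?oppr_le0 ?(ltW b0)//.
rewrite ge0_integral_setU//; last 2 first.
- exact: measurable_funTS.
- by apply/disj_setPS => y [/=]; rewrite !in_itv/= => /andP[_ yt] /andP[]; lra.
by rewrite mulr_natl mulr2n EFinD; apply: leeD; [exact: int_k_neg|exact: int_k_pos].
Qed.

(** For [t <= 1] the smaller exponent gives the larger power. The 1 comes from the smooth part of
    the shift and the [p + 1] from the singularity, whence the minimum in the decay rate. *)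
Lemma powR_scale_le (t : R) : 0 < t <= 1 ->
  4 * F t + 2 * (t * CM) <= (4 / (p + 1) + 2 * CM) * t `^ (Num.min 1 (p + 1)).
Proof.
move=> t01; rewrite [leRHS]mulrDl; apply: lerD.
  rewrite /F mulrAC mulrA ler_wpM2r ?invr_ge0 ?(ltW p10)// ler_wpM2l//.
  by apply: ger_powR => //; rewrite ge_min lexx orbT.
rewrite -mulrA ler_wpM2l// mulrC ler_wpM2l ?le_max ?ler01//.
have /andP[t0 t1] := t01.
rewrite -[leLHS]powRr1 ?(ltW t0)//.
by apply: ger_powR => //; rewrite ge_min lexx.
Qed.
End shift_modulus.

Section lipschitz.
Context {R : realType}.

Lemma lipschitz_of_derive (f : R -> R) (K : R) : (forall x, derivable f x 1) ->
  (forall x, `|derive1 f x| <= K) -> forall x y, `|f x - f y| <= K * `|x - y|.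
Proof.
move=> df fK x y; wlog xy : x y / y <= x => [H|].
  have [/H//|/ltW/H] := leP y x; by rewrite distrC [`|y - x|]distrC.
have cf : continuous f by move=> z; apply/differentiable_continuous/derivable1_diffP.
have [|c _ ->] := MVT_segment (f := f) (df := derive1 f) xy _ (continuous_subspaceT cf).
  by move=> z _; rewrite derive1E; exact: derivableP.
by rewrite normrM ler_wpM2r.
Qed.

Lemma lipschitz_cos (x y : R) : `|cos x - cos y| <= `|x - y|.
Proof.
rewrite -[leRHS]mul1r; apply: (@lipschitz_of_derive cos 1) => z; first exact: derivable_cos.
by rewrite derive1E derive_val normrN sin_max.
Qed.

Lemma lipschitz_sin (x y : R) : `|sin x - sin y| <= `|x - y|.
Proof.
rewrite -[leRHS]mul1r; apply: (@lipschitz_of_derive sin 1) => z; first exact: derivable_sin.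
by rewrite derive1E derive_val cos_max.
Qed.

Lemma test_function_bounds (chi : R -> R[i]) : test_function chi ->
  exists2 B : R, 0 <= B & (forall x, normc (chi x) <= B) /\
    (forall x y, normc (chi x - chi y) <= B * `|x - y|).
Proof.
move=> hchi; have [[s1 s2] _] := hchi; have [M _ HM] := test_function_support hchi.
have H (g : R -> R) : smooth g -> (forall x, M < `|x| -> g x = 0) ->
    exists2 B : R, 0 <= B & (forall x, `|g x| <= B) /\ (forall x y, `|g x - g y| <= B * `|x - y|).
  move=> sg g0; have rg := compact_support_rapidly_decreasing sg g0.
  have [B0 H0] := rg 0%N 0%N; have [B1 H1] := rg 0%N 1%N.
  have B0' : 0 <= B0 by apply: le_trans (H0 0); rewrite mulr_ge0.
  have B1' : 0 <= B1 by apply: le_trans (H1 0); rewrite mulr_ge0.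
  exists (B0 + B1); first exact: addr_ge0.
  split=> [x|x y].
    by have := H0 x; rewrite expr0 mul1r => /le_trans ->//; rewrite lerDl.
  rewrite (@le_trans _ _ (B1 * `|x - y|))//; last by rewrite ler_wpM2r// lerDr.
  apply: lipschitz_of_derive => z; first exact: (sg 0%N).
  by have := H1 z; rewrite expr0 mul1r derive1n1.
have [|B1 B10 [b1 l1]] := H _ s1; first by move=> x /HM ->.
have [|B2 B20 [b2 l2]] := H _ s2; first by move=> x /HM ->.
exists (B1 + B2); first exact: addr_ge0.
split=> [x|x y]; apply: le_trans (normc_ReIm _) _; first exact: lerD.
rewrite mulrDl; apply: lerD.
- by apply: le_trans (l1 x y); case: (chi x) (chi y) => [? ?] [? ?].
- by apply: le_trans (l2 x y); case: (chi x) (chi y) => [? ?] [? ?].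
Qed.
End lipschitz.

Section fourier_decay.
Context {R : realType}.
Notation leb := (@lebesgue_measure R).
Variables (p M B : R) (chi : R -> R[i]).
Hypotheses (p1 : -1 < p) (M1 : 1 <= M) (B0 : 0 <= B).
Hypotheses (mchi : cmeasurable (chi : measurableTypeR R -> R[i])) (chiB : forall x, normc (chi x) <= B).
Hypotheses (chiL : forall x y, normc (chi x - chi y) <= B * `|x - y|).
Hypotheses (chi0 : forall x, M < `|x| -> chi x = 0).

Let h (u : R) : R[i] := chi u * (`|u| `^ p)%:C.

Let H (x : R) := cintegral leb (fun u => cis (pi * x * u) * h u).

Let M0 : 0 < M. Proof. exact: lt_le_trans M1. Qed.

Let mh : cmeasurable (h : measurableTypeR R -> R[i]).
Proof. by apply: cmeasurableM => //; apply: cmeasurable_real; exact: measurable_powR_norm. Qed.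

Let normc_h u : normc (h u) = normc (chi u) * `|u| `^ p.
Proof. by rewrite ComplexField.Normc.normcM normc_real ger0_norm// powR_ge0. Qed.

Let memM u : (u \in `[(- M), M]%classic) = (`|u| <= M).
Proof. by rewrite mem_setE in_itv/= -ler_norml. Qed.

Lemma cintegrable_singular : cintegrable leb h.
Proof.
apply/(cintegrableP _ mh).
apply: (@le_lt_trans _ _ (\int[leb]_u ((fun u => (B * `|u| `^ p)%:E) \_ `[(- M)%R, M]) u)%E).
  apply: ge0_le_integral => //.
  - by move=> u _; rewrite lee_fin normc_ge0.
  - by apply/measurable_EFinP; exact: measurable_normc.
  - apply/(measurable_restrictT _ _).1 => //; apply: measurable_funTS.
    by apply/measurable_EFinP; apply: measurable_funM => //; exact: measurable_powR_norm.
  - move=> u _; rewrite normc_h patchE memM; case: ifPn => [_|].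
      by rewrite lee_fin ler_wpM2r// powR_ge0.
    by rewrite -ltNge => /chi0 ->; rewrite ComplexField.Normc.normc0 mul0r.
rewrite -integral_mkcond; under eq_integral do rewrite EFinM.
rewrite ge0_integralZl//.
- apply: lte_mul_pinfty => //.
  exact: le_lt_trans (integral_powR_norm_le p1 M0) (ltry _).
- by apply: measurable_funTS; apply/measurable_EFinP; exact: measurable_powR_norm.
Qed.

Let F (b : R) := b `^ (p + 1) / (p + 1).

(** Discrete product rule: the increment of [h] splits into the increment of [chi] times the shifted
    power, which vanishes unless [u + t] is within [M + 1] of 0, and [chi] times the increment of
    the power, which vanishes unless [u] is within [M] of 0. *)
Let modulus (t : R) : 0 < t <= 1 ->
  (\int[leb]_u (normc (h u - h (u + t)))%:E <=
    (B * t * (2 * F (M + 1)) + B * (4 * F t + 2 * (t * Num.max 1 ((M + 1) `^ p))))%:E)%E.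
Proof.
move=> t01; have /andP[t0 t1] := t01.
have mk := @measurable_powR_norm R p.
have mkt : measurable_fun setT (fun u : R => `|u + t| `^ p).
  apply: (@measurableT_comp _ _ _ _ _ _ (fun u : R => `|u| `^ p) _ (fun u : R => u + t)); first exact: mk.
  exact: measurable_funD.
have mht : cmeasurable (fun u : measurableTypeR R => h (u + t)).
  have ms : measurable_fun setT ((fun u : R => u + t) : measurableTypeR R -> measurableTypeR R).
    exact: measurable_funD.
  by move: mh => [h1 h2]; split; [exact: measurableT_comp h1 ms|exact: measurableT_comp h2 ms].
pose g1 (u : R) := ((B * t * `|u| `^ p)%:E : \bar R).
pose G1 := g1 \_ `[(- (M + 1))%R, (M + 1)%R]%classic.
pose g2 (u : R) := ((B * `| `|u| `^ p - `|u + t| `^ p|)%:E : \bar R).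
pose G2 := g2 \_ `[(- M)%R, M]%classic.
have mg1 : measurable_fun setT g1 by apply/measurable_EFinP; exact: measurable_funM.
have mG1 : measurable_fun setT G1 by apply/(measurable_restrictT _ _).1 => //; exact: measurable_funTS.
have mg2 : measurable_fun setT g2.
  by apply/measurable_EFinP; apply: measurable_funM => //; apply: measurableT_comp => //; exact: measurable_funB.
have mG2 : measurable_fun setT G2 by apply/(measurable_restrictT _ _).1 => //; exact: measurable_funTS.
have g10 u : (0 <= g1 u)%E by rewrite lee_fin !mulr_ge0 ?powR_ge0// ltW.
have g20 u : (0 <= g2 u)%E by rewrite lee_fin mulr_ge0.
have G10 u : (0 <= G1 u)%E by apply: erestrict_ge0.
have G20 u : (0 <= G2 u)%E by apply: erestrict_ge0.
have mG1t : measurable_fun setT (fun u : R => G1 (u + t)).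
  apply: (@measurableT_comp _ _ _ _ _ _ G1 _ (fun u : R => u + t)) => //.
  exact: measurable_funD.
apply: (@le_trans _ _ (\int[leb]_u (G1 (u + t)%R + G2 u))%E).
  apply: ge0_le_integral => //.
  - by move=> u _; rewrite lee_fin normc_ge0.
  - apply/measurable_EFinP; apply: measurable_normc; apply: cmeasurableD => //.
    move: mht => [h1 h2]; split.
      have -> : (fun x => complex.Re (- h (x + t))) = (fun x => - complex.Re (h (x + t))).
        by apply/funext => u; case: (h _).
      exact: measurableT_comp h1.
    have -> : (fun x => complex.Im (- h (x + t))) = (fun x => - complex.Im (h (x + t))).
      by apply/funext => u; case: (h _).
    exact: measurableT_comp h2.
  - exact: emeasurable_funD.
  move=> u _.
  have -> : h u - h (u + t) = (chi u - chi (u + t)) * (`|u + t| `^ p)%:C +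
     chi u * (`|u| `^ p - `|u + t| `^ p)%:C by rewrite /h rmorphB/=; ring.
  apply: (@le_trans _ _ ((normc ((chi u - chi (u + t)) * (`|u + t| `^ p)%:C))%:E +
     (normc (chi u * (`|u| `^ p - `|u + t| `^ p)%:C))%:E)%E).
    by rewrite -EFinD lee_fin le_normcD.
  apply: leeD.
  - rewrite /G1 patchE mem_setE in_itv/= -ler_norml; case: ifPn => [_|].
      rewrite lee_fin ComplexField.Normc.normcM normc_real (ger0_norm (powR_ge0 _ _)).
      rewrite ler_wpM2r ?powR_ge0// (le_trans (chiL _ _))//.
      by rewrite opprD addrA subrr add0r normrN (gtr0_norm t0).
    rewrite -ltNge => Mut; have Mu : M < `|u|.
      have := ler_normD u t; rewrite (gtr0_norm t0); lra.
    rewrite !chi0//; last by rewrite (lt_trans _ Mut)// ltrDl.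
    by rewrite subrr mul0r ComplexField.Normc.normc0.
  - rewrite /G2 patchE memM; case: ifPn => [_|].
      by rewrite lee_fin ComplexField.Normc.normcM normc_real ler_wpM2r.
    by rewrite -ltNge => /chi0 ->; rewrite mul0r ComplexField.Normc.normc0.
rewrite ge0_integralD// EFinD; apply: leeD.
- apply: (@le_trans _ _ (\int[leb]_u G1 u)%E).
    rewrite [leRHS](@ge0_integral_affine R 1 t)// ?oner_eq0// normr1 mul1e.
    by apply: le_eq_integral => u _; rewrite mul1r.
  rewrite /G1 -integral_mkcond /g1; under eq_integral do rewrite EFinM.
  rewrite ge0_integralZl//.
  + rewrite [leRHS]EFinM; apply: lee_wpmul2l; first by rewrite lee_fin mulr_ge0// ltW.
    by apply: integral_powR_norm_le => //; rewrite ltr_wpDl// ltW.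
  + by apply: measurable_funTS; exact/measurable_EFinP.
  + by rewrite lee_fin mulr_ge0// ltW.
- rewrite /G2 -integral_mkcond /g2; under eq_integral do rewrite EFinM.
  rewrite ge0_integralZl//.
  + rewrite [leRHS]EFinM; apply: lee_wpmul2l; first by rewrite lee_fin.
    exact: shift_modulus_powR.
  + apply: measurable_funTS; apply/measurable_EFinP.
    by apply: measurableT_comp => //; exact: measurable_funB.
Qed.

(* Translating [u] by [1/x] changes the sign of [cis (pi * x * u)]. *)
Let decay_shift (x : R) : 1 <= x ->
  ((normc (H x))%:E <= \int[leb]_u (normc (h u - h (u + x^-1)))%:E)%E.
Proof.
move=> x1; have x0 : 0 < x by exact: lt_le_trans x1.
have xn0 : x != 0 by rewrite gt_eqF.
have ih := cintegrable_cis x cintegrable_singular.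
have iht : cintegrable leb (fun u => cis (pi * x * u) * h (u + x^-1)).
  apply: cintegrable_cis.
  have := @cintegrable_affine R 1 x^-1 h (oner_neq0 _) cintegrable_singular.
  by congr cintegrable; apply/funext => u; rewrite mul1r.
have E : H x = (-1) * cintegral leb (fun u => cis (pi * x * u) * h (u + x^-1)).
  rewrite /H (@cintegral_affine R 1 x^-1 _ (oner_neq0 _) ih) normr1 mul1r -cintegralZ//.
  apply: eq_cintegral => u; rewrite mul1r mulrA; congr (_ * _).
  by rewrite mulrDr mulfK// cisD cispi mulrC.
(* Adding the original and the translated expression leaves a difference of values of [h]. The 2 on
   the left then cancels the one of [normc_cintegral_le]. *)
have E2 : 2 * H x = cintegral leb (fun u => cis (pi * x * u) * (h u - h (u + x^-1))).
  rewrite [LHS](_ : _ = H x + H x); last by rewrite mulr_natl mulr2n.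
  rewrite {2}E -cintegralZ// -cintegralD//; last exact: cintegrableZ.
  by apply: eq_cintegral => u; rewrite mulrBr mulN1r.
have id : cintegrable leb (fun u => cis (pi * x * u) * (h u - h (u + x^-1))).
  have := cintegrableD ih (cintegrableZ (-1) iht).
  by congr cintegrable; apply/funext => u; rewrite mulrBr mulN1r.
have := normc_cintegral_le id; rewrite -E2 ComplexField.Normc.normcM.
have -> : normc (2 : R[i]) = 2.
  by rewrite (_ : 2 = (2 : R)%:C) ?normc_real ?ger0_norm// rmorph_nat.
rewrite EFinM lee_pmul2l// => /le_trans; apply.
by under eq_integral do rewrite ComplexField.Normc.normcM normc_cis mul1r.
Qed.

Lemma fourier_decay_pos : exists C : R, forall x, 1 <= x ->
  normc (H x) <= C * x `^ (- Num.min 1 (p + 1)).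
Proof.
exists (B * (2 * F (M + 1)) + B * (4 / (p + 1) + 2 * Num.max 1 ((M + 1) `^ p))) => x x1.
have x0 : 0 < x by exact: lt_le_trans x1.
have t01 : 0 < x^-1 <= 1 by rewrite invr_gt0 x0 invf_le1.
rewrite -lee_fin; apply: le_trans (decay_shift x1) _.
apply: le_trans (modulus t01) _; rewrite lee_fin.
have -> : x `^ (- Num.min 1 (p + 1)) = x^-1 `^ (Num.min 1 (p + 1)).
  by rewrite powRN -[x^-1]powR_inv1 ?(ltW x0)// -powRrM mulN1r powRN.
rewrite [leRHS]mulrDl; apply: lerD; last first.
  rewrite -mulrA ler_wpM2l//; exact: powR_scale_le.
rewrite mulrAC ler_wpM2l//.
  by rewrite mulr_ge0// mulr_ge0// divr_ge0 ?powR_ge0// ltW// -ltrBlDr sub0r.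
rewrite -[leLHS]powRr1 ?invr_ge0 ?(ltW x0)//.
by apply: ger_powR => //; rewrite ge_min lexx.
Qed.

Lemma normc_singular_le (x : R) : ((normc (H x))%:E <= 2%:E * \int[leb]_u (normc (h u))%:E)%E.
Proof.
apply: le_trans (normc_cintegral_le (cintegrable_cis x cintegrable_singular)) _.
by under eq_integral do rewrite ComplexField.Normc.normcM normc_cis mul1r.
Qed.
End fourier_decay.

(** * Lower bound by subordination to Fejer kernels *)

Section tent.
Context {R : realType}.
Notation leb := (@lebesgue_measure R).

Definition tent (z : R) : R := Num.max 0 (1 - `|z|).

Lemma tent_ge0 z : 0 <= tent z. Proof. by rewrite le_max lexx. Qed.

Lemma tent_le z : tent z <= 2 * (1 + z ^+ 2)^-1.
Proof.
have h : 0 < 1 + z ^+ 2 by rewrite ltr_pwDl ?sqr_ge0.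
rewrite ler_pdivlMr// /tent; have [z1|z1] := leP (1 - `|z|) 0; first by rewrite mul0r.
have : `|z| ^+ 2 = z ^+ 2 by rewrite real_normK ?num_real.
have := normr_ge0 z; set y := `|z| in z1 * => y0 <-.
have yy : y * y <= 1 by rewrite mulr_ile1//; lra.
have y3 : 0 <= y ^+ 3 by rewrite exprn_ge0.
have -> : (1 - y) * (1 + y ^+ 2) = 1 - y + y * y - y ^+ 3 by ring.
lra.
Qed.

Lemma continuous_tent : continuous tent.
Proof.
move=> z; have c1 : continuous (fun z : R => 1 - `|z|).
  by move=> y; apply: cvgB; [exact: cvg_cst|exact: norm_continuous].
by have := @continuous_max R R (fun=> 0) (fun z => 1 - `|z|) z (@cst_continuous _ _ _ z) (c1 z).
Qed.

Lemma measurable_tent : measurable_fun setT tent.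
Proof. by apply: continuous_measurable_fun; exact: continuous_tent. Qed.

Lemma cintegrable_tent : cintegrable leb (fun z => (tent z)%:C).
Proof.
apply: (@cintegrable_le _ _ _ leb _ (fun z => 2 * (1 + z ^+ 2)^-1)).
- by apply: cmeasurable_real; exact: measurable_tent.
- exact: (integrableZl measurableT 2 integrable_oneDsqrV).
- by move=> z; rewrite normc_real ger0_norm ?tent_ge0// tent_le.
Qed.

(* At [t = 0] Rocq's division gives [0] instead of the limit value [1]. *)
Definition fejer (t : R) : R := 2 * (1 - cos (pi * t)) / (pi * t) ^+ 2.

Lemma fejerN t : fejer (- t) = fejer t.
Proof. by rewrite /fejer mulrN cosN sqrrN. Qed.

Lemma fejer0 : fejer 0 = 0.
Proof. by rewrite /fejer mulr0 expr0n/= invr0 mulr0. Qed.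

Lemma fejer_ge0 t : 0 <= fejer t.
Proof. by rewrite /fejer mulr_ge0 ?invr_ge0 ?sqr_ge0// mulr_ge0// subr_ge0 cos_le1. Qed.

Lemma measurable_fejer : measurable_fun setT fejer.
Proof.
rewrite /fejer; apply: measurable_funM.
  apply: measurable_funM => //; apply: measurable_funB => //.
  apply: (@measurableT_comp _ _ _ _ _ _ (@cos R) _ (fun t : R => pi * t)).
    by apply: continuous_measurable_fun; exact: continuous_cos.
  exact: measurable_funM.
have -> : (fun t : R => ((pi * t) ^+ 2)^-1) = (fun t : R => ((pi * t) ^+ 2) `^ (-1)).
  by apply/funext => t; rewrite powR_inv1// sqr_ge0.
apply: (@measurableT_comp _ _ _ _ _ _ (fun y : R => y `^ (-1)) _ (fun t : R => (pi * t) ^+ 2)).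
  exact: measurable_powR.
by apply: measurable_funX; exact: measurable_funM.
Qed.

Lemma fejer_le1 t : fejer t <= 1.
Proof.
have [->|t0] := eqVneq t 0; first by rewrite fejer0.
have pt0 : 0 < (pi * t) ^+ 2 by rewrite exprn_even_gt0//= mulf_neq0// gt_eqF// pi_gt0.
rewrite /fejer ler_pdivrMr// mul1r.
have -> : pi * t = (pi * t / 2) *+ 2 by rewrite -mulr_natr; field.
set s := pi * t / 2; rewrite cos_mulr2n cos2sin2.
have : `|sin s| <= `|s| by have := @lipschitz_sin R s 0; rewrite sin0 !subr0.
rewrite -ler_sqr ?nnegrE// !real_normK ?num_real// => h.
move: (sin s) h => a h; clear pt0; clearbody s; clear t t0.
have -> : 2 * (1 - ((1 - a ^+ 2) *+ 2 - 1)) = 4 * a ^+ 2 by rewrite -mulr_natr; ring.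
have -> : (s *+ 2) ^+ 2 = 4 * s ^+ 2 by rewrite -mulr_natr; ring.
by rewrite ler_pM2l.
Qed.

Lemma fejer_le_sqrV t : fejer t <= (t ^+ 2)^-1.
Proof.
have [->|t0] := eqVneq t 0; first by rewrite fejer0 invr_ge0 sqr_ge0.
have tt : 0 < t ^+ 2 by rewrite exprn_even_gt0.
rewrite /fejer exprMn ler_pdivrMr; last by rewrite mulr_gt0// exprn_gt0// pi_gt0.
rewrite mulrCA mulVf ?gt_eqF// mulr1.
have := cos_geN1 (pi * t); have := @pi_ge2 R; set c := cos _; set q := pi => p2 c1.
clearbody c q; have : 2 * 2 <= q * q :> R by rewrite ler_pM.
by rewrite expr2; lra.
Qed.

Lemma fejer_le t : fejer t <= 2 * (1 + t ^+ 2)^-1.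
Proof.
have h : 0 < 1 + t ^+ 2 by rewrite ltr_pwDl ?sqr_ge0.
have [t1|t1] := leP (t ^+ 2) 1.
  by apply: le_trans (fejer_le1 t) _; rewrite ler_pdivlMr//; lra.
apply: le_trans (fejer_le_sqrV t) _.
by rewrite ler_pdivlMr// mulrC ler_pdivrMr//; lra.
Qed.

(** On this range cos(pi t) is nonpositive, so the numerator is at least 2, and pi t <= 4 keeps the
    denominator at most 16. *)
Lemma fejer_ge t : 1 / 2 <= t <= 1 -> 1 / 8 <= fejer t.
Proof.
move=> /andP[t1 t2]; have p0 := @pi_gt0 R.
have pt : 0 < pi * t by rewrite mulr_gt0//; lra.
rewrite /fejer ler_pdivlMr ?exprn_gt0//.
have c0 : cos (pi * t) <= 0.
  have -> : pi * t = pi * (t - 1 / 2) + pi / 2 by field.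
  rewrite cosDpihalf oppr_le0; apply: sin_ge0_pi; rewrite mulr_ge0 ?(ltW p0)//=; last by lra.
  by rewrite -[leRHS]mulr1 ler_pM2l//; lra.
have p4 : pi * t <= 4.
  have := @pihalf_lt2 R; rewrite ltr_pdivrMr// => pi4.
  by rewrite -[leRHS]mulr1 ler_pM ?(ltW p0)//; lra.
move: p4 pt c0; set c := cos _; set q := pi * t => p4 pt c0.
have : q * q <= 4 * 4 by rewrite ler_pM// ltW.
by clearbody c q; rewrite expr2; lra.
Qed.

Lemma integrable_fejer : leb.-integrable setT (EFin \o fejer).
Proof.
apply: (le_integrable measurableT _ _ (integrableZl measurableT 2 integrable_oneDsqrV)).
  by apply/measurable_EFinP; exact: measurable_fejer.
move=> t _ /=; rewrite lee_fin ger0_norm ?fejer_ge0// ger0_norm ?fejer_le//.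
by rewrite (le_trans (fejer_ge0 t))// fejer_le.
Qed.
End tent.

Section tent_fourier.
Context {R : realType}.
Notation leb := (@lebesgue_measure R).

(** The tent is 1 + z on [-1, 0] and 1 - z on [0, 1]; [e] is this slope, and [prim] is the primitive
    obtained by integrating by parts. *)
Let half (t : R) (e : R) (z : R) := (1 + e * z) * cos (pi * t * z).
Let prim (t : R) (e : R) (z : R) :=
  (1 + e * z) * (sin (pi * t * z) / (pi * t)) + e * (cos (pi * t * z) / (pi * t) ^+ 2).

Let derive_prim (t e z : R) : t != 0 -> is_derive z 1 (prim t e) (half t e z).
Proof.
move=> t0; rewrite /prim /half.
have pt0 : pi * t != 0 :> R by rewrite mulf_neq0// gt_eqF// pi_gt0.
apply: is_derive_eq.
rewrite /GRing.scale/=; have p0 : pi != 0 :> R by rewrite gt_eqF// pi_gt0.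
move: p0 {pt0}; generalize (pi : R) => q q0.
by field; rewrite t0 q0.
Qed.

Let continuous_half (t e : R) : continuous (half t e).
Proof.
move=> z; apply: cvgM.
  by apply: cvgD; [exact: cvg_cst|apply: cvgM; [exact: cvg_cst|exact: cvg_id]].
apply: (@continuous_comp _ _ _ (fun z : R => pi * t * z) (@cos R)); last exact: continuous_cos.
by apply: cvgM; [exact: cvg_cst|exact: cvg_id].
Qed.

Let Rintegral_half (t e a b : R) : t != 0 -> a < b ->
  \int[leb]_(z in `[a, b]) half t e z = prim t e b - prim t e a.
Proof.
move=> t0 ab; rewrite /Rintegral (@continuous_FTC2 R (half t e) (prim t e))//.
- exact/continuous_subspaceT/continuous_half.
- have cp z : {for z, continuous (prim t e)}.
    apply/differentiable_continuous/derivable1_diffP.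
    by have [] := derive_prim e z t0.
  split.
  + by move=> z _; have [] := derive_prim e z t0.
  + by apply: cvg_at_right_filter; exact: cp.
  + by apply: cvg_at_left_filter; exact: cp.
- by move=> z _; rewrite derive1E; have [_ <-] := derive_prim e z t0.
Qed.

Lemma cintegral_tent (t : R) : t != 0 ->
  cintegral leb (fun z => cis (pi * t * z) * (tent z)%:C) = (fejer t)%:C.
Proof.
move=> t0.
have [i1 i2] := cintegrable_cis t (@cintegrable_tent R).
rewrite /cintegral; apply/eqP; rewrite eq_complex/=; apply/andP; split; apply/eqP.
- have E z : cos (pi * t * z) * tent z =
      ((fun z => cos (pi * t * z) * tent z) \_ `[- 1, 1]) z.
    rewrite patchE mem_setE in_itv/= -ler_norml; case: ifPn => //; rewrite -ltNge => z1.
    by rewrite /tent max_l ?mulr0// subr_le0 ltW.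
  rewrite (_ : Rintegral _ _ _ = \int[leb]_(z in `[-1, 1]) (cos (pi * t * z) * tent z)); last first.
    by rewrite [RHS]Rintegral_mkcond; apply: eq_Rintegral => z _; rewrite -E/= mulr0 subr0.
  rewrite (@itv_bndbnd_setU _ _ (BLeft (-1)) (BLeft 0) (BRight 1)) ?bnd_simp//.
  have i1' D : measurable D -> leb.-integrable D (EFin \o (fun z => cos (pi * t * z) * tent z)).
    move=> mD; apply: (@integrableS _ _ _ leb setT) => //.
    by apply: eq_integrable i1 => // z _ /=; rewrite mulr0 subr0.
  rewrite Rintegral_setU//; last 2 first.
  - by apply: i1'; exact: measurableU.
  - apply/disj_setPS => y [/=]; rewrite !in_itv/= => /andP[_ y0] /andP[]; lra.
  rewrite Rintegral_itv_bndo_bndc; last exact: i1'.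
  rewrite (_ : \int[leb]_(x in `[-1, 0]) _ = \int[leb]_(x in `[-1, 0]) half t 1 x); last first.
    apply: eq_Rintegral => z; rewrite inE/= in_itv/= => /andP[z1 z0].
    rewrite /half /tent ler0_norm// mul1r opprK mulrC max_r//; lra.
  rewrite (_ : \int[leb]_(x in `[0, 1]) _ = \int[leb]_(x in `[0, 1]) half t (-1) x); last first.
    apply: eq_Rintegral => z; rewrite inE/= in_itv/= => /andP[z1 z0].
    rewrite /half /tent ger0_norm// mulN1r mulrC max_r//; lra.
  rewrite !Rintegral_half// ?oppr_lt0//.
  rewrite /prim /fejer !(mulr0, mulr1, mulrN1) sin0 cos0 cosN.
  have pt0 : pi * t != 0 :> R by rewrite mulf_neq0// gt_eqF// pi_gt0.
  move: pt0; set q := pi * t => pt0; clearbody q; field.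
  exact: pt0.
- have i2' : leb.-integrable setT (EFin \o (fun z => sin (pi * t * z) * tent z)).
    by apply: eq_integrable i2 => // z _ /=; rewrite mulr0 add0r.
  (* The integrand is odd, so reflection shows that the imaginary part equals its own negative. *)
  have : \int[leb]_x (sin (pi * t * x) * tent x) = - \int[leb]_x (sin (pi * t * x) * tent x).
    rewrite {1}(@Rintegral_affine R (-1) 0 _ _ i2') ?oppr_eq0 ?oner_eq0// normrN normr1 mul1r.
    rewrite -[RHS]mulN1r -(RintegralZl (-1) measurableT i2'); apply: eq_Rintegral => z _.
    by rewrite addr0 mulN1r mulrN sinN mulN1r mulNr /tent normrN.
  move=> /eqP; rewrite -addr_eq0 -mulr2n mulrn_eq0/= => /eqP I0; rewrite -[RHS]I0.
  by apply: eq_Rintegral => z _; rewrite /= mulr0 add0r.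
Qed.
End tent_fourier.

Section tent_pairing.
Context {R : realType}.
Notation leb := (@lebesgue_measure R).

Lemma cintegrable_tent_affine (x s : R) : s != 0 ->
  cintegrable leb (fun xi => (tent ((xi + x) / s))%:C).
Proof.
move=> s0; have s1 : s^-1 != 0 by rewrite invr_eq0.
have := @cintegrable_affine R s^-1 (x / s) _ s1 (@cintegrable_tent R).
by congr cintegrable; apply/funext => xi; rewrite mulrDl mulrC.
Qed.

Lemma inv_fourier_tent (x s y : R) : s != 0 -> y != 0 ->
  inv_fourier (fun xi => (tent ((xi + x) / s))%:C) y =
  (2^-1 * `|s|)%:C * (cis (- (pi * x * y)) * (fejer (s * y))%:C).
Proof.
move=> s0 y0; have i := cintegrable_cis y (cintegrable_tent_affine x s0).
rewrite /inv_fourier (@cintegral_affine R s (- x) _ s0 i) rmorphM/= -[RHS]mulrA.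
congr (_ * (_ * _)); rewrite -(@cintegral_tent R (s * y)) ?mulf_neq0//.
rewrite -cintegralZ; last exact: cintegrable_cis (@cintegrable_tent R).
apply: eq_cintegral => z.
rewrite mulrA -cisD; congr (cis _ * (tent _)%:C).
  by ring.
by rewrite subrK mulrC mulKf.
Qed.

Lemma cmeasurable_inv_fourier m : cintegrable leb m ->
  cmeasurable (inv_fourier m : measurableTypeR R -> R[i]).
Proof.
by move=> /inv_fourier_continuous[c1 c2]; split; exact: continuous_measurable_fun.
Qed.

(** The convolution theorem for a translated and dilated tent, whose inverse transform is a
    modulated Fejer kernel. It trades an oscillating integral of [f] for an integral of its
    transform against a tent; at [y = 0] that weight carries no phase. *)
Lemma fourier_tent_pairing (f : R -> R[i]) (x s y : R) : s != 0 -> cintegrable leb f ->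
  cintegral leb (fun u => f u * (cis (- (pi * x * (y - u))) * (fejer (s * (y - u)))%:C)) =
  (`|s|^-1)%:C * cintegral leb (fun xi => cis (pi * y * xi) * ((tent ((xi + x) / s))%:C * fourier f xi)).
Proof.
move=> s0 intf; have it := cintegrable_tent_affine x s0.
have mf : cmeasurable (f : measurableTypeR R -> R[i]) := cintegrable_cmeasurable intf.
have msub : measurable_fun setT (fun u : R => y - u) by exact: measurable_funB.
have mk : cmeasurable (fun u : measurableTypeR R => cis (- (pi * x * (y - u))) * (fejer (s * (y - u)))%:C).
  apply: cmeasurableM.
    apply: cmeasurable_cis; apply: measurableT_comp => //; exact: measurable_funM.
  have ms : measurable_fun setT (fun u : R => s * (y - u)) by exact: measurable_funM.
  by apply: cmeasurable_real; exact: measurableT_comp (@measurable_fejer R) ms.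
pose F u := f u * (cis (- (pi * x * (y - u))) * (fejer (s * (y - u)))%:C).
have iF : cintegrable leb F.
  have := @cintegrableM_bounded _ _ _ leb f _ 1 mk _ intf.
  rewrite (_ : (fun x0 => _ * f x0) = F); last by apply/funext => u; rewrite mulrC.
  apply=> u; rewrite ComplexField.Normc.normcM normc_cis mul1r normc_real.
  by rewrite ger0_norm ?fejer_ge0// fejer_le1.
have E : inv_fourier (fun xi => (tent ((xi + x) / s))%:C * fourier f xi) y =
    (2^-1 * `|s|)%:C * cintegral leb F.
  rewrite (inv_fourier_mul_fourier y it intf) -cintegralZ//.
  apply: ae_eq_cintegral.
  - apply: cmeasurableM => //.
    have [h1 h2] := cmeasurable_inv_fourier it.
    by split; [exact: measurableT_comp h1 msub|exact: measurableT_comp h2 msub].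
  - apply: cmeasurableM; first exact: cmeasurable_cst.
    exact: cmeasurableM.
  (* At [u = y] the convention [fejer 0 = 0] breaks the identity, but a single point is a null
     set. *)
  exists [set y]; split => //; first exact: lebesgue_measure_set1.
  move=> u /= H; apply: contrapT => /eqP uy; apply: H.
  have yu : y - u != 0 by rewrite subr_eq0 eq_sym.
  by rewrite (inv_fourier_tent x s0 yu) mulrCA.
rewrite -[LHS]/(cintegral leb F); move: E; rewrite {1}/inv_fourier => E.
have h2 : (2^-1 : R)%:C != 0 by rewrite fmorph_eq0 invr_eq0.
apply: (mulfI h2); rewrite mulrCA E rmorphM/= -[_ * _ * cintegral _ _]mulrA mulrCA; congr (_ * _).
by rewrite mulrA -rmorphM/= mulVf ?mul1r// normr_eq0.
Qed.
End tent_pairing.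

(** * Injectivity of the Fourier transform *)

Section fourier_injective.
Context {R : realType}.
Notation leb := (@lebesgue_measure R).

Lemma Rintegral_fejer_gt0 : 0 < \int[leb]_x fejer x.
Proof.
apply: (@lt_le_trans _ _ (1 / 8 * (1 - 1 / 2))); first by rewrite mulr_gt0//; lra.
apply: Rintegral_ge_box; first exact: integrable_fejer.
- exact: fejer_ge0.
- lra.
- lra.
- exact: fejer_ge.
Qed.

(* Rescaled, the integrals of [p] against [s * fejer (s * (y - u))] tend to
   [p y] times the integral of [fejer]. *)
Lemma fejer_concentration (p : R -> R) (B y : R) : continuous p ->
  (forall x, `|p x| <= B) ->
  (forall s, 0 < s -> \int[leb]_u (p u * fejer (s * (y - u))) = 0) -> p y = 0.
Proof.
move=> cp pB H.
have mp : measurable_fun setT p by exact: continuous_measurable_fun.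
have B0 : 0 <= B by apply: le_trans (pB 0).
have mfj := @measurable_fejer R.
have dom (q : R -> R) : measurable_fun setT q -> (forall x, `|q x| <= B) ->
    leb.-integrable setT (EFin \o (fun v => q v * fejer v)).
  move=> mq qB; apply: (le_integrable measurableT _ _ (integrableZl measurableT B (@integrable_fejer R))).
    by apply/measurable_EFinP; exact: measurable_funM.
  move=> x _ /=; rewrite lee_fin !normrM ler_wpM2r//.
  by rewrite (le_trans (qB x))// ler_norm.
have E (s : R) : 0 < s -> \int[leb]_v (p (y - s^-1 * v) * fejer v) = 0.
  move=> s0; have a0 : - s^-1 != 0 :> R by rewrite oppr_eq0 invr_eq0 gt_eqF.
  have ma : measurable_fun setT (fun v : R => y - s^-1 * v).
    by apply: measurable_funB => //; exact: measurable_funM.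
  have i1 := dom (fun v => p (y - s^-1 * v)) (measurableT_comp mp ma) (fun=> pB _).
  have i2 : leb.-integrable setT (EFin \o (fun u => p u * fejer (s * (y - u)))).
    have s0' : - s != 0 :> R by rewrite oppr_eq0 gt_eqF.
    have := @integrable_affine R (- s) (s * y) _ s0' i1.
    apply: eq_integrable => // u _ /=; congr (_%:E); congr (p _ * fejer _).
      by field; rewrite gt_eqF.
    by ring.
  have := H _ s0; rewrite (Rintegral_affine y a0 i2) => /eqP.
  rewrite mulf_eq0 normr_eq0 (negbTE a0)/= => /eqP I0; rewrite -[RHS]I0.
  apply: eq_Rintegral => v _; congr (p _ * fejer _); first by ring.
  by field; rewrite gt_eqF.
have lim : \int[leb]_v (p (y - n.+1%:R^-1 * v) * fejer v) @[n --> \oo] --> \int[leb]_v (p y * fejer v).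
  apply: (@cvg_Rintegral_dominated _ _ _ (fun v => B * fejer v)).
  - move=> n; apply: measurable_funM => //; apply: measurableT_comp => //.
    by apply: measurable_funB => //; exact: measurable_funM.
  - exact: measurable_funM.
  - move=> v; apply: cvgM; last exact: cvg_cst.
    apply: (@cvg_comp _ _ _ (fun n : nat => y - n.+1%:R^-1 * v) p _ (nbhs y)); last exact: cp.
    have : y - n.+1%:R^-1 * v @[n --> \oo] --> y - 0 * v.
      apply: cvgB; first exact: cvg_cst.
      by apply: cvgM; [exact: cvg_harmonic|exact: cvg_cst].
    by rewrite mul0r subr0.
  - exact: (integrableZl measurableT B (@integrable_fejer R)).
  - by move=> n v; rewrite normrM (ger0_norm (fejer_ge0 v)) ler_wpM2r ?fejer_ge0.
have : \int[leb]_v (p y * fejer v) = 0.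
  rewrite -(cvg_lim _ lim)//; under eq_fun do rewrite E ?ltr0n//.
  exact: lim_cst.
rewrite RintegralZl//; last exact: integrable_fejer.
by move/eqP; rewrite mulf_eq0 => /orP[/eqP//|]; rewrite gt_eqF// Rintegral_fejer_gt0.
Qed.

(** By the pairing formula with [x = 0], the integrals of [f] against all dilated Fejer kernels
    centred at [y] vanish, and these kernels concentrate at [y]. The lemma serves to find a
    frequency where the transform of [chi] is positive. *)
Lemma fourier_eq0 (f : R -> R[i]) (B : R) : cintegrable leb f ->
  continuous (fun x => complex.Re (f x)) -> continuous (fun x => complex.Im (f x)) ->
  (forall x, normc (f x) <= B) -> (forall xi, fourier f xi = 0) -> forall y, f y = 0.
Proof.
move=> intf c1 c2 fB f0 y.
have E (s : R) : 0 < s -> cintegral leb (fun u => f u * (fejer (s * (y - u)))%:C) = 0.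
  move=> s0; have := fourier_tent_pairing 0 y (lt0r_neq0 s0) intf.
  rewrite (@eq_cintegral _ _ _ leb _ (fun u => f u * (fejer (s * (y - u)))%:C)); last first.
    by move=> u; rewrite mulr0 mul0r oppr0 cis0 mul1r.
  move=> ->; rewrite (@eq_cintegral _ _ _ leb _ (fun=> 0)); last first.
    by move=> xi; rewrite f0 !mulr0.
  rewrite (_ : cintegral _ _ = 0) ?mulr0//.
  by rewrite /cintegral /= /Rintegral integral0.
have H1 : complex.Re (f y) = 0.
  apply: (@fejer_concentration (fun x => complex.Re (f x)) B) => // [x|s s0].
    exact: le_trans (normc_Re _) (fB x).
  have := congr1 (@complex.Re R) (E s s0) => /= Es; rewrite -[RHS]Es.
  by apply: eq_Rintegral => u _; rewrite complexReM/= mulr0 subr0.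
have H2 : complex.Im (f y) = 0.
  apply: (@fejer_concentration (fun x => complex.Im (f x)) B) => // [x|s s0].
    exact: le_trans (normc_Im _) (fB x).
  have := congr1 (@complex.Im R) (E s s0) => /= Es; rewrite -[RHS]Es.
  by apply: eq_Rintegral => u _; rewrite complexImM/= mulr0 add0r.
by move: H1 H2; case: (f y) => a b /= -> ->.
Qed.
End fourier_injective.

Section fejer_mellin.
Context {R : realType}.
Notation leb := (@lebesgue_measure R).
Variable a : R.
Hypotheses (a0 : 0 < a) (a1 : a < 1).

(** Near 0 the exponent exceeds -1 and [fejer] is at most 1; beyond 1 the power is at most 1 and
    [fejer] decays quadratically. *)
Lemma integrable_fejer_mellin :
  leb.-integrable setT (EFin \o (fun s => `|s| `^ (a - 1) * fejer s)).
Proof.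
have p1 : -1 < a - 1 by rewrite ltrBrDr addrC subrr.
have mk := @measurable_powR_norm R (a - 1).
pose g1 (s : R) := (((`|s| `^ (a - 1))%:E) : \bar R).
have mg1 : measurable_fun setT g1 by exact/measurable_EFinP.
pose g2 (s : R) := ((2 * (1 + s ^+ 2)^-1)%:E : \bar R).
have ig2 : leb.-integrable setT g2 := integrableZl measurableT 2 (@integrable_oneDsqrV R).
have ig1 : leb.-integrable setT (g1 \_ `[(-1)%R, 1%R]).
  have mI : measurable (`[-1, 1]%classic : set (measurableTypeR R)) by exact: measurable_itv.
  apply/(@integrable_mkcond _ _ _ leb `[-1, 1]%classic g1 mI); apply/integrableP; split; first exact: measurable_funTS.
  apply: (@le_lt_trans _ _ (\int[leb]_(u in `[(- 1)%R, 1%R]) (`|u| `^ (a - 1))%:E)%E); last first.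
    exact: le_lt_trans (integral_powR_norm_le p1 (@ltr01 R)) (ltry _).
  by apply: le_eq_integral => s _; rewrite /g1 /= ger0_norm ?powR_ge0.
apply: (le_integrable measurableT _ _ (integrableD measurableT ig1 ig2)).
  by apply/measurable_EFinP; apply: measurable_funM => //; exact: measurable_fejer.
move=> s _ /=.
have h : 0 < 1 + s ^+ 2 by rewrite ltr_pwDl ?sqr_ge0.
have h2 : 0 <= 2 * (1 + s ^+ 2)^-1 by rewrite mulr_ge0 ?invr_ge0 ?ltW.
rewrite ger0_norm; last by rewrite mulr_ge0 ?powR_ge0 ?fejer_ge0.
rewrite patchE mem_setE in_itv/= -ler_norml.
case: ifPn => [_|].
  rewrite /g1 /g2 -EFinD /= lee_fin; apply: le_trans (ler_norm _).
  rewrite (@le_trans _ _ (`|s| `^ (a - 1)))//; last by rewrite lerDl.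
  by rewrite ler_piMr ?powR_ge0// fejer_le1.
rewrite -ltNge => s1; rewrite add0e /g2/= lee_fin; apply: le_trans (ler_norm _).
rewrite -[leRHS]mul1r ler_pM ?powR_ge0 ?fejer_ge0 ?fejer_le//.
have -> : a - 1 = - (1 - a) by rewrite opprB.
have s0 : 0 < `|s| by exact: lt_trans s1.
have : `|s| `^ 0 <= `|s| `^ (1 - a) by apply: ler_powR; rewrite ?subr_ge0 ltW.
by rewrite powRr0 powRN => ?; rewrite invf_le1 ?powR_gt0.
Qed.

(** The two-sided Mellin transform of [fejer] at [a]: it normalises the superposition of dilates
    that represents |u|^(-a). *)
Definition fejer_mellin : R := \int[leb]_s (`|s| `^ (a - 1) * fejer s).

Lemma fejer_mellin_gt0 : 0 < fejer_mellin.
Proof.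
apply: (@lt_le_trans _ _ (1 / 8 * (1 - 1 / 2))); first by rewrite mulr_gt0//; lra.
apply: Rintegral_ge_box; first exact: integrable_fejer_mellin.
- by move=> x; rewrite mulr_ge0 ?powR_ge0 ?fejer_ge0.
- lra.
- lra.
move=> x /[dup] xx /andP[x1 x2]; have x0 : 0 < x by lra.
rewrite -[leLHS]mul1r; apply: ler_pM (fejer_ge xx) => //.
rewrite gtr0_norm// -opprB powRN.
rewrite invf_ge1 ?powR_gt0//.
rewrite (@le_trans _ _ (1 `^ (1 - a)))//; last by rewrite powR1.
by rewrite ge0_ler_powR ?nnegrE ?(ltW x0)// subr_ge0 ltW.
Qed.

Lemma fejer_mellin_scale (u : R) :
  leb.-integrable setT (EFin \o (fun s => `|s| `^ (a - 1) * fejer (s * u))) /\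
  \int[leb]_s (`|s| `^ (a - 1) * fejer (s * u)) = fejer_mellin * `|u| `^ (- a).
Proof.
(* At [u = 0] both sides are 0 by convention: [fejer 0 = 0], and the power of 0 with nonzero
   exponent [- a] is 0. *)
have [->|u0] := eqVneq u 0.
  have E : (fun s => `|s| `^ (a - 1) * fejer (s * 0)) = cst 0.
    by apply/funext => s; rewrite mulr0 fejer0 mulr0.
  rewrite E normr0 powR0 ?oppr_eq0 ?gt_eqF// mulr0; split.
    exact: integrable0.
  by rewrite /Rintegral integral0.
have nu0 : 0 < `|u| by rewrite normr_gt0.
have i1 := integrable_affine 0 u0 integrable_fejer_mellin.
have E s : `|s| `^ (a - 1) * fejer (s * u) =
    `|u| `^ (1 - a) * (`|u * s + 0| `^ (a - 1) * fejer (u * s + 0)).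
  rewrite addr0 normrM powRM// [RHS]mulrA mulrA -powRD; last by rewrite (gt_eqF nu0) implybT.
  by rewrite addrA subrK subrr powRr0 mul1r [s * u]mulrC.
split.
  have := integrableZl measurableT (`|u| `^ (1 - a)) i1.
  by apply: eq_integrable => // s _ /=; rewrite E.
transitivity (\int[leb]_s (`|u| `^ (1 - a) * (`|u * s + 0| `^ (a - 1) * fejer (u * s + 0)))).
  by apply: eq_Rintegral => s _; exact: E.
rewrite RintegralZl//.
rewrite /fejer_mellin (Rintegral_affine 0 u0 integrable_fejer_mellin).
set I := Rintegral _ _ _; rewrite mulrAC; congr (_ * _).
by rewrite -{2}(powRr1 (ltW nu0)) -powRD ?subrK// (gt_eqF nu0) implybT.
Qed.
End fejer_mellin.

Section fourier_lower_bound.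
Context {R : realType}.
Notation leb := (@lebesgue_measure R).
Variables (a : R) (chi : R -> R[i]).
Hypotheses (a0 : 0 < a) (a1 : a < 1).
Hypothesis ichi : cintegrable leb chi.
Hypothesis ising : cintegrable leb (fun u => chi u * (`|u| `^ (- a))%:C).
Hypothesis X_ge0 : forall xi, 0 <= complex.Re (fourier chi xi).

Let mchi : cmeasurable (chi : measurableTypeR R -> R[i]) := cintegrable_cmeasurable ichi.

Let q (x u : R) := complex.Re (cis (pi * x * u) * chi u).

Let F (x : R) (z : measurableTypeR R * measurableTypeR R) : R :=
  `|z.1| `^ (a - 1) * fejer (z.1 * z.2) * q x z.2.

Let mq x : measurable_fun setT (q x).
Proof.
have [h _] : cmeasurable (fun u : measurableTypeR R => cis (pi * x * u) * chi u).
  by apply: cmeasurableM => //; apply: cmeasurable_cis; exact: measurable_mulr3.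
exact: h.
Qed.

Let mF x : measurable_fun setT (F x).
Proof.
have m1 : measurable_fun setT (fun z : measurableTypeR R * measurableTypeR R => z.1) by exact: measurable_fst.
have m2 : measurable_fun setT (fun z : measurableTypeR R * measurableTypeR R => z.2) by exact: measurable_snd.
apply: measurable_funM; last exact: measurableT_comp (mq x) m2.
apply: measurable_funM; first exact: measurableT_comp (@measurable_powR_norm R (a - 1)) m1.
by apply: measurableT_comp (@measurable_fejer R) _; exact: measurable_funM.
Qed.

Let q_le x u : `|q x u| <= normc (chi u).
Proof.
by apply: le_trans (normc_Re _) _; rewrite ComplexField.Normc.normcM normc_cis mul1r.
Qed.

(** Tonelli with the scale integral first: [fejer_mellin_scale] evaluates it to a multiple of
    |u|^(-a), and what remains is the integral of the modulus of the function in [ising]. *)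
Let iF x : (leb \x leb)%E.-integrable setT (EFin \o F x).
Proof.
have mEF : measurable_fun setT (EFin \o F x) by apply/measurable_EFinP; exact: mF.
apply/(integrable21ltyP leb leb mEF).
apply: (@le_lt_trans _ _ (\int[leb]_u ((fejer_mellin a)%:E * (normc (chi u * (`|u| `^ (- a))%:C))%:E))%E).
  apply: ge0_le_integral => //.
  - by move=> u _; apply: integral_ge0.
  - apply: (@measurable_fun_fubini_tonelli_G _ _ _ _ _ leb (abse \o (EFin \o F x))).
      exact: measurableT_comp.
    by move=> z; exact: abse_ge0.
  - apply: emeasurable_funM => //; apply/measurable_EFinP; apply: measurable_normc.
    exact: cintegrable_cmeasurable ising.
  move=> u _.
  have [i1 E] := fejer_mellin_scale a0 a1 u.
  apply: (@le_trans _ _ (\int[leb]_s ((`|q x u|)%:E * (`|s| `^ (a - 1) * fejer (s * u))%:E))%E).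
    apply: le_eq_integral => s _ /=.
    by rewrite -EFinM /F/= normrM ger0_norm 1?mulrC// mulr_ge0 ?powR_ge0 ?fejer_ge0.
  rewrite integralZl// -[X in (_ * X <= _)%E]fineK; last exact: integrable_fin_num i1.
  rewrite -[fine _]/(Rintegral leb setT _) E -!EFinM lee_fin.
  rewrite ComplexField.Normc.normcM normc_real (ger0_norm (powR_ge0 _ _)).
  rewrite mulrCA ler_wpM2l ?(ltW (fejer_mellin_gt0 a0 a1))//.
  by rewrite ler_wpM2r ?powR_ge0.
have iN := cintegrable_normc ising.
rewrite integralZl//; apply: lte_mul_pinfty => //.
  by rewrite lee_fin ltW// fejer_mellin_gt0.
exact: (cintegrableP _ (cintegrable_cmeasurable ising)).1 ising.
Qed.

Let G (x s : R) := \int[leb]_u F x (s, u).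

Let iG x : leb.-integrable setT (EFin \o G x) := integrable_Rintegral1 (iF x).

Let intG x : \int[leb]_s G x s =
  fejer_mellin a * complex.Re (cintegral leb (fun u => cis (pi * x * u) * (chi u * (`|u| `^ (- a))%:C))).
Proof.
rewrite (Rfubini (iF x)) /=.
have [i1 _] := cintegrable_cis x ising.
rewrite -RintegralZl//; apply: eq_Rintegral => u _.
have [i2 E] := fejer_mellin_scale a0 a1 u.
have -> : complex.Re (cis (pi * x * u) * (chi u * (`|u| `^ (- a))%:C)) = q x u * `|u| `^ (- a).
  by rewrite mulrA [LHS]complexReM [complex.Re (_ %:C)]/= [complex.Im (_ %:C)]/= mulr0 subr0.
by rewrite /F /= RintegralZr// E [q _ _ * _]mulrC mulrA.
Qed.

(** At a fixed scale the pairing formula at the point 0 replaces the Fejer kernel by a tent. With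
    the nonnegative transform of [chi] this makes [G] nonnegative, so that parts of its integral may
    be dropped. *)
Let GE x s : s != 0 -> G x s = `|s| `^ (a - 1) / `|s| *
  \int[leb]_xi (tent ((xi + x) / s) * complex.Re (fourier chi xi)).
Proof.
move=> s0; have E := fourier_tent_pairing x 0 s0 ichi.
have [i1 _] := cintegrable_mul_fourier (cintegrable_tent_affine x s0) ichi.
have s1 u : `|fejer (s * u) * q x u| <= normc (chi u).
  rewrite normrM -[leRHS]mul1r ler_pM// ger0_norm ?fejer_ge0//; exact: fejer_le1.
have iq : leb.-integrable setT (EFin \o (fun u => fejer (s * u) * q x u)).
  apply: (le_integrable measurableT _ _ (cintegrable_normc ichi)).
    apply/measurable_EFinP; apply: measurable_funM; last exact: mq.
    by apply: measurableT_comp (@measurable_fejer R) _; exact: measurable_funM.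
  by move=> u _ /=; rewrite lee_fin (le_trans (s1 u))// ler_norm.
rewrite /G /F /=.
transitivity (\int[leb]_u (`|s| `^ (a - 1) * (fejer (s * u) * q x u))).
  by apply: eq_Rintegral => u _; rewrite mulrA.
rewrite RintegralZl// -[RHS]mulrA; congr (_ * _).
transitivity (complex.Re (cintegral leb (fun u => chi u * (cis (- (pi * x * (0 - u))) * (fejer (s * (0 - u)))%:C)))).
  apply: eq_Rintegral => u _; rewrite sub0r !mulrN opprK fejerN mulrA complexReM.
  by rewrite [complex.Re (_ %:C)]/= [complex.Im (_ %:C)]/= mulr0 subr0 mulrC [chi u * _]mulrC.
rewrite E complexReM [complex.Re (_ %:C)]/= [complex.Im (_ %:C)]/= mul0r subr0; congr (_ * _).
apply: eq_Rintegral => xi _; rewrite mulr0 mul0r cis0 mul1r complexReM.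
by rewrite [complex.Re (_ %:C)]/= [complex.Im (_ %:C)]/= mul0r subr0.
Qed.

Let G_ge0 x s : 0 <= G x s.
Proof.
have [->|s0] := eqVneq s 0.
  rewrite /G /F /=; apply: Rintegral_ge0 => u _.
  by rewrite mul0r fejer0 mulr0 mul0r.
rewrite GE// mulr_ge0 ?divr_ge0 ?powR_ge0//; apply: Rintegral_ge0 => xi _.
by rewrite mulr_ge0 ?tent_ge0.
Qed.

(* Up to a constant, [|u|^(-a)] is the superposition of the dilates [fejer (s * u)]
   with weight [|s|^(a - 1)].  Each dilate has a nonnegative tent as its Fourier
   transform, so everything is nonnegative and it suffices to keep the scales
   [2x <= s <= 4x] and the frequencies close to [y0]. *)
Lemma fourier_singular_ge (y0 r e : R) : 0 <= r -> 0 <= e ->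
  (forall y, y0 - r <= y <= y0 + r -> e <= complex.Re (fourier chi y)) ->
  exists2 c : R, c = 3 / 8 * e * r * 4 `^ (a - 1) / fejer_mellin a &
  forall x, 0 < x -> 4 * (`|y0| + r) <= x ->
    c * x `^ (a - 1) <=
    complex.Re (cintegral leb (fun u => cis (pi * x * u) * (chi u * (`|u| `^ (- a))%:C))).
Proof.
move=> r0 e0 He; eexists; first by []; move=> x x0 xy.
have ca := fejer_mellin_gt0 a0 a1.
rewrite mulrAC ler_pdivrMr// [leRHS]mulrC -intG.
(* The factors are (4x)^(a-1) / (4x), the smallest weight over the retained scales; 3/8, a lower
   bound for the tent; [e], one for the transform; [2 * r], the length of the frequency interval;
   and 2x, that of the scale interval. *)
have -> : 3 / 8 * e * r * 4 `^ (a - 1) * x `^ (a - 1) =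
    ((4 * x) `^ (a - 1) / (4 * x) * (3 / 8 * e * (2 * r))) * (4 * x - 2 * x).
  by rewrite powRM ?(ltW x0)//; field; rewrite gt_eqF.
have x4 : 0 < 4 * x by rewrite mulr_gt0.
apply: Rintegral_ge_box => //.
- by rewrite !mulr_ge0 ?powR_ge0 ?invr_ge0 ?(ltW x4).
- by rewrite ler_pM2r// ler_nat.
move=> s /andP[s1 s2]; have s0 : 0 < s by apply: lt_le_trans s1; rewrite mulr_gt0.
rewrite GE ?gt_eqF// (gtr0_norm s0); apply: ler_pM.
- by rewrite divr_ge0 ?powR_ge0// ltW.
- by rewrite !mulr_ge0.
- apply: ler_pM; rewrite ?powR_ge0 ?invr_ge0 ?(ltW x4)//; last by rewrite lef_pV2 ?posrE.
  rewrite -opprB !powRN lef_pV2 ?posrE ?powR_gt0//.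
  by apply: ge0_ler_powR s2; rewrite ?nnegrE ?subr_ge0 ltW.
have -> : 2 * r = (y0 + r) - (y0 - r) by ring.
apply: Rintegral_ge_box.
- have [i1 _] := cintegrable_mul_fourier (cintegrable_tent_affine x (lt0r_neq0 s0)) ichi.
  by apply: eq_integrable i1 => // xi _; rewrite [in LHS]complexReM /= mul0r subr0.
- by move=> xi; rewrite mulr_ge0 ?tent_ge0.
- by rewrite mulr_ge0.
- lra.
move=> xi /[dup] xi12 /andP[xi1 xi2]; apply: ler_pM => //; last exact: He.
have := ler_norm y0; have := ler_norm (- y0); rewrite normrN => n1 n2.
have h1 : 0 <= xi + x by lra.
rewrite /tent le_max ger0_norm ?divr_ge0 ?(ltW s0)//; apply/orP; right.
(* The lower bound on [x] gives xi + x <= 5x/4, and s >= 2x turns this into 5/8, so that the tent is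
   at least 3/8. *)
suff : (xi + x) / s <= 5 / 8 by lra.
rewrite ler_pdivrMr//; lra.
Qed.
End fourier_lower_bound.

(** * Upper and lower bounds for the transform of the singular function *)

Section singular_kernel.
Context {R : realType}.
Notation leb := (@lebesgue_measure R).

Lemma fourierE (f : R -> R[i]) (xi : R) : fourier f xi = 2 * inv_fourier f (- xi).
Proof.
rewrite /inv_fourier mulrA [2 * _]mulrC half_mul2 mul1r; apply: eq_cintegral => x.
by congr (cis _ * _); ring.
Qed.

Variables (p : R) (chi : R -> R[i]).
Hypotheses (p1 : -1 < p) (hchi : test_function chi).

Let h (u : R) : R[i] := chi u * (`|u| `^ p)%:C.

Let H (x : R) := cintegral leb (fun u => cis (pi * x * u) * h u).

Let mchi : cmeasurable (chi : measurableTypeR R -> R[i]).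
Proof.
have [c1 c2] := test_function_continuous hchi.
by split; exact: continuous_measurable_fun.
Qed.

Lemma cintegrable_test_function : cintegrable leb chi.
Proof.
have [[s1 s2] _] := hchi; have [M _ HM] := test_function_support hchi.
apply: schwartz_cintegrable; split => //;
  by apply: (@compact_support_rapidly_decreasing _ _ M) => // x /HM ->.
Qed.

Lemma cintegrable_kernel : cintegrable leb h.
Proof.
have [M M1 HM] := test_function_support hchi.
have [B B0 [chiB chiL]] := test_function_bounds hchi.
exact: (@cintegrable_singular R p M B).
Qed.

Lemma fourier_kernel_decay : exists2 C : R, 0 <= C & forall x,
  normc (H x) <= C /\ (1 <= `|x| -> normc (H x) <= C * `|x| `^ (- Num.min 1 (p + 1))).
Proof.
have [M M1 HM] := test_function_support hchi.
have [B B0 [chiB chiL]] := test_function_bounds hchi.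
have [C1 H1] := @fourier_decay_pos R p M B chi p1 M1 B0 mchi chiB chiL HM.
(* Negative frequencies are positive frequencies of the reflected function, which satisfies the same
   bounds. *)
have mchiN : cmeasurable ((fun u => chi (- u)) : measurableTypeR R -> R[i]).
  have mN : measurable_fun setT ((fun u : R => - u) : measurableTypeR R -> measurableTypeR R).
    exact: measurable_funN.
  by have [h1 h2] := mchi; split; [exact: measurableT_comp h1 mN|exact: measurableT_comp h2 mN].
have [|||C2 H2] := @fourier_decay_pos R p M B (fun u => chi (- u)) p1 M1 B0 mchiN.
- by move=> x; exact: chiB.
- by move=> x y; apply: le_trans (chiL _ _) _; rewrite -opprD normrN.
- by move=> x Mx; rewrite HM// normrN.
pose C3 := fine (2%:E * \int[leb]_u (normc (h u))%:E)%E.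
have H3 x : normc (H x) <= C3.
  rewrite -lee_fin; have := @normc_singular_le R p M B chi p1 M1 B0 mchi chiB HM x.
  by rewrite fineK// fin_numM//; exact: integrable_fin_num (cintegrable_normc cintegrable_kernel).
have HN x : H (- x) = cintegral leb (fun u => cis (pi * x * u) * (chi (- u) * (`|u| `^ p)%:C)).
  rewrite /H (@cintegral_affine R (-1) 0 _ _ (cintegrable_cis (- x) cintegrable_kernel)); last first.
    by rewrite oppr_eq0 oner_eq0.
  rewrite normrN normr1 mul1r; apply: eq_cintegral => u.
  by rewrite addr0 mulN1r /h normrN; congr (cis _ * _); ring.
exists (Num.max C3 (Num.max C1 C2)).
  by rewrite le_max (le_trans (normc_ge0 _) (H3 0)).
move=> x; split; first by rewrite le_max H3.
have [x0|x0] := leP 0 x.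
  rewrite ger0_norm// => x1; apply: le_trans (H1 x x1) _.
  by rewrite ler_wpM2r ?powR_ge0// !le_max lexx orbT.
rewrite ltr0_norm// => x1; rewrite -[x]opprK HN opprK; apply: le_trans (H2 _ x1) _.
by rewrite ler_wpM2r ?powR_ge0// !le_max lexx !orbT.
Qed.

Lemma fourier_kernel_ge : p < 0 -> (exists x, chi x <> 0) ->
  (forall xi, 0 <= fourier chi xi) ->
  exists c x0 : R, [/\ 0 < c, 1 <= x0 &
    forall x, x0 <= x -> c * x `^ (- (p + 1)) <= normc (H x)].
Proof.
move=> p0 [z chiz] fge0.
have [c1 c2] := test_function_continuous hchi.
have [B B0 [chiB _]] := test_function_bounds hchi.
have ichi := cintegrable_test_function.
have X0 xi : 0 <= complex.Re (fourier chi xi) by have := fge0 xi; case: (fourier _ _) => u v /andP[].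
(* A transform vanishing everywhere would force [chi] to vanish by [fourier_eq0]; nonnegativity
   turns nonvanishing into positivity. Continuity then spreads it over an interval. *)
have [y0 y0_gt] : exists y, 0 < complex.Re (fourier chi y).
  apply: contrapT => Hn; apply: chiz; apply: (fourier_eq0 ichi c1 c2 chiB) => xi.
  have : complex.Re (fourier chi xi) = 0.
    by apply/eqP; rewrite eq_le X0 andbT leNgt; apply/negP => ?; apply: Hn; exists xi.
  by have := fge0 xi; case: (fourier _ _) => u v; rewrite lecE/= => /andP[/eqP-> _] ->.
have cX : continuous (fun y => complex.Re (fourier chi y)).
  have -> : (fun y => complex.Re (fourier chi y)) = (fun y => 2 * complex.Re (inv_fourier chi (- y))).
    apply/funext => y; rewrite fourierE; have -> : (2 : R[i]) = (2 : R)%:C by rewrite rmorph_nat.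
    by case: (inv_fourier _ _) => u v; rewrite complexReM/= mul0r subr0.
  move=> y; apply: cvgM; first exact: cvg_cst.
  have [cI _] := inv_fourier_continuous ichi.
  apply: (@continuous_comp _ _ _ (fun y : R => - y) (fun y => complex.Re (inv_fourier chi y))); last exact: cI.
  by apply: cvgN; exact: cvg_id.
have : \forall y \near y0, complex.Re (fourier chi y0) / 2 < complex.Re (fourier chi y).
  have /cvgrPdist_lt/(_ (complex.Re (fourier chi y0) / 2)) := cX y0.
  move=> /(_ (divr_gt0 y0_gt (ltr0n _ 2))); apply: filterS => y.
  by rewrite ltr_norml => /andP[_ ?]; lra.
move=> /nbhs_ballP[e e0 He]; have {}e0 : 0 < e := e0.
pose X := complex.Re (fourier chi y0); pose r := e / 2.
have r0 : 0 < r by rewrite divr_gt0.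
have a0 : 0 < - p by rewrite oppr_gt0.
have a1 : - p < 1 by rewrite ltrNl.
have ik : cintegrable leb (fun u => chi u * (`|u| `^ (- - p))%:C) by rewrite opprK; exact: cintegrable_kernel.
have X2 : 0 <= X / 2 by rewrite divr_ge0// ltW.
have [|c cE Hc] := @fourier_singular_ge R (- p) chi a0 a1 ichi ik X0 y0 r (X / 2) (ltW r0) X2.
  move=> y /andP[y1 y2]; rewrite ltW//; apply: He.
  by rewrite /ball/= ltr_norml; move: y1 y2; rewrite /r => y1 y2; apply/andP; split; lra.
exists c, (Num.max 1 (4 * (`|y0| + r))); split.
- rewrite cE divr_gt0 ?fejer_mellin_gt0// mulr_gt0 ?powR_gt0// mulr_gt0// mulr_gt0 ?divr_gt0//.
- by rewrite le_max lexx.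
- move=> x; rewrite ge_max => /andP[x1 x2].
  have -> : - (p + 1) = - p - 1 by ring.
  apply: le_trans (Hc x (lt_le_trans ltr01 x1) x2) _; rewrite opprK.
  by apply: le_trans (ler_norm _) _; exact: normc_Re.
Qed.
End singular_kernel.

(** * Riesz products and their transfer operator *)

Section riesz_product.
Context {R : realType}.
Notation leb := (@lebesgue_measure R).

Definition riesz (n : nat) (t : R) : R := \prod_(0 <= j < n) `|cos (pi * 3 ^+ j * t)|.

Lemma normr_cosDnpi (x : R) (n : nat) : `|cos (x + pi *+ n)| = `|cos x|.
Proof.
elim: n => [|n IH]; first by rewrite addr0.
by rewrite mulrSr addrA cosDpi normrN.
Qed.

Lemma riesz0 t : riesz 0 t = 1. Proof. by rewrite /riesz big_geq. Qed.

Lemma rieszS n t : riesz n.+1 t = `|cos (pi * t)| * riesz n (3 * t).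
Proof.
rewrite /riesz big_nat_recl// expr0 mulr1; congr (_ * _).
by apply: eq_bigr => j _; rewrite exprS; congr (`|cos _|); ring.
Qed.

Lemma riesz_ge0 n t : 0 <= riesz n t.
Proof. by rewrite /riesz prodr_ge0. Qed.

Lemma riesz_le1 n t : riesz n t <= 1.
Proof.
elim: n t => [|n IH] t; first by rewrite riesz0.
by rewrite rieszS mulr_ile1 ?riesz_ge0 ?cos_max ?IH.
Qed.

Lemma rieszD1 n t : riesz n (t + 1) = riesz n t.
Proof.
apply: eq_bigr => j _; rewrite mulrDr mulr1 -natrX.
by rewrite [pi * (3 ^ j)%:R]mulr_natr normr_cosDnpi.
Qed.

Lemma rieszB1 n t : riesz n (t - 1) = riesz n t.
Proof. by rewrite -[in RHS](subrK 1 t) rieszD1. Qed.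

Lemma measurable_normr_cospi : measurable_fun setT (fun t : R => `|cos (pi * t)|).
Proof.
apply: measurableT_comp => //.
apply: (@measurableT_comp _ _ _ _ _ _ (@cos R) _ (fun t => pi * t)).
  by apply: continuous_measurable_fun; exact: continuous_cos.
exact: measurable_funM.
Qed.

Lemma measurable_riesz n : measurable_fun setT (riesz n).
Proof.
elim: n => [|n IH].
  by rewrite (_ : riesz 0 = cst 1)//; apply/funext => t; rewrite riesz0.
rewrite (_ : riesz n.+1 = (fun t => `|cos (pi * t)| * riesz n (3 * t))); last first.
  by apply/funext => t; rewrite rieszS.
apply: measurable_funM; first exact: measurable_normr_cospi.
by apply: measurableT_comp IH _; exact: measurable_funM.
Qed.

(* Dual of multiplication by [|cos (pi t)|] followed by tripling on the circle,
   with [-1/2, 1/2[ as fundamental domain. *)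
Definition transfer (f : R -> R) (u : R) : R :=
  let w t := `|cos (pi * t)| * f t in (w ((u - 1) / 3) + w (u / 3) + w ((u + 1) / 3)) / 3.

Lemma transfer_ge0 f u : (forall x, 0 <= f x) -> 0 <= transfer f u.
Proof. by move=> f0; rewrite /transfer divr_ge0// !addr_ge0// mulr_ge0. Qed.

Lemma measurable_transfer f : measurable_fun setT f -> measurable_fun setT (transfer f).
Proof.
move=> mf; rewrite /transfer.
have mw : measurable_fun setT (fun t => `|cos (pi * t)| * f t).
  by apply: measurable_funM => //; exact: measurable_normr_cospi.
have H (b : R) : measurable_fun setT (fun u : R => `|cos (pi * ((u + b) / 3))| * f ((u + b) / 3)).
  apply: (@measurableT_comp _ _ _ _ _ _ (fun t => `|cos (pi * t)| * f t) _ (fun u : R => (u + b) / 3) mw).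
  by apply: measurable_funM => //; exact: measurable_funD.
apply: measurable_funM => //; apply: measurable_funD; last exact: H.
apply: measurable_funD; first exact: H.
by have := H 0; under eq_fun do rewrite addr0.
Qed.

Let integral_third (w : R -> R) (k : R) : measurable_fun setT w -> (forall x, 0 <= w x) ->
  (\int[leb]_(t in `[((- (1 / 2) + k) / 3)%R, ((1 / 2 + k) / 3)%R[) (w t)%:E =
   \int[leb]_(u in `[(- (1 / 2))%R, (1 / 2)%R[) (w ((u + k) / 3) / 3)%:E)%E.
Proof.
move=> mw w0.
have mw' : measurable_fun setT (fun u : R => w ((u + k) / 3)).
  apply: (@measurableT_comp _ _ _ _ _ _ w _ (fun u : R => (u + k) / 3) mw).
  by apply: measurable_funM => //; exact: measurable_funD.
have mwE : measurable_fun setT (fun t => (w t)%:E) by exact/measurable_EFinP.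
have w0E x : (0 <= (w x)%:E)%E by rewrite lee_fin.
rewrite (@ge0_integral_affine_set _ 3^-1 (k / 3))//.
have -> : (fun x => 3^-1 * x + k / 3) @^-1` `[(- (1 / 2) + k) / 3, (1 / 2 + k) / 3[ =
    `[- (1 / 2), 1 / 2[%classic.
  by apply/seteqP; split => x /=; rewrite !in_itv/= => /andP[x1 x2]; apply/andP; split; lra.
have mE : measurable_fun setT (fun x : R => (w (3^-1 * x + k / 3))%:E).
  apply/measurable_EFinP; apply: (@measurableT_comp _ _ _ _ _ _ w _ (fun x : R => 3^-1 * x + k / 3) mw).
  exact: measurable_affine.
rewrite ger0_norm// -ge0_integralZl//; last exact: measurable_funTS mE.
by apply: eq_integral => u _; rewrite -EFinM mulrC [3^-1 * u]mulrC -mulrDl.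
Qed.

(** Tripling followed by an integer shift carries each third of the fundamental domain onto the
    whole, and the period 1 of [riesz n] absorbs the shift. Half-open intervals make the thirds an
    exact partition. *)
Lemma integral_transfer (f : R -> R) n : measurable_fun setT f -> (forall x, 0 <= f x) ->
  (\int[leb]_(t in `[(- (1 / 2))%R, (1 / 2)%R[) (f t * riesz n.+1 t)%:E =
   \int[leb]_(t in `[(- (1 / 2))%R, (1 / 2)%R[) (transfer f t * riesz n t)%:E)%E.
Proof.
move=> mf f0.
pose w t := (`|cos (pi * t)| * f t) * riesz n (3 * t).
have w0 t : 0 <= w t by rewrite !mulr_ge0 ?riesz_ge0.
have mr : measurable_fun setT (fun t : R => riesz n (3 * t)).
  by apply: (@measurableT_comp _ _ _ _ _ _ (riesz n) _ (fun t : R => 3 * t)); [exact: measurable_riesz|exact: measurable_funM].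
have mw : measurable_fun setT w.
  by apply: measurable_funM => //; apply: measurable_funM => //; exact: measurable_normr_cospi.
have mwk (k : R) : measurable_fun setT (fun u : R => (w ((u + k) / 3) / 3)%:E).
  apply/measurable_EFinP; apply: measurable_funM => //.
  apply: (@measurableT_comp _ _ _ _ _ _ w _ (fun u : R => (u + k) / 3) mw).
  by apply: measurable_funM => //; exact: measurable_funD.
have mwE : measurable_fun setT (fun t => (w t)%:E) by exact/measurable_EFinP.
have w0' x : (0 <= (w x)%:E)%E by rewrite lee_fin.
have wk0 (k u : R) : (0 <= (w ((u + k) / 3) / 3)%:E)%E by rewrite lee_fin divr_ge0.
transitivity (\int[leb]_(t in `[(- (1 / 2))%R, (1 / 2)%R[) (w t)%:E)%E.
  by apply: eq_integral => t _; rewrite rieszS /w mulrCA mulrA.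
have E1 : `[- (1 / 2), 1 / 2[%classic = `[(- (1 / 2) + -1) / 3, (1 / 2 + -1) / 3[%classic `|`
    (`[(- (1 / 2) + 0) / 3, (1 / 2 + 0) / 3[%classic `|` `[(- (1 / 2) + 1) / 3, ((1 / 2 + 1) / 3 : R)[%classic).
  apply/seteqP; split => x /=; rewrite !in_itv/=.
    move=> /andP[x1 x2]; have [x3|x3] := ltP x ((1 / 2 + -1) / 3).
      by left; apply/andP; split => //; lra.
    right; have [x4|x4] := ltP x ((1 / 2 + 0) / 3).
      by left; apply/andP; split => //; lra.
    by right; apply/andP; split; lra.
  by move=> [|[]] /andP[x1 x2]; apply/andP; split; lra.
rewrite [in LHS]E1 ge0_integral_setU//; last 3 first.
- exact: measurableU.
- exact: measurable_funTS.
- by apply/disj_setPS => y [/=]; rewrite !in_itv/= => /andP[_ y1] [/andP[]|/andP[]]; lra.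
rewrite [X in (_ + X)%E]ge0_integral_setU//; last 2 first.
- exact: measurable_funTS.
- by apply/disj_setPS => y [/=]; rewrite !in_itv/= => /andP[_ y1] /andP[]; lra.
rewrite !integral_third//.
have mwT k : measurable_fun (`[- (1 / 2), 1 / 2[%classic : set (measurableTypeR R)) (fun u : R => (w ((u + k) / 3) / 3)%:E).
  exact: measurable_funTS (mwk k).
rewrite -(ge0_integralD _ _ _ (mwT 0) _ (mwT 1))// -(ge0_integralD _ _ _ (mwT (-1)))//; last 2 first.
- by move=> x _; rewrite adde_ge0.
- exact: emeasurable_funD.
apply: eq_integral => u _; rewrite -!EFinD; congr EFin.
have E3 : 3 * ((u - 1) / 3) = u - 1 by field.
have E4 : 3 * (u / 3) = u by field.
have E5 : 3 * ((u + 1) / 3) = u + 1 by field.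
by rewrite /w addr0 E3 E4 E5 rieszB1 rieszD1 /transfer; field.
Qed.

Lemma integral_iter_transfer (f : R -> R) n : measurable_fun setT f -> (forall x, 0 <= f x) ->
  (\int[leb]_(t in `[(- (1 / 2))%R, (1 / 2)%R[) (f t * riesz n t)%:E =
   \int[leb]_(t in `[(- (1 / 2))%R, (1 / 2)%R[) (iter n transfer f t)%:E)%E.
Proof.
elim: n f => [|n IH] f mf f0.
  by apply: eq_integral => t _; rewrite riesz0 mulr1.
rewrite integral_transfer// IH; last 2 first.
- exact: measurable_transfer.
- by move=> x; exact: transfer_ge0.
by apply: eq_integral => t _; rewrite iterSr.
Qed.

(** The symmetric domain is preferred because the branches u/3, (u - 1)/3 and (u + 1)/3 of
    [transfer] map it into itself, and |cos (pi t)| is cos (pi t) there. *)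
Lemma integral_riesz_shift n :
  (\int[leb]_(t in `[0%R, 1%R]) (riesz n t)%:E =
   \int[leb]_(t in `[(- (1 / 2))%R, (1 / 2)%R[) (riesz n t)%:E)%E.
Proof.
have mr : measurable_fun setT (fun t => (riesz n t)%:E).
  by apply/measurable_EFinP; exact: measurable_riesz.
have r0 t : (0 <= (riesz n t)%:E)%E by rewrite lee_fin riesz_ge0.
rewrite -integral_itv_bndo_bndc; last exact: measurable_funTS.
have -> : `[0, 1[%classic = `[0, 1 / 2[%classic `|` `[1 / 2, 1[%classic :> set R.
  by rewrite -(@itv_bndbnd_setU _ _ (BLeft 0) (BLeft (1 / 2)) (BLeft 1)) ?bnd_simp//; lra.
have -> : `[- (1 / 2), 1 / 2[%classic = `[- (1 / 2), 0[%classic `|` `[0, 1 / 2[%classic :> set R.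
  by rewrite -(@itv_bndbnd_setU _ _ (BLeft (- (1 / 2))) (BLeft 0) (BLeft (1 / 2))) ?bnd_simp//; lra.
rewrite ge0_integral_setU//; last 2 first.
- exact: measurable_funTS.
- by apply/disj_setPS => y [/=]; rewrite !in_itv/= => /andP[_ y1] /andP[]; lra.
rewrite ge0_integral_setU//; last 2 first.
- exact: measurable_funTS.
- by apply/disj_setPS => y [/=]; rewrite !in_itv/= => /andP[_ y1] /andP[]; lra.
rewrite addeC; congr (_ + _)%E.
rewrite (@ge0_integral_affine_set _ 1 1)// ?oner_eq0// normr1 mul1e.
have -> : (fun x : R => 1 * x + 1) @^-1` `[1 / 2, 1[ = `[- (1 / 2), 0[%classic.
  by apply/seteqP; split => x /=; rewrite !in_itv/= => /andP[x1 x2]; apply/andP; split; lra.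
by apply: eq_integral => t _; rewrite mul1r rieszD1.
Qed.
End riesz_product.

Section trigonometry.
Context {R : realType}.

Lemma cos_triple (x : R) : cos (3 * x) = 4 * cos x ^+ 3 - 3 * cos x.
Proof.
have -> : 3 * x = x *+ 2 + x by rewrite -mulr_natr; ring.
rewrite cosD cos_mulr2n sin_mulr2n.
have -> : (cos x * sin x) *+ 2 * sin x = 2 * cos x * sin x ^+ 2 by rewrite -mulr_natr; ring.
by rewrite sin2cos2 -mulr_natr; ring.
Qed.

Lemma cos_pi3 : cos (pi / 3) = 1 / 2 :> R.
Proof.
have p0 := @pi_gt0 R.
have c0 : 0 < cos (pi / 3) :> R by apply: cos_gt0_pihalf; apply/andP; split; lra.
have := cos_triple (pi / 3); rewrite (_ : 3 * (pi / 3) = pi); last by field.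
rewrite cospi; move: (cos _) c0 => c c0 E.
have : (c + 1) * (2 * c - 1) ^+ 2 = 0.
  have -> : (c + 1) * (2 * c - 1) ^+ 2 = (4 * c ^+ 3 - 3 * c) + 1 by ring.
  by rewrite -E addNr.
move/eqP; rewrite mulf_eq0 sqrf_eq0 gt_eqF /=; last by rewrite ltr_pwDl.
by move=> /eqP ?; lra.
Qed.

Lemma sin_pi3 : sin (pi / 3) ^+ 2 = 3 / 4 :> R.
Proof. by rewrite sin2cos2 cos_pi3; field. Qed.
End trigonometry.

Section transfer_iterates.
Context {R : realType}.
Notation leb := (@lebesgue_measure R).
Implicit Types (f g : R -> R) (u v : R).

Definition transfer1 (n : nat) : R -> R := iter n transfer (fun=> 1).

Lemma normr_third u : `|u| <= 1 / 2 ->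
  [/\ `|(u - 1) / 3| <= 1 / 2, `|u / 3| <= 1 / 2 & `|(u + 1) / 3| <= 1 / 2].
Proof. by rewrite !ler_norml => /andP[u1 u2]; split; apply/andP; split; lra. Qed.

Lemma transfer_le f g : (forall u, `|u| <= 1 / 2 -> f u <= g u) ->
  forall u, `|u| <= 1 / 2 -> transfer f u <= transfer g u.
Proof.
move=> fg u /normr_third[u1 u2 u3]; rewrite /transfer ler_pM2r ?invr_gt0//.
by rewrite !lerD// ler_wpM2l// fg.
Qed.

Lemma transferZ (c : R) f u : transfer (fun x => c * f x) u = c * transfer f u.
Proof. by rewrite /transfer; ring. Qed.

Lemma transfer1S n u : transfer1 n.+1 u = transfer (transfer1 n) u.
Proof. by []. Qed.

Lemma transfer1_ge0 n u : 0 <= transfer1 n u.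
Proof. by elim: n u => [|n IH] u //; exact: transfer_ge0. Qed.

Lemma transfer1_le1 n u : transfer1 n u <= 1.
Proof.
elim: n u => [//|n IH] u; rewrite transfer1S /transfer ler_pdivrMr// mul1r.
have H x : `|cos (pi * x)| * transfer1 n x <= 1.
  by rewrite mulr_ile1 ?cos_max ?transfer1_ge0.
by rewrite (_ : 3 = 1 + 1 + 1) ?lerD//; ring.
Qed.

Lemma measurable_transfer1 n : measurable_fun setT (transfer1 n).
Proof. by elim: n => [|n IH]; [exact: measurable_cst|exact: measurable_transfer]. Qed.

(** Since |cos| is at least its square, it suffices to add the squared cosines of three angles
    spaced by pi/3, whose sum is 3/2. *)
Lemma transfer_one_ge u : 1 / 2 <= transfer (fun=> 1) u.
Proof.
rewrite /transfer !mulr1 ler_pdivlMr//.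
have H (x : R) : cos x ^+ 2 <= `|cos x|.
  by rewrite -real_normK ?num_real// expr2 ler_piMl// cos_max.
set a := pi * (u / 3).
have -> : pi * ((u - 1) / 3) = a - pi / 3 by rewrite /a; field.
have -> : pi * ((u + 1) / 3) = a + pi / 3 by rewrite /a; field.
apply: (le_trans _ (lerD (lerD (H (a - pi / 3)) (H a)) (H (a + pi / 3)))).
rewrite cosB cosD cos_pi3; have := cos2Dsin2 a; have := @sin_pi3 R.
move: (sin (pi / 3)) (cos a) (sin a) => S c s S2 cs.
rewrite le_eqVlt; apply/orP; left; apply/eqP.
have -> : (c * (1 / 2) + s * S) ^+ 2 + c ^+ 2 + (c * (1 / 2) - s * S) ^+ 2 =
  3 / 2 * c ^+ 2 + 2 * s ^+ 2 * S ^+ 2 by field.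
rewrite S2; have -> : 3 / 2 * c ^+ 2 + 2 * s ^+ 2 * (3 / 4) = 3 / 2 * (c ^+ 2 + s ^+ 2) by field.
by rewrite cs; field.
Qed.

(** Monotonicity of [transfer] propagates the bound 1/2 for the first iterate. It prevents the
    suprema from dropping too fast, which the Lipschitz estimate needs. *)
Lemma transfer1S_ge n u : `|u| <= 1 / 2 -> transfer1 n u / 2 <= transfer1 n.+1 u.
Proof.
elim: n u => [|n IH] u uJ; first by rewrite /transfer1/= transfer_one_ge.
rewrite transfer1S [leRHS]transfer1S mulrC -transferZ; apply: transfer_le => // v vJ.
by rewrite mulrC IH.
Qed.

Lemma transfer1_ge n u : `|u| <= 1 / 2 -> (1 / 2) ^+ n <= transfer1 n u.
Proof.
elim: n => [//|n IH] uJ; apply: le_trans (transfer1S_ge n uJ).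
by rewrite exprSr div1r ler_pM2r ?invr_gt0// -div1r IH.
Qed.

Definition transfer_sup n := sup (transfer1 n @` [set u | `|u| <= 1 / 2]).

Let has_sup_transfer1 n : has_sup (transfer1 n @` [set u | `|u| <= 1 / 2]).
Proof.
split; first by exists (transfer1 n 0), 0 => //=; rewrite normr0.
by exists 1 => _ [u _ <-]; exact: transfer1_le1.
Qed.

Lemma transfer1_le_sup n u : `|u| <= 1 / 2 -> transfer1 n u <= transfer_sup n.
Proof. by move=> uJ; apply: sup_upper_bound => //; exists u. Qed.

Lemma transfer_sup_le n (y : R) : (forall u, `|u| <= 1 / 2 -> transfer1 n u <= y) ->
  transfer_sup n <= y.
Proof.
move=> H; apply: sup_le_ub; first by case: (has_sup_transfer1 n).
by move=> _ [u uJ <-]; exact: H.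
Qed.

Lemma transfer_sup_le1 n : transfer_sup n <= 1.
Proof. by apply: transfer_sup_le => u _; exact: transfer1_le1. Qed.

Lemma transfer_sup_ge n : (1 / 2) ^+ n <= transfer_sup n.
Proof.
have J0 : `|0 : R| <= 1 / 2 by rewrite normr0.
exact: le_trans (transfer1_ge n J0) (transfer1_le_sup n J0).
Qed.

Lemma transfer_sup_gt0 n : 0 < transfer_sup n.
Proof. by apply: lt_le_trans (transfer_sup_ge n); rewrite exprn_gt0. Qed.

Lemma transfer_sup_adherent n : exists2 u, `|u| <= 1 / 2 & transfer_sup n / 2 <= transfer1 n u.
Proof.
have M0 := transfer_sup_gt0 n; have M2 : 0 < transfer_sup n / 2 by rewrite divr_gt0.
have [_ [u uJ <-] H] := sup_adherent M2 (has_sup_transfer1 n).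
by exists u => //; move: H; rewrite -/(transfer_sup n); lra.
Qed.

(** After [n] steps the function is at most the constant [transfer_sup n], and by positivity and
    linearity the other [m] steps multiply this constant by at most [transfer_sup m].
    Submultiplicativity is what Fekete's argument rests on. *)
Lemma transfer_supD n m : transfer_sup (n + m) <= transfer_sup n * transfer_sup m.
Proof.
apply: transfer_sup_le => u uJ.
apply: (@le_trans _ _ (transfer_sup n * transfer1 m u)); last first.
  by rewrite ler_wpM2l ?transfer1_le_sup// ltW// transfer_sup_gt0.
elim: m u uJ => [|m IH] u uJ; first by rewrite addn0 mulr1 transfer1_le_sup.
by rewrite addnS !transfer1S -transferZ; apply: transfer_le.
Qed.

Lemma transfer_supS_ge n : transfer_sup n <= 2 * transfer_sup n.+1.
Proof.
apply: transfer_sup_le => u uJ.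
rewrite mulrC -ler_pdivrMr//; apply: le_trans (transfer1S_ge n uJ) _.
exact: transfer1_le_sup.
Qed.

Lemma lipschitz_normr_cospi u v : `| `|cos (pi * u)| - `|cos (pi * v)| | <= 4 * `|u - v|.
Proof.
apply: le_trans (ler_dist_dist _ _) _; apply: le_trans (lipschitz_cos _ _) _.
rewrite -mulrBr normrM ler_wpM2r// ger0_norm ?pi_ge0//.
by have := @pihalf_lt2 R; rewrite ltr_pdivrMr// => /ltW; rewrite -natrM.
Qed.

(** The constant 8 reproduces itself: the product with the 4-Lipschitz |cos (pi t)| raises it to 12,
    the contraction by 3 of the branches lowers it to 4, and passing from [transfer_sup n] to
    [transfer_sup n.+1] costs a factor 2. *)
Lemma transfer1_lipschitz n u v : `|u| <= 1 / 2 -> `|v| <= 1 / 2 ->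
  `|transfer1 n u - transfer1 n v| <= 8 * transfer_sup n * `|u - v|.
Proof.
elim: n u v => [|n IH] u v uJ vJ.
  by rewrite /transfer1/= subrr normr0 !mulr_ge0// ltW// transfer_sup_gt0.
have M0 := ltW (transfer_sup_gt0 n).
pose w t := `|cos (pi * t)| * transfer1 n t.
have H s t : `|s| <= 1 / 2 -> `|t| <= 1 / 2 -> `|w s - w t| <= 12 * transfer_sup n * `|s - t|.
  move=> sJ tJ.
  have -> : w s - w t =
     `|cos (pi * s)| * (transfer1 n s - transfer1 n t) +
     (`|cos (pi * s)| - `|cos (pi * t)|) * transfer1 n t by rewrite /w; ring.
  apply: le_trans (ler_normD _ _) _; rewrite !normrM normr_id.
  have -> : 12 * transfer_sup n * `|s - t| =
    1 * (8 * transfer_sup n * `|s - t|) + (4 * `|s - t|) * transfer_sup n by ring.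
  apply: lerD; apply: ler_pM => //; [exact: cos_max|exact: IH|exact: lipschitz_normr_cospi|].
  by rewrite ger0_norm ?transfer1_ge0// transfer1_le_sup.
have [u1 u2 u3] := normr_third uJ; have [v1 v2 v3] := normr_third vJ.
have D k : `|(u + k) / 3 - (v + k) / 3| = `|u - v| / 3.
  by rewrite -mulrBl opprD addrACA subrr addr0 normrM [`|3^-1|]ger0_norm.
have D0 : `|u / 3 - v / 3| = `|u - v| / 3 by have := D 0; rewrite !addr0.
have := H _ _ u1 v1; have := H _ _ u2 v2; have := H _ _ u3 v3; rewrite !D D0.
have T x : transfer1 n.+1 x = (w ((x - 1) / 3) + w (x / 3) + w ((x + 1) / 3)) / 3 by [].
clearbody w => h3 h2 h1; rewrite !T {T}.
have -> : (w ((u - 1) / 3) + w (u / 3) + w ((u + 1) / 3)) / 3 -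
    (w ((v - 1) / 3) + w (v / 3) + w ((v + 1) / 3)) / 3 = ((w ((u - 1) / 3) - w ((v - 1) / 3)) +
    (w (u / 3) - w (v / 3)) + (w ((u + 1) / 3) - w ((v + 1) / 3))) / 3.
  by ring.
move: h1 h2 h3; set A1 := w _ - _; set A2 := w _ - _; set A3 := w _ - _ => h1 h2 h3.
rewrite normrM [`|3^-1|]ger0_norm// ler_pdivrMr//; apply: le_trans (ler_normD _ _) _.
have h23 := ler_normD A1 A2.
have h4 := transfer_supS_ge n.
have h5 : 12 * transfer_sup n * `|u - v| <= 12 * (2 * transfer_sup n.+1) * `|u - v|.
  by rewrite ler_wpM2r// ler_pM2l.
lra.
Qed.
End transfer_iterates.

(** * The growth rate of the integrated Riesz products *)

Section growth_rate.
Context {R : realType}.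
Notation leb := (@lebesgue_measure R).

Definition riesz_integral (n : nat) : R := \int[leb]_(t in `[0, 1]) riesz n t.

Let riesz_integralE n : ((riesz_integral n)%:E =
  \int[leb]_(t in `[(- (1 / 2))%R, (1 / 2)%R[) (transfer1 n t)%:E)%E /\
  riesz_integral n <= transfer_sup n.
Proof.
have E : (\int[leb]_(t in `[0%R, 1%R]) (riesz n t)%:E =
    \int[leb]_(t in `[(- (1 / 2))%R, (1 / 2)%R[) (transfer1 n t)%:E)%E.
  rewrite integral_riesz_shift -(@integral_iter_transfer _ (fun=> 1))//.
  by apply: eq_integral => t _; rewrite mul1r.
have L : leb `[- (1 / 2), 1 / 2[ = 1%:E.
  rewrite lebesgue_measure_itv/= lte_fin ifT; last by lra.
  by rewrite -EFinD; congr EFin; lra.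
have le1 : (\int[leb]_(t in `[(- (1 / 2))%R, (1 / 2)%R[) (transfer1 n t)%:E <= (transfer_sup n)%:E)%E.
  rewrite -[leRHS]mule1 -L -integral_cst//.
  apply: ge0_le_integral => //.
  - by move=> x _; rewrite lee_fin transfer1_ge0.
  - apply: measurable_funTS; apply/measurable_EFinP; exact: measurable_transfer1.
  - move=> x /=; rewrite in_itv/= => /andP[x1 x2]; rewrite lee_fin transfer1_le_sup//.
    by rewrite ler_norml x1 ltW.
have F : (riesz_integral n)%:E = (\int[leb]_(t in `[(- (1 / 2))%R, (1 / 2)%R[) (transfer1 n t)%:E)%E.
  rewrite /riesz_integral /Rintegral E fineK// ge0_fin_numE.
    exact: le_lt_trans le1 (ltry _).
  by apply: integral_ge0 => x _; rewrite lee_fin transfer1_ge0.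
by split=> //; rewrite -lee_fin F.
Qed.

Lemma riesz_integral_le n : riesz_integral n <= transfer_sup n.
Proof. by have [] := riesz_integralE n. Qed.

(* The supremum is attained up to a factor 2, and the Lipschitz bound keeps
   [transfer1 n] above a quarter of it on an interval of length 1/32. *)
Lemma riesz_integral_ge n : transfer_sup n / 128 <= riesz_integral n.
Proof.
have [F _] := riesz_integralE n; have M0 := transfer_sup_gt0 n (R := R).
have [u uJ Hu] := transfer_sup_adherent n (R := R).
(* The interval lies to the right of a nonpositive [u] and to the left of a positive one, so that it
   stays in the domain. *)
have [a [a1 a2 Ha]] : exists a : R, [/\ - (1 / 2) <= a, a + 1 / 32 <= 1 / 2 &
    forall x, a <= x <= a + 1 / 32 -> `|u - x| <= 1 / 32].
  move: uJ; rewrite ler_norml => /andP[u1 u2].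
  have [u0|u0] := leP u 0.
    exists u; split; [lra|lra|move=> x /andP[x1 x2]]; rewrite ler_norml; apply/andP; split; lra.
  exists (u - 1 / 32); split; [lra|lra|move=> x /andP[x1 x2]]; rewrite ler_norml; apply/andP; split; lra.
rewrite -lee_fin F.
apply: (@le_trans _ _ (\int[leb]_(t in `[a, (a + 1 / 32)%R[) (transfer1 n t)%:E)%E); last first.
  apply: ge0_subset_integral => //.
  - by apply: measurable_funTS; apply/measurable_EFinP; exact: measurable_transfer1.
  - by move=> x _; rewrite lee_fin transfer1_ge0.
  - by move=> x /=; rewrite !in_itv/= => /andP[x1 x2]; apply/andP; split; lra.
have L : leb `[a, a + 1 / 32[ = (1 / 32)%:E.
  rewrite lebesgue_measure_itv/= lte_fin ifT; last by lra.
  by rewrite -EFinD; congr EFin; lra.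
have -> : (transfer_sup n / 128)%:E = ((transfer_sup n / 4)%:E * leb `[a, (a + 1 / 32)%R[)%E.
  by rewrite L -EFinM; congr EFin; field.
rewrite -integral_cst//; apply: ge0_le_integral => //.
- by move=> x _; rewrite lee_fin divr_ge0// ltW.
- by apply: measurable_funTS; apply/measurable_EFinP; exact: measurable_transfer1.
move=> x /=; rewrite in_itv/= => /andP[x1 x2]; rewrite lee_fin.
have xJ : `|x| <= 1 / 2 by rewrite ler_norml; apply/andP; split; lra.
(* Within 1/32 of [u] the value loses at most 8/32 = 1/4 of the supremum from at least 1/2 of it.
   The remaining quarter times the length 1/32 is the 1/128 of the statement. *)
have := transfer1_lipschitz n uJ xJ.
have : 8 * transfer_sup n * `|u - x| <= 8 * transfer_sup n * (1 / 32).
  by rewrite ler_wpM2l ?mulr_ge0 ?(ltW M0)// Ha// x1 ltW.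
move=> h1 h2; have := le_trans (ler_norm _) (le_trans h2 h1).
move: M0 Hu; clear; lra.
Qed.

(* By Fekete's lemma this infimum is also the limit of the roots. *)
Definition growth_rate : R := inf (range (fun n : nat => (transfer_sup n.+1 : R) `^ (n.+1%:R^-1))).

Let has_inf_rate : has_inf (range (fun n : nat => (transfer_sup n.+1 : R) `^ (n.+1%:R^-1))).
Proof.
split; first by exists ((transfer_sup 1 : R) `^ (1%:R^-1)), 0%N.
by exists 0 => _ [n _ <-]; exact: powR_ge0.
Qed.

Let root_pow (x : R) (n : nat) : 0 <= x -> (x `^ (n.+1%:R^-1)) ^+ n.+1 = x.
Proof.
move=> x0; rewrite -powR_mulrn ?powR_ge0// -powRrM mulVf ?pnatr_eq0//.
by rewrite powRr1.
Qed.

Lemma growth_rate_ge : 1 / 2 <= growth_rate.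
Proof.
apply: lb_le_inf; first by case: has_inf_rate.
move=> _ [n _ <-]; have M0 := ltW (transfer_sup_gt0 n.+1 (R := R)).
rewrite -(@ler_pXn2r _ n.+1) ?nnegrE ?powR_ge0//.
by rewrite root_pow// transfer_sup_ge.
Qed.

Lemma growth_rate_gt0 : 0 < growth_rate.
Proof. by apply: lt_le_trans growth_rate_ge. Qed.

Lemma growth_rate_expn_le n : growth_rate ^+ n <= transfer_sup n.
Proof.
case: n => [|n]; first exact: (transfer_sup_ge 0).
have M0 := ltW (transfer_sup_gt0 n.+1 (R := R)).
rewrite -[leRHS](root_pow n M0) lerXn2r ?nnegrE ?powR_ge0 ?(ltW growth_rate_gt0)//.
by apply: ge_inf; [case: has_inf_rate|exists n].
Qed.

(** By definition of the infimum some root lies below [b]. Submultiplicativity extends the bound to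
    the multiples of that index, and the remainder of the division costs a constant. *)
Lemma transfer_sup_expn_le (b : R) : growth_rate < b ->
  exists2 K : R, 0 < K & forall n, transfer_sup n <= K * b ^+ n.
Proof.
move=> cb; have b0 : 0 < b by exact: lt_trans growth_rate_gt0 cb.
have bc : 0 < b - growth_rate by rewrite subr_gt0.
have [_ [k _ <-]] := inf_adherent bc has_inf_rate.
rewrite -/growth_rate addrC subrK => Mk.
have M0 n := transfer_sup_gt0 n (R := R).
have {}Mk : transfer_sup k.+1 <= b ^+ k.+1.
  by rewrite -(root_pow k (ltW (M0 k.+1))) lerXn2r ?nnegrE ?powR_ge0 ?(ltW b0)// ltW.
have Mq q : transfer_sup (q * k.+1) <= b ^+ (q * k.+1).
  elim: q => [|q IH]; first by rewrite mul0n transfer_sup_le1.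
  rewrite mulSn exprD; apply: le_trans (transfer_supD _ _) _.
  by apply: ler_pM => //; exact: ltW.
(* The remainder contributes a factor at most 1 on the left, whereas the matching power of [b] on
   the right may be small when [b < 1]; it is still at least [m ^+ k.+1]. *)
pose m := Num.min b 1; have m0 : 0 < m by rewrite lt_min b0 ltr01.
exists (m ^- k.+1); first by rewrite invr_gt0 exprn_gt0.
move=> n; rewrite {1 2}(divn_eq n k.+1); apply: le_trans (transfer_supD _ _) _.
rewrite exprD mulrCA; apply: ler_pM (Mq _) _; try exact: ltW.
apply: le_trans (transfer_sup_le1 _) _.
rewrite mulrC ler_pdivlMr ?exprn_gt0// mul1r.
apply: (@le_trans _ _ (m ^+ (n %% k.+1))).
  by apply: ler_wiXn2l; rewrite ?(ltW m0) ?ge_min ?lexx ?orbT// ltnW// ltn_mod.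
by apply: lerXn2r; rewrite ?nnegrE ?(ltW m0) ?(ltW b0)// ge_min lexx.
Qed.

Lemma riesz_integral_ge_expn n : growth_rate ^+ n / 128 <= riesz_integral n.
Proof.
by apply: le_trans (riesz_integral_ge n); rewrite ler_pM2r ?invr_gt0// growth_rate_expn_le.
Qed.

Let cvg_root (K : R) : 0 < K -> K `^ (n%:R^-1) @[n --> \oo] --> (1 : R).
Proof.
move=> K0; have -> : (fun n : nat => K `^ (n%:R^-1)) = (fun n : nat => expR (n%:R^-1 * ln K)).
  by apply/funext => n; rewrite /powR gt_eqF.
rewrite -[X in _ --> X]expR0 -(mul0r (ln K)).
apply: (@cvg_comp _ _ _ (fun n : nat => n%:R^-1 * ln K) expR _ (nbhs (0 * ln K))); last exact: continuous_expR.
apply: cvgM; last exact: cvg_cst.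
rewrite -(@cvg_shiftS R); exact: cvg_harmonic.
Qed.

(** Squeeze: the roots of the lower bound tend to the growth rate and those of the upper bound to
    [growth_rate + e / 2], since the roots of a positive constant tend to 1. *)
Lemma cvg_riesz_integral_root :
  riesz_integral n `^ (n%:R^-1) @[n --> \oo] --> growth_rate.
Proof.
have c0 := growth_rate_gt0.
have root_expn (x : R) n : 0 <= x -> (x ^+ n.+1) `^ (n.+1%:R^-1) = x.
  by move=> x0; rewrite -powR_mulrn// -powRrM mulfV ?pnatr_eq0// powRr1.
have I0 n : 0 < riesz_integral n.
  by apply: lt_le_trans (riesz_integral_ge_expn n); rewrite divr_gt0 ?exprn_gt0.
apply/cvgrPdist_lt => e e0.
have cb : growth_rate < growth_rate + e / 2 by rewrite ltrDl divr_gt0.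
have [K K0 HK] := transfer_sup_expn_le cb.
have b0 : 0 < growth_rate + e / 2 by exact: lt_trans cb.
have lim1 : (128^-1 : R) `^ (n%:R^-1) * growth_rate @[n --> \oo] --> growth_rate.
  rewrite -[X in _ --> X]mul1r; apply: cvgM; last exact: cvg_cst.
  by apply: cvg_root; rewrite invr_gt0.
have lim2 : K `^ (n%:R^-1) * (growth_rate + e / 2) @[n --> \oo] --> growth_rate + e / 2.
  rewrite -[X in _ --> X]mul1r; apply: cvgM; last exact: cvg_cst.
  exact: cvg_root.
move/cvgrPdist_lt/(_ _ e0) in lim1.
have e2 : 0 < e / 2 by rewrite divr_gt0.
move/cvgrPdist_lt/(_ _ e2) in lim2.
near=> n.
have n0 : (0 < n)%N by near: n; exists 1%N.
have H1 : `|growth_rate - 128^-1 `^ (n%:R^-1) * growth_rate| < e by near: n.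
have H2 : `|growth_rate + e / 2 - K `^ (n%:R^-1) * (growth_rate + e / 2)| < e / 2 by near: n.
have n1 : (0 : R) <= n%:R^-1 by rewrite invr_ge0.
have L1 : 128^-1 `^ (n%:R^-1) * growth_rate <= riesz_integral n `^ (n%:R^-1).
  rewrite -{1}(root_expn growth_rate n.-1 (ltW c0)) prednK// -powRM ?exprn_ge0 ?(ltW c0)//.
  apply: ge0_ler_powR => //; rewrite ?nnegrE ?mulr_ge0 ?exprn_ge0 ?(ltW c0) ?(ltW (I0 n))//.
  by rewrite mulrC riesz_integral_ge_expn.
have L2 : riesz_integral n `^ (n%:R^-1) <= K `^ (n%:R^-1) * (growth_rate + e / 2).
  rewrite -[in leRHS](root_expn (growth_rate + e / 2) n.-1 (ltW b0)) prednK// -powRM ?exprn_ge0 ?(ltW b0) ?(ltW K0)//.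
  apply: ge0_ler_powR => //; rewrite ?nnegrE ?mulr_ge0 ?exprn_ge0 ?(ltW b0) ?(ltW K0) ?(ltW (I0 n))//.
  exact: le_trans (riesz_integral_le n) (HK n).
move: H1 H2; rewrite !ltr_norml => /andP[h1 h2] /andP[h3 h4]; apply/andP; split; lra.
Unshelve. all: by end_near.
Qed.

Lemma c1E : c1 R = growth_rate.
Proof. by apply: cvg_lim => //; exact: cvg_riesz_integral_root. Qed.
End growth_rate.

(** * Numerical bounds for the growth rate *)

Section numerics.
Context {R : realType}.

Let cos_le_cos (x y : R) : 0 <= x -> x <= y -> y <= pi -> cos y <= cos x.
Proof.
move=> x0 xy yp; rewrite leNgt; apply/negP; rewrite ltr_cos ?in_itv/= ?x0 ?(le_trans x0)//; last first.
  exact: le_trans yp.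
by rewrite ltNge xy.
Qed.

(** The number cos (pi/9) is the root [k >= 1/2] of 4 k^3 - 3 k = 1/2, by the triple angle formula.
    The difference quotient of this cubic is positive here, so the sign of the cubic minus 1/2 at a
    rational [b] tells on which side of [k] it lies. *)
Let incr (b k : R) : 9 / 10 <= b -> 1 / 2 <= k -> 0 < 4 * (b ^+ 2 + b * k + k ^+ 2) - 3.
Proof.
move=> hb hk; have b0 : 0 <= b by lra.
have k0 : 0 <= k by lra.
have h1 : 0 <= b * k by rewrite mulr_ge0.
have h2 := ler_wpM2r b0 hb; have h3 := ler_wpM2r k0 hk.
by rewrite !expr2; lra.
Qed.

Let diff (b k : R) : 4 * k ^+ 3 - 3 * k = 1 / 2 ->
  (b - k) * (4 * (b ^+ 2 + b * k + k ^+ 2) - 3) = 4 * b ^+ 3 - 3 * b - 1 / 2.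
Proof. by move=> <-; ring. Qed.

Let cubic_ge (b k : R) : 9 / 10 <= b -> 1 / 2 <= k -> 4 * k ^+ 3 - 3 * k = 1 / 2 ->
  4 * b ^+ 3 - 3 * b - 1 / 2 <= 0 -> b <= k.
Proof.
by move=> hb hk /(diff b) <-; rewrite pmulr_lle0 ?subr_le0//; exact: incr.
Qed.

Let cubic_le (b k : R) : 9 / 10 <= b -> 1 / 2 <= k -> 4 * k ^+ 3 - 3 * k = 1 / 2 ->
  0 <= 4 * b ^+ 3 - 3 * b - 1 / 2 -> k <= b.
Proof.
by move=> hb hk /(diff b) <-; rewrite pmulr_lge0 ?subr_ge0//; exact: incr.
Qed.

Let kappa_lower : 296 / 315 <= cos (pi / 9) :> R.
Proof.
apply: cubic_ge; first by lra.
- by rewrite -cos_pi3; have := @pi_gt0 R => p0; apply: cos_le_cos; lra.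
- by rewrite -cos_triple -cos_pi3; congr cos; field.
- lra.
Qed.

Let kappa_upper : cos (pi / 9) <= 187 / 199 :> R.
Proof.
apply: cubic_le; first by lra.
- by rewrite -cos_pi3; have := @pi_gt0 R => p0; apply: cos_le_cos; lra.
- by rewrite -cos_triple -cos_pi3; congr cos; field.
- lra.
Qed.

Let sqrt_lower (c k : R) : 0 < c -> 2 * c ^+ 2 - 1 = k -> 296 / 315 <= k -> 64 / 65 <= c.
Proof.
move=> c0 E hk; rewrite leNgt; apply/negP => lt.
have h1 : c * c <= c * (64 / 65) by rewrite ler_wpM2l// ltW.
by move: E; rewrite expr2; lra.
Qed.

(** Half-angle formula applied to the bound for cos (pi/9). As pi u/9 stays within pi/18 of 0, this
    is what confines [z] to [0, 1/65] below. *)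
Let cos_pi18 : 64 / 65 <= cos (pi / 18) :> R.
Proof.
have p0 := @pi_gt0 R.
apply: sqrt_lower kappa_lower.
  by apply: cos_gt0_pihalf; apply/andP; split; lra.
rewrite (_ : pi / 9 = (pi / 18) *+ 2 :> R); first by rewrite cos_mulr2n mulr_natl.
by rewrite mulr2n; field.
Qed.

(* Close to the leading eigenfunction of [transfer]: the quotient
   [transfer trial / trial] stays in [81/125, 24/37], and this interval lies in
   [3^0.236 / 2, 3^0.237 / 2[. *)
Definition trial (u : R) : R := 1 + 10 * cos (pi * u / 3).

(** With phi = pi u/9, the branches of [transfer] take the weight at 3 phi and 3 phi +- pi/3, and
    the cosine of [trial] at phi and phi +- pi/9. The addition formulas cancel the terms odd in phi
    and leave a polynomial in [y] and cos (pi/9). *)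
Let transfer_trialE (u : R) : `|u| <= 1 / 2 -> exists y z : R,
  [/\ y = cos (pi * u / 9), z = 1 - y, 0 <= z <= 1 / 65,
     trial u = 1 + 10 * (4 * y ^+ 3 - 3 * y) &
     transfer trial u = 2 / 3 * (4 * y ^+ 3 - 3 * y) + 10 / 3 *
       ((4 * y ^+ 3 - 3 * y) * y * (1 + cos (pi / 9)) +
        2 * ((4 * y ^+ 2 - 1) * (1 - y ^+ 2)) * (2 * cos (pi / 9) ^+ 2 - 1 - cos (pi / 9) / 2))].
Proof.
move=> uJ; have p0 := @pi_gt0 R.
have /andP[u1 u2] : - (1 / 2) <= u <= 1 / 2 by rewrite -ler_norml.
pose phi := pi * u / 9.
have pu1 : - (pi / 2) <= pi * u by rewrite -mulrN -[2^-1]div1r ler_pM2l.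
have pu2 : pi * u <= pi / 2 by rewrite -[2^-1]div1r ler_pM2l.
have c3E : cos (pi * u / 3) = 4 * cos phi ^+ 3 - 3 * cos phi.
  by rewrite -cos_triple; congr cos; rewrite /phi; field.
exists (cos phi), (1 - cos phi); split => //.
- have : cos (pi / 18) <= cos phi.
    rewrite -[cos phi]cos_norm; apply: cos_le_cos => //; last by lra.
    rewrite ler_norml /phi; apply/andP; split; lra.
  by have := cos_le1 phi; have := cos_pi18; lra.
- by rewrite /trial c3E.
rewrite /transfer.
have W (x t b : R) : pi * x = t -> - (pi / 2) <= t <= pi / 2 -> pi * x / 3 = b ->
    `|cos (pi * x)| * trial x = cos t * (1 + 10 * cos b).
  move=> E1 E2 E3; rewrite /trial E3 E1 ger0_norm// cos_ge0_pihalf//.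
rewrite (W _ (3 * phi - pi / 3) (phi - pi / 9)); last 3 first.
- by rewrite /phi; field.
- by rewrite /phi; apply/andP; split; lra.
- by rewrite /phi; field.
rewrite (W _ (3 * phi) phi); last 3 first.
- by rewrite /phi; field.
- by rewrite /phi; apply/andP; split; lra.
- by rewrite /phi; field.
rewrite (W _ (3 * phi + pi / 3) (phi + pi / 9)); last 3 first.
- by rewrite /phi; field.
- by rewrite /phi; apply/andP; split; lra.
- by rewrite /phi; field.
rewrite [cos (3 * phi - _)]cosB [cos (3 * phi + _)]cosD [cos (phi - _)]cosB [cos (phi + _)]cosD cos_pi3.
(* The angle pi/3 - pi/9 is twice pi/9: the difference formula and the double angle formula together
   express the product of sines by cos (pi/9). *)
have SS : sin (pi / 3 : R) * sin (pi / 9) = 2 * cos (pi / 9) ^+ 2 - 1 - cos (pi / 9) / 2.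
  have : cos (pi / 3 - pi / 9 : R) = 2 * cos (pi / 9) ^+ 2 - 1.
    rewrite (_ : pi / 3 - pi / 9 = (pi / 9) *+ 2 :> R) ?cos_mulr2n ?mulr_natl//.
    by rewrite mulr2n; field.
  by rewrite cosB cos_pi3 => <-; field.
have S3 : sin (3 * phi) * sin phi = (4 * cos phi ^+ 2 - 1) * (1 - cos phi ^+ 2).
  have -> : 3 * phi = phi *+ 2 + phi by rewrite mulr2n; ring.
  rewrite sinD cos_mulr2n sin_mulr2n -sin2cos2; generalize (sin phi) (cos phi) => s c.
  by rewrite !mulr2n; ring.
rewrite -S3 -SS -cos_triple.
by field.
Qed.

Lemma trial_bounds (u : R) : `|u| <= 1 / 2 -> 1 <= trial u <= 11.
Proof.
move=> uJ; have p0 := @pi_gt0 R.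
have /andP[u1 u2] : - (1 / 2) <= u <= 1 / 2 by rewrite -ler_norml.
have pu1 : - (pi / 2) <= pi * u by rewrite -mulrN -[2^-1]div1r ler_pM2l.
have pu2 : pi * u <= pi / 2 by rewrite -[2^-1]div1r ler_pM2l.
have : 0 <= cos (pi * u / 3) by apply: cos_ge0_pihalf; apply/andP; split; lra.
by have := cos_le1 (pi * u / 3); rewrite /trial; lra.
Qed.

Let poly_facts (z : R) : 0 <= z <= 1 / 65 ->
  [/\ 0 <= z ^+ 2, z ^+ 2 <= 1 / 65 * z, 0 <= z ^+ 3, z ^+ 3 <= 1 / 65 * z ^+ 2 &
      0 <= z ^+ 4 /\ z ^+ 4 <= 1 / 65 * z ^+ 3].
Proof.
move=> /andP[z0 z1].
have H n : z ^+ n.+1 <= 1 / 65 * z ^+ n by rewrite exprS ler_wpM2r// exprn_ge0.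
by split; rewrite ?exprn_ge0//; exact: (H 1%N).
Qed.

(** The powers of [z] become separate variables tied by linear relations, so that the polynomial
    inequalities below fall to linear arithmetic. The lower bound for [z2] is the tangent of the
    square at 1/115. *)
Let poly_expand (y z : R) : z = 1 - y -> 0 <= z <= 1 / 65 ->
  exists z2 z3 z4 : R, [/\ 2 / 115 * z - 1 / 115 * (1 / 115) <= z2 <= 1 / 65 * z,
    0 <= z3 <= 1 / 65 * z2 /\ 0 <= z4 <= 1 / 65 * z3,
    4 * y ^+ 3 - 3 * y = 1 - 9 * z + 12 * z2 - 4 * z3,
    (4 * y ^+ 3 - 3 * y) * y = 1 - 10 * z + 21 * z2 - 16 * z3 + 4 * z4 &
    2 * ((4 * y ^+ 2 - 1) * (1 - y ^+ 2)) = 12 * z - 38 * z2 + 32 * z3 - 8 * z4].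
Proof.
move=> zE z01; have [_ h2 h3 h3' [h4 h4']] := poly_facts z01.
have yE : y = 1 - z by rewrite zE; ring.
exists (z ^+ 2), (z ^+ 3), (z ^+ 4); split; rewrite ?h2 ?h3 ?h4 ?andbT//; last 3 first.
- by rewrite yE; ring.
- by rewrite yE; ring.
- by rewrite yE; ring.
have := sqr_ge0 (z - 1 / 115); rewrite (_ : (z - 1 / 115) ^+ 2 = z ^+ 2 - 2 / 115 * z + 1 / 115 * (1 / 115)); last by field.
by move: h2; move: (z ^+ 2) => w; lra.
Qed.

(** [A] and [Q] are nonnegative, so [k] and [m] may be replaced by their rational bounds; the rest
    is linear in the powers of [z]. *)
Let trial_ratio_ge (c A Q k m z z2 z3 z4 : R) :
  296 / 315 <= k -> 37 / 125 <= m -> 0 <= z <= 1 / 65 ->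
  2 / 115 * z - 1 / 115 * (1 / 115) <= z2 <= 1 / 65 * z -> 0 <= z3 <= 1 / 65 * z2 -> 0 <= z4 <= 1 / 65 * z3 ->
  c = 1 - 9 * z + 12 * z2 - 4 * z3 -> A = 1 - 10 * z + 21 * z2 - 16 * z3 + 4 * z4 ->
  Q = 12 * z - 38 * z2 + 32 * z3 - 8 * z4 ->
  81 / 125 * (1 + 10 * c) <= 2 / 3 * c + 10 / 3 * (A * (1 + k) + Q * m).
Proof.
move=> hk hm /andP[z0 z1] /andP[a1 a2] /andP[a3 a4] /andP[a5 a6] cE AE QE.
have A0 : 0 <= A by lra.
have Q0 : 0 <= Q by lra.
have h1 : A * (1 + 296 / 315) <= A * (1 + k) by rewrite ler_wpM2l// lerD2l.
have h2 := ler_wpM2l Q0 hm.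
have : 81 / 125 * (1 + 10 * c) <= 2 / 3 * c + 10 / 3 * (A * (1 + 296 / 315) + Q * (37 / 125)) by lra.
by move: h1 h2; move: (A * (1 + k)) (Q * m) => X Y; lra.
Qed.

Let trial_ratio_le (c A Q k m z z2 z3 z4 : R) :
  k <= 187 / 199 -> m <= 8 / 27 -> 0 <= z <= 1 / 65 ->
  2 / 115 * z - 1 / 115 * (1 / 115) <= z2 <= 1 / 65 * z -> 0 <= z3 <= 1 / 65 * z2 -> 0 <= z4 <= 1 / 65 * z3 ->
  c = 1 - 9 * z + 12 * z2 - 4 * z3 -> A = 1 - 10 * z + 21 * z2 - 16 * z3 + 4 * z4 ->
  Q = 12 * z - 38 * z2 + 32 * z3 - 8 * z4 ->
  2 / 3 * c + 10 / 3 * (A * (1 + k) + Q * m) <= 24 / 37 * (1 + 10 * c).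
Proof.
move=> hk hm /andP[z0 z1] /andP[a1 a2] /andP[a3 a4] /andP[a5 a6] cE AE QE.
have A0 : 0 <= A by lra.
have Q0 : 0 <= Q by lra.
have h1 : A * (1 + k) <= A * (1 + 187 / 199) by rewrite ler_wpM2l// lerD2l.
have h2 := ler_wpM2l Q0 hm.
have : 2 / 3 * c + 10 / 3 * (A * (1 + 187 / 199) + Q * (8 / 27)) <= 24 / 37 * (1 + 10 * c) by lra.
by move: h1 h2; move: (A * (1 + k)) (Q * m) => X Y; lra.
Qed.

(** At k = cos (pi/9) the expression is sin(pi/3) sin(pi/9), about 0.2962, which 37/125 and 8/27
    enclose. *)
Let mixed_ge (k : R) : 296 / 315 <= k -> 37 / 125 <= 2 * k ^+ 2 - 1 - k / 2.
Proof.
move=> k1; have k0 : 0 <= k by lra.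
by have := ler_wpM2r k0 k1; rewrite expr2; lra.
Qed.

Let mixed_le (k : R) : 0 <= k -> k <= 187 / 199 -> 2 * k ^+ 2 - 1 - k / 2 <= 8 / 27.
Proof. by move=> k0 k1; have := ler_wpM2r k0 k1; rewrite expr2; lra. Qed.

Let mixed_ge0 : (0 : R) <= 296 / 315. Proof. lra. Qed.

Lemma transfer_trial_bounds (u : R) : `|u| <= 1 / 2 ->
  81 / 125 * trial u <= transfer trial u <= 24 / 37 * trial u.
Proof.
move=> /transfer_trialE[y [z [_ zE z01 -> ->]]].
have k1 := kappa_lower; have k2 := kappa_upper; move: k1 k2; generalize (cos (pi / 9) : R) => k k1 k2.
have m1 := mixed_ge k1; have m2 := mixed_le (le_trans (mixed_ge0) k1) k2.
have [z2 [z3 [z4 [h2 [h3 h4] cE AE QE]]]] := poly_expand zE z01.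
apply/andP; split.
- exact: trial_ratio_ge k1 m1 z01 h2 h3 h4 cE AE QE.
- exact: trial_ratio_le k2 m2 z01 h2 h3 h4 cE AE QE.
Qed.

(** As [trial] lies between 1 and 11, the constant 1 lies between trial/11 and [trial], and
    positivity of [transfer] preserves both comparisons at every step. *)
Lemma transfer1_trial_bounds n (u : R) : `|u| <= 1 / 2 ->
  (81 / 125) ^+ n * trial u <= 11 * transfer1 n u <= 11 * ((24 / 37) ^+ n * trial u).
Proof.
elim: n u => [|n IH] u uJ.
  by have := trial_bounds uJ; rewrite !expr0 mul1r mulr1 => /andP[h1 h2]; rewrite h2 ler_peMr.
have h3 (c : R) v : transfer (fun x => c * trial x) v = c * transfer trial v by exact: transferZ.
have := transfer_trial_bounds uJ => /andP[b1 b2]; apply/andP; split.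
- rewrite transfer1S -transferZ; apply: (@le_trans _ _ (transfer (fun x => (81 / 125) ^+ n * trial x) u)).
    by rewrite h3 exprSr -mulrA ler_wpM2l// exprn_ge0// divr_ge0.
  by apply: transfer_le => // v /IH/andP[].
- rewrite transfer1S ler_pM2l//; apply: (@le_trans _ _ (transfer (fun x => (24 / 37) ^+ n * trial x) u)).
    by apply: transfer_le => // v /IH/andP[_]; rewrite ler_pM2l.
  by rewrite h3 exprSr -mulrA ler_wpM2l// exprn_ge0// divr_ge0.
Qed.

(** By Bernoulli's inequality the powers of a/b would otherwise exceed any [K]. *)
Let expn_dominated (a b K : R) : 0 < a -> 0 < b -> (forall n, a ^+ n <= K * b ^+ n) -> a <= b.
Proof.
move=> a0 b0 H; rewrite leNgt; apply/negP => ba.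
have q1 : 1 < a / b by rewrite ltr_pdivlMr// mul1r.
have e0 : 0 < a / b - 1 by rewrite subr_gt0.
have [n Hn] : exists n : nat, K < (a / b) ^+ n.
  have K0 : 0 <= `|K| / (a / b - 1) by rewrite divr_ge0// ltW.
  exists (Num.bound (`|K| / (a / b - 1))); have := archi_boundP K0.
  set n := Num.bound _; rewrite ltr_pdivrMr// => Kn.
  apply: le_lt_trans (ler_norm K) _; apply: lt_le_trans Kn _.
  have -> : a / b = 1 + (a / b - 1) by ring.
  move: e0; set e := a / b - 1 => e0; clearbody e n; clear -e0.
  have -> : 1 + e - 1 = e by ring.
  elim: n => [|n IH]; first by rewrite mul0r.
  have E1 : 1 <= (1 + e) ^+ n by rewrite exprn_ege1// lerDl ltW.
  rewrite exprSr mulrDr mulr1 -natr1 mulrDl mul1r lerD//.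
  by rewrite ler_peMl// ltW.
have := H n; rewrite leNgt => /negP; apply.
by move: Hn; rewrite exprMn exprVn ltr_pdivlMr// exprn_gt0.
Qed.

Lemma growth_rate_bounds : 81 / 125 <= (growth_rate : R) <= 24 / 37.
Proof.
have c0 := @growth_rate_gt0 R.
apply/andP; split.
(* The suprema are bounded by powers only for bases above the growth rate, hence the arbitrary
   [e]. *)
- apply/ler_addgt0Pr => e e0; have cb : growth_rate < growth_rate + e by rewrite ltrDl.
  have [K K0 HK] := transfer_sup_expn_le cb.
  apply: (@expn_dominated _ _ (11 * K)); rewrite ?divr_gt0 ?addr_gt0// => n.
  have J0 : `|0 : R| <= 1 / 2 by rewrite normr0.
  have /andP[h _] := transfer1_trial_bounds n J0.
  have /andP[t1 _] := trial_bounds J0.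
  rewrite -mulrA; apply: (@le_trans _ _ (11 * transfer1 n 0)).
    by apply: le_trans h; rewrite ler_peMr// exprn_ge0// divr_ge0.
  by rewrite ler_pM2l//; apply: le_trans (HK n); exact: transfer1_le_sup.
- apply: (@expn_dominated _ _ 11) => // n.
  apply: le_trans (growth_rate_expn_le n) _; apply: transfer_sup_le => u uJ.
  have /andP[_ h] := transfer1_trial_bounds n uJ; move: h; rewrite ler_pM2l// => h.
  apply: le_trans h _; rewrite mulrC ler_wpM2r ?exprn_ge0 ?divr_ge0//.
  by have /andP[] := trial_bounds uJ.
Qed.
End numerics.

Section threshold.
Context {R : realType}.

Lemma ln_ge_of_expn (x y : R) (p q : nat) : 0 < x -> 0 < y -> y ^+ p <= x ^+ q ->
  p%:R * ln y <= q%:R * ln x.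
Proof.
move=> x0 y0 H; rewrite !mulr_natl -!lnXn// ler_ln ?posrE ?exprn_gt0//.
Qed.

(* 59/250 = 0.236, and 41/173 is a fraction slightly below 0.237. *)
Lemma threshold_bounds :
  236 / 1000 <= ln (2 : R) / ln 3 + ln (growth_rate : R) / ln 3 < 237 / 1000.
Proof.
have /andP[c1 c2] := @growth_rate_bounds R; have c0 := @growth_rate_gt0 R.
have l3 : 0 < ln (3 : R) by rewrite ln_gt0// ltr1n.
rewrite -mulrDl -lnM ?posrE//; apply/andP; split.
- rewrite ler_pdivlMr//.
  have h : (59%:R : R) * ln 3 <= 250%:R * ln (2 * growth_rate).
    apply: ln_ge_of_expn => //; first by rewrite mulr_gt0.
    (* 162/125 is twice 81/125; what remains is the numerical inequality 3^59 <= (162/125)^250. *)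
    apply: (@le_trans _ _ ((162 / 125) ^+ 250)); last first.
      by apply: lerXn2r; rewrite ?nnegrE ?mulr_ge0 ?(ltW c0)//; lra.
    lra.
  lra.
- rewrite ltr_pdivrMr//.
  have h : (173%:R : R) * ln (2 * growth_rate) <= 41%:R * ln 3.
    apply: ln_ge_of_expn => //; first by rewrite mulr_gt0.
    (* 48/37 is twice 24/37; what remains is (48/37)^173 <= 3^41. *)
    apply: (@le_trans _ _ ((48 / 37) ^+ 173)).
      by apply: lerXn2r; rewrite ?nnegrE ?mulr_ge0 ?(ltW c0)//; lra.
    lra.
  lra.
Qed.
End threshold.

(** * The Fourier transform of the Cantor measure *)

Section cantor_fourier.
Context {R : realType}.
Notation leb := (@lebesgue_measure R).

Lemma measurable_cantor_set : measurable (cantor_set : set (measurableTypeR R)).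
Proof.
apply: bigcapT_measurable => n.
rewrite /cantor_stage; elim: (cantor_intervals n) => [|J s IH].
  rewrite (_ : [set x | _] = set0)//.
  by apply/seteqP; split => x //= [I]; rewrite in_nil.
rewrite (_ : [set x | _] = `[J.1, J.2]%classic `|`
   [set x | exists2 I, I \in s & x \in `[I.1, I.2]]); first exact: measurableU.
apply/seteqP; split => x /=.
  by move=> [I]; rewrite inE => /orP[/eqP->|Is] xI; [left|right; exists I].
by move=> [xJ|[I Is xI]]; [exists J => //; rewrite inE eqxx|exists I => //; rewrite inE Is orbT].
Qed.

Lemma cantor_set_sub : cantor_set `<=` `[- (1 / 2), (1 / 2 : R)]%classic.
Proof.
move=> x /(_ 0%N I) [J]; rewrite inE => /eqP -> /=; rewrite !in_itv/=.
by rewrite !div1r.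
Qed.

Variable mu : probability (measurableTypeR R) R.
Hypothesis hmu : cantor_measure mu.

Lemma cantor_ae : {ae mu, forall x : measurableTypeR R, `|x : R| <= 1 / 2}.
Proof.
have [h _] := hmu.
exists (~` (cantor_set : set (measurableTypeR R))); split.
- by apply: measurableC; exact: measurable_cantor_set.
- by rewrite probability_setC ?h ?subee//; exact: measurable_cantor_set.
- by move=> x /= H1 H2; apply: H1; have := cantor_set_sub H2; rewrite /= in_itv/= ler_norml.
Qed.

Let T (e : R) : measurableTypeR R -> measurableTypeR R := fun x => (x + e) / 3.

Let mT e : measurable_fun setT (T e).
Proof. by apply: measurable_funM => //; exact: measurable_funD. Qed.

(** Self-similarity is an equality of measures: [mu] is the average of its images under the two
    contractions. *)
Lemma ge0_integral_cantor (f : measurableTypeR R -> \bar R) :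
  measurable_fun setT f -> (forall x, 0 <= f x)%E ->
  (\int[mu]_x f x = (2^-1)%:E * \int[mu]_x f ((x - 1) / 3)%R +
     (2^-1)%:E * \int[mu]_x f ((x + 1) / 3)%R)%E.
Proof.
move=> mf f0; have [_ h] := hmu.
have half0 : 0 <= 2^-1 :> R by [].
pose m1 : {measure set (measurableTypeR R) -> \bar R} :=
  mscale (NngNum half0) (pushforward mu (T (-1))).
pose m2 : {measure set (measurableTypeR R) -> \bar R} :=
  mscale (NngNum half0) (pushforward mu (T 1)).
rewrite (@eq_measure_integral _ _ _ _ (measure_add (m1 (mT (-1))) (m2 (mT 1)))); last first.
  move=> A mA _; apply: eq_trans (h A mA) _; exact: esym (measure_addE (m1 (mT (-1))) (m2 (mT 1)) A).
rewrite ge0_integral_measure_add// !ge0_integral_mscale//=.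
rewrite !ge0_integral_pushforward//.
Qed.

Let mcis (x : R) : cmeasurable (fun eta : measurableTypeR R => cis (pi * x * eta)).
Proof. by apply: cmeasurable_cis; exact: measurable_mulr3. Qed.

Let icst (c : R) : mu.-integrable setT (EFin \o (fun=> c)).
Proof. exact: finite_measure_integrable_cst. Qed.

Let int_cst (c : R) : (\int[mu]_x c%:E = c%:E)%E.
Proof.
by rewrite integral_cst// -[RHS]mule1; congr (_ * _)%E; exact: probability_setT.
Qed.

Lemma cintegrable_cis_mu (x : R) : cintegrable mu (fun eta : measurableTypeR R => cis (pi * x * eta)).
Proof.
by apply: (@cintegrable_le _ _ _ mu _ (fun=> 1) (mcis x) (icst 1)) => y; rewrite normc_cis.
Qed.

Let int_add_cst (B : R) (g : measurableTypeR R -> R) : mu.-integrable setT (EFin \o g) ->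
  (\int[mu]_x (B + g x)%:E = B%:E + (\int[mu]_x g x)%:E)%E.
Proof.
move=> ig; rewrite /Rintegral fineK; last exact: integrable_fin_num ig.
by rewrite -[X in (_ = X + _)%E](int_cst B) -(integralD measurableT (icst B) ig).
Qed.

(** Adding the bound [B] makes the function nonnegative, so that [ge0_integral_cantor] applies; the
    constant cancels because [mu] has mass 1. *)
Let Rintegral_cantor (f : R -> R) (B : R) : measurable_fun setT f -> (forall x, `|f x| <= B) ->
  \int[mu]_x f x = 2^-1 * \int[mu]_x f ((x - 1) / 3) + 2^-1 * \int[mu]_x f ((x + 1) / 3).
Proof.
move=> mf fB.
have ib (g : measurableTypeR R -> R) : measurable_fun setT g -> (forall x, `|g x| <= B) ->
    mu.-integrable setT (EFin \o g).
  move=> mg gB; apply: (le_integrable measurableT _ _ (icst B)); first exact/measurable_EFinP.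
  by move=> x _ /=; rewrite lee_fin (le_trans (gB x))// ler_norm.
have m1 : measurable_fun setT (fun x : R => f ((x - 1) / 3)) := measurableT_comp mf (mT (-1)).
have m2 : measurable_fun setT (fun x : R => f ((x + 1) / 3)) := measurableT_comp mf (mT 1).
have i0 := ib _ mf fB; have i1 := ib _ m1 (fun=> fB _); have i2 := ib _ m2 (fun=> fB _).
have mBf : measurable_fun setT (fun x : measurableTypeR R => (B + f x)%:E).
  by apply/measurable_EFinP; exact: measurable_funD.
have Bf0 (x : measurableTypeR R) : (0 <= (B + f x)%:E)%E.
  by rewrite lee_fin -lerBlDl sub0r; have := fB x; rewrite ler_norml => /andP[].
have := congr1 fine (ge0_integral_cantor mBf Bf0).
by rewrite (int_add_cst B i0) (int_add_cst B i1) (int_add_cst B i2) /=; lra.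
Qed.

Definition mu_hat (x : R) : R[i] := cintegral mu (fun eta : measurableTypeR R => cis (pi * x * eta)).

Lemma mu_hat3 (x : R) : mu_hat (3 * x) = (cos (pi * x))%:C * mu_hat x.
Proof.
have E (P : R[i] -> R) : P = @complex.Re R \/ P = @complex.Im R ->
    \int[mu]_eta P (cis (pi * (3 * x) * eta)) =
    2^-1 * \int[mu]_eta P (cis (- (pi * x)) * cis (pi * x * eta)) +
    2^-1 * \int[mu]_eta P (cis (pi * x) * cis (pi * x * eta)).
  move=> HP; rewrite (@Rintegral_cantor _ 1).
  - congr (_ * _ + _ * _); apply: eq_Rintegral => eta _; rewrite -cisD; congr (P (cis _)); by field.
  - have [c1 c2] := mcis (3 * x); by case: HP => ->.
  - by move=> y; case: HP => -> /=; [exact: cos_max|exact: sin_max].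
have i1 := cintegrable_cis_mu x.
have : mu_hat (3 * x) = (2^-1)%:C * (cis (- (pi * x)) * mu_hat x) + (2^-1)%:C * (cis (pi * x) * mu_hat x).
  rewrite /mu_hat -!(cintegralZ _ i1) {1}/cintegral (E _ (or_introl erefl)) (E _ (or_intror erefl)).
  by rewrite /cintegral; simpc.
move=> ->; rewrite -mulrDr -mulrDl mulrA; congr (_ * _).
by rewrite /cis cosN sinN; simpc; congr (_ +i* _); field.
Qed.

Lemma normc_mu_hat_le (x : R) : normc (mu_hat x) <= 2.
Proof.
rewrite -lee_fin; apply: le_trans (normc_cintegral_le (cintegrable_cis_mu x)) _.
by under eq_integral do rewrite normc_cis; rewrite int_cst -EFinM mulr1.
Qed.

Lemma normc_mu_hatN (x : R) : normc (mu_hat (- x)) = normc (mu_hat x).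
Proof.
have -> : mu_hat (- x) = complex.Re (mu_hat x) +i* - complex.Im (mu_hat x).
  have [_ i2] := cintegrable_cis_mu x.
  rewrite /mu_hat /cintegral /=; congr (_ +i* _).
    by apply: eq_Rintegral => eta _; rewrite mulrN mulNr cosN.
  rewrite -[RHS]mulN1r -(RintegralZl (-1) measurableT i2); apply: eq_Rintegral => eta _.
  by rewrite mulrN mulNr sinN mulN1r.
by rewrite /mu_hat /cintegral /= sqrrN.
Qed.

(** The measure is carried by [-1/2, 1/2], where pi x eta stays within pi/3 of 0 and the cosine is
    at least 1/2. Since this holds only almost everywhere, the cosine is first replaced by its
    maximum with 1/2. *)
Let mu_hat_ge_third (x : R) : 0 <= x <= 1 / 3 -> 1 / 2 <= normc (mu_hat x).
Proof.
move=> /andP[x0 x3]; apply: (@le_trans _ _ (complex.Re (mu_hat x))); last first.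
  by apply: le_trans (ler_norm _) _; exact: normc_Re.
rewrite /mu_hat /=; have [i1 _] := cintegrable_cis_mu x.
rewrite -lee_fin /Rintegral fineK; last exact: integrable_fin_num i1.
have mc : measurable_fun setT (fun eta : measurableTypeR R => cos (pi * x * eta)) by have [] := mcis x.
have mm : measurable_fun setT (fun eta : measurableTypeR R => Num.max (1 / 2) (cos (pi * x * eta))).
  exact: measurable_maxr.
have -> : (\int[mu]_eta (cos (pi * x * eta))%:E = \int[mu]_eta (Num.max (1 / 2) (cos (pi * x * eta)))%:E)%E.
  apply: ae_eq_integral => //; [exact/measurable_EFinP|exact/measurable_EFinP|].
  apply: filterS cantor_ae => eta eta2 _; congr EFin; rewrite max_r// -cos_pi3 -[leRHS]cos_norm.
  have p0 := @pi_gt0 R.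
  have h : `|pi * x * eta| <= pi / 3.
    rewrite !normrM (gtr0_norm p0) (ger0_norm x0) -[leRHS]mulr1 -!mulrA ler_pM2l//.
    apply: (@le_trans _ _ (1 / 3 * (1 / 2))); first exact: ler_pM.
    lra.
  rewrite leNgt; apply/negP; rewrite ltr_cos ?in_itv/= ?normr_ge0/=.
  - by rewrite ltNge h.
  - by apply/andP; split; lra.
  - by apply: le_trans h _; lra.
rewrite -int_cst; apply: ge0_le_integral => //.
- exact/measurable_EFinP.
- by move=> y _; rewrite lee_fin le_max lexx.
Qed.

(** One use of the scaling relation extends the bound from [0, 1/3] to [0, 1], at the cost of the
    factor cos (pi x/3) >= 1/2. This makes integrals of |muhat| over triadic intervals comparable
    with those of Riesz products. *)
Lemma normc_mu_hat_ge (x : R) : 0 <= x <= 1 -> 1 / 4 <= normc (mu_hat x).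
Proof.
move=> /andP[x0 x1]; have p0 := @pi_gt0 R.
have -> : x = 3 * (x / 3) by field.
rewrite mu_hat3 ComplexField.Normc.normcM normc_real.
have -> : 1 / 4 = 1 / 2 * (1 / 2) :> R by field.
apply: ler_pM => //; last by apply: mu_hat_ge_third; apply/andP; split; lra.
apply: le_trans (ler_norm _); rewrite -cos_pi3.
rewrite leNgt; apply/negP; rewrite ltr_cos ?in_itv/=; try by apply/andP; split; nra.
nra.
Qed.

Lemma measurable_normc_mu_hat : measurable_fun setT (fun x : R => normc (mu_hat x)).
Proof.
apply: (@measurable_normc _ (measurableTypeR R) R).
have mE : cmeasurable (fun z : measurableTypeR R * measurableTypeR R => cis (pi * z.1 * z.2)).
  by apply: cmeasurable_cis; apply: measurable_funM => //; apply: measurable_funM.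
have H (P : R[i] -> R) : P = @complex.Re R \/ P = @complex.Im R ->
    measurable_fun setT (fun x : R => \int[mu]_eta P (cis (pi * x * eta))).
  move=> HP.
  (* Adding 1 makes the integrand nonnegative, as the measurability part of Tonelli's theorem
     requires. *)
  have mP : measurable_fun setT (fun z : measurableTypeR R * measurableTypeR R => (1 + P (cis (pi * z.1 * z.2)))%:E).
    by apply/measurable_EFinP; apply: measurable_funD => //; have [] := mE; case: HP => ->.
  have P0 z : (0 <= (1 + P (cis (pi * z.1 * z.2)))%:E)%E.
    rewrite lee_fin -lerBlDl sub0r; case: HP => -> /=; first exact: cos_geN1.
    exact: sin_geN1.
  have := @measurable_fun_fubini_tonelli_F _ _ _ _ _ mu _ mP P0.
  set G := fubini_F _ _ => mG.
  have -> : (fun x : R => \int[mu]_eta P (cis (pi * x * eta))) = (fun x => fine (G x) - 1).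
    apply/funext => x; rewrite /G /fubini_F/= int_add_cst/= 1?addrAC ?subrr ?add0r//.
    by have [j1 j2] := cintegrable_cis_mu x; case: HP => ->.
  apply: measurable_funB => //; exact: measurableT_comp mG.
by split; [exact: H (or_introl _)|exact: H (or_intror _)].
Qed.
End cantor_fourier.

(** * Integrability of functions with the triadic scaling relation *)

Section self_similar_integral.
Context {R : realType}.
Notation leb := (@lebesgue_measure R).
Variable phi : R -> R.
Hypotheses (mphi : measurable_fun setT phi) (phi_ge0 : forall x, 0 <= phi x).
Hypotheses (phi_le : forall x, phi x <= 2) (phi_ge : forall x, 0 <= x <= 1 -> 1 / 4 <= phi x).
Hypothesis phi3 : forall x, phi (3 * x) = `|cos (pi * x)| * phi x.

Let phi_expn n t : phi (3 ^+ n * t) = riesz n t * phi t.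
Proof.
elim: n t => [|n IH] t; first by rewrite expr0 mul1r riesz0 mul1r.
by rewrite exprSr -mulrA IH phi3 rieszS; ring.
Qed.

Let J n := (\int[leb]_(x in `[0%R, (3 ^+ n)%R[) (phi x)%:E)%E.

Let e3 n : (0 : R) < 3 ^+ n. Proof. by rewrite exprn_gt0. Qed.

Let JE n : (J n = (3 ^+ n)%:E * \int[leb]_(t in `[0%R, 1%R]) (riesz n t * phi t)%:E)%E.
Proof.
have mE : measurable_fun setT (fun x => (phi x)%:E) by exact/measurable_EFinP.
have E0 x : (0 <= (phi x)%:E)%E by rewrite lee_fin.
have lt1 x : (3 ^+ n * x < 3 ^+ n :> R) = (x < 1) by rewrite -[ltRHS]mulr1 ltr_pM2l.
rewrite /J (@ge0_integral_affine_set _ (3 ^+ n) 0)// ?gt_eqF// gtr0_norm//; congr (_ * _)%E.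
have -> : (fun x : R => 3 ^+ n * x + 0) @^-1` `[0, 3 ^+ n[ = `[0, 1[%classic.
  apply/seteqP; split => x /=; rewrite !in_itv/= addr0 pmulr_rge0//.
    by rewrite lt1.
  by rewrite lt1.
rewrite integral_itv_bndo_bndc; last first.
  apply: measurable_funTS; apply/measurable_EFinP.
  apply: (@measurableT_comp _ _ _ _ _ _ phi _ (fun x : R => 3 ^+ n * x + 0)) => //.
  exact: measurable_affine.
by apply: eq_integral => t _; rewrite addr0 phi_expn.
Qed.

Let mrphi n : measurable_fun setT (fun t => (riesz n t * phi t)%:E).
Proof. by apply/measurable_EFinP; apply: measurable_funM => //; exact: measurable_riesz. Qed.

Let riesz_fin n : (\int[leb]_(t in `[0%R, 1%R]) (riesz n t)%:E = (riesz_integral n : R)%:E)%E.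
Proof.
rewrite /riesz_integral /Rintegral fineK// ge0_fin_numE; last first.
  by apply: integral_ge0 => t _; rewrite lee_fin riesz_ge0.
apply: (@le_lt_trans _ _ (\int[leb]_(t in `[0%R, 1%R]) (cst 1%:E) t)%E).
  apply: ge0_le_integral => //.
  - by move=> t _; rewrite lee_fin riesz_ge0.
  - by apply: measurable_funTS; apply/measurable_EFinP; exact: measurable_riesz.
  - by move=> t _; rewrite lee_fin riesz_le1.
by rewrite integral_cst//= lebesgue_measure_itv/= lte_fin ltr01 -EFinB -EFinM ltry.
Qed.

(** Here 512 = 4 * 128: the 4 comes from the lower bound of [phi] on [0, 1] and the 128 from
    [riesz_integral_ge_expn]. *)
Lemma self_similar_integral_ge n : (((3 * growth_rate) ^+ n / 512)%:E <= J n)%E.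
Proof.
have mr : measurable_fun setT (fun t : R => (riesz n t)%:E).
  by apply/measurable_EFinP; exact: measurable_riesz.
rewrite JE.
have -> : (3 * growth_rate) ^+ n / 512 = 3 ^+ n * (1 / 4 * (growth_rate ^+ n / 128)) :> R.
  by rewrite exprMn; field.
rewrite EFinM; apply: lee_wpmul2l; first by rewrite lee_fin exprn_ge0.
apply: (@le_trans _ _ ((1 / 4)%:E * \int[leb]_(t in `[0%R, 1%R]) (riesz n t)%:E)%E).
  rewrite riesz_fin -EFinM lee_fin ler_pM2l; last by rewrite divr_gt0.
  exact: riesz_integral_ge_expn.
rewrite -ge0_integralZl//; last 2 first.
- exact: measurable_funTS.
- by move=> x _; rewrite lee_fin riesz_ge0.
apply: ge0_le_integral => //.
- by move=> x _; rewrite -EFinM lee_fin mulr_ge0 ?riesz_ge0// divr_ge0.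
- by apply: measurable_funTS; exact: emeasurable_funM.
- exact: measurable_funTS (mrphi n).
- move=> x /=; rewrite in_itv/= => x01; rewrite -EFinM lee_fin mulrC.
  by rewrite ler_wpM2l ?riesz_ge0// phi_ge.
Qed.

Lemma self_similar_integral_le (b : R) : growth_rate < b ->
  exists2 K : R, 0 < K & forall n, (J n <= (K * (3 * b) ^+ n)%:E)%E.
Proof.
move=> cb; have [K K0 HK] := transfer_sup_expn_le cb.
exists (2 * K) => [|n]; first by rewrite mulr_gt0.
have mr : measurable_fun setT (fun t : R => (riesz n t)%:E).
  by apply/measurable_EFinP; exact: measurable_riesz.
rewrite JE; have -> : 2 * K * (3 * b) ^+ n = 3 ^+ n * (2 * (K * b ^+ n)) by rewrite exprMn; ring.
rewrite EFinM; apply: lee_wpmul2l; first by rewrite lee_fin exprn_ge0.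
apply: (@le_trans _ _ (2%:E * \int[leb]_(t in `[0%R, 1%R]) (riesz n t)%:E)%E); last first.
  rewrite riesz_fin -EFinM lee_fin ler_pM2l//.
  exact: le_trans (riesz_integral_le n) (HK n).
rewrite -ge0_integralZl//; last 2 first.
- exact: measurable_funTS.
- by move=> x _; rewrite lee_fin riesz_ge0.
apply: ge0_le_integral => //.
- by move=> x _; rewrite lee_fin mulr_ge0 ?riesz_ge0.
- exact: measurable_funTS (mrphi n).
- by apply: measurable_funTS; exact: emeasurable_funM.
- by move=> x _; rewrite -EFinM lee_fin mulrC ler_wpM2r ?riesz_ge0.
Qed.

Let powR_expn (s : R) n : (3 ^+ n : R) `^ s = (3 `^ s) ^+ n.
Proof. by rewrite -[RHS]powR_mulrn ?powR_ge0// -powRrM mulrC powRrM powR_mulrn. Qed.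

(** Decomposition into the shells between 3^n and 3^(n+1). There x^(-s) is at most [e ^+ n], and the
    integral of [phi] is at most a constant times (3b)^(n+1), so the contributions are geometric. *)
Lemma self_similar_finite (F : R -> R) (C s : R) : measurable_fun setT F ->
  (forall x, 0 <= F x) -> 0 <= C -> 0 <= s ->
  (forall x, 0 <= x -> F x <= C * phi x) ->
  (forall x, 1 <= x -> F x <= C * phi x * x `^ (- s)) ->
  3 * 3 `^ (- s) * growth_rate < 1 ->
  (\int[leb]_(x in `[0%R, +oo[) (F x)%:E < +oo)%E.
Proof.
move=> mF F0 C0 s0 F1 F2 c1; set e := 3 `^ (- s) in c1.
have e0 : 0 < e by exact: powR_gt0.
have ee : 0 < 3 * e by rewrite mulr_gt0.
have c1' : growth_rate < (3 * e)^-1 by rewrite -[X in _ < X]mul1r ltr_pdivlMr// mulrC.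
(* The midpoint leaves room on both sides: above the growth rate for [self_similar_integral_le], and
   below the inverse of [3 * e] for the shell ratio [q] to be less than 1. *)
pose b := (growth_rate + (3 * e)^-1) / 2.
have cb : growth_rate < b by rewrite /b; lra.
have b0 : 0 < b by exact: lt_trans (@growth_rate_gt0 R) cb.
have be : b < (3 * e)^-1 by rewrite /b; lra.
have [K K0 HK] := self_similar_integral_le cb.
pose q := 3 * e * b.
have q1 : q < 1 by rewrite /q mulrC -ltr_pdivlMr// mul1r.
have q0 : 0 < q by rewrite mulr_gt0.
pose A := 3 * b * C * K.
have A0 : 0 <= A by rewrite /A; apply: mulr_ge0 (ltW K0); rewrite mulr_ge0// mulr_ge0// ltW.
have mFE : measurable_fun setT (fun x => (F x)%:E) by exact/measurable_EFinP.
have F0E x : (0 <= (F x)%:E)%E by rewrite lee_fin.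
have mphiE : measurable_fun setT (fun x => (phi x)%:E) by exact/measurable_EFinP.
have phi0E x : (0 <= (phi x)%:E)%E by rewrite lee_fin.
have shell n : (\int[leb]_(x in `[(3 ^+ n)%R, (3 ^+ n.+1)%R[) (F x)%:E <= (A * q ^+ n)%:E)%E.
  apply: (@le_trans _ _ (\int[leb]_(x in `[(3 ^+ n)%R, (3 ^+ n.+1)%R[) ((C * e ^+ n)%:E * (phi x)%:E))%E).
    apply: ge0_le_integral => //.
    - exact: measurable_funTS.
    - by apply: measurable_funTS; exact: emeasurable_funM.
    - move=> x /=; rewrite in_itv/= => /andP[x1 x2].
      have xge1 : 1 <= x by apply: le_trans x1; rewrite exprn_ege1// ler1n.
      rewrite -EFinM lee_fin; apply: le_trans (F2 x xge1) _.
      rewrite mulrAC ler_wpM2r// ler_wpM2l// /e -powR_expn !powRN.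
      have x0 : 0 < x by exact: lt_le_trans xge1.
      rewrite lef_pV2 ?posrE ?powR_gt0//.
      by apply: ge0_ler_powR => //; rewrite nnegrE ltW.
  rewrite ge0_integralZl//; last 2 first.
  - exact: measurable_funTS.
  - by rewrite lee_fin mulr_ge0// exprn_ge0// ltW.
  apply: (@le_trans _ _ ((C * e ^+ n)%:E * J n.+1)%E).
    apply: lee_wpmul2l; first by rewrite lee_fin mulr_ge0// exprn_ge0// ltW.
    apply: ge0_subset_integral => //; first exact: measurable_funTS.
    by move=> x /=; rewrite !in_itv/= => /andP[x1 ->]; rewrite andbT (le_trans _ x1)// ltW.
  apply: (@le_trans _ _ ((C * e ^+ n)%:E * (K * (3 * b) ^+ n.+1)%:E)%E).
    by apply: lee_wpmul2l => //; rewrite lee_fin mulr_ge0// exprn_ge0// ltW.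
  rewrite -EFinM lee_fin le_eqVlt; apply/orP; left; apply/eqP.
  by rewrite /A /q exprS !exprMn; ring.
pose Bd := C * (K * 1) + A / (1 - q).
have q1' : 0 < 1 - q by rewrite subr_gt0.
(* [C * (K * 1)] accounts for [0, 1[, and the quotient is the partial geometric sum over the first
   [N] shells. *)
have ball N : (\int[leb]_(x in `[0%R, (3 ^+ N)%R[) (F x)%:E <=
    (C * (K * 1) + A * ((1 - q ^+ N) / (1 - q)))%:E)%E.
  elim: N => [|N IH].
    rewrite expr0 subrr mul0r mulr0 addr0.
    apply: (@le_trans _ _ (\int[leb]_(x in `[0%R, 1%R[) (C%:E * (phi x)%:E))%E).
      apply: ge0_le_integral => //.
      - exact: measurable_funTS.
      - by apply: measurable_funTS; exact: emeasurable_funM.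
      - by move=> x /=; rewrite in_itv/= => /andP[x0 _]; rewrite -EFinM lee_fin F1.
    rewrite ge0_integralZl//; last exact: measurable_funTS.
    rewrite [leRHS]EFinM; apply: lee_wpmul2l => //.
    by have := HK 0%N; rewrite /J !expr0.
  have l : (3 ^+ N <= 3 ^+ N.+1 :> R) by rewrite exprS ler_peMl ?exprn_ge0// ler1n.
  rewrite (@itv_bndbnd_setU _ _ (BLeft 0) (BLeft (3 ^+ N)) (BLeft (3 ^+ N.+1))) ?bnd_simp ?(ltW (e3 N))//.
  rewrite ge0_integral_setU//; last 2 first.
  - exact: measurable_funTS.
  - by apply/disj_setPS => y [/=]; rewrite !in_itv/= => /andP[_ y1] /andP[y2 _]; move: (lt_le_trans y1 y2); rewrite ltxx.
  apply: le_trans (leeD IH (shell N)) _; rewrite -EFinD lee_fin le_eqVlt; apply/orP; left; apply/eqP.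
  by rewrite exprS; field; rewrite gt_eqF.
have ballB N : (\int[leb]_(x in `[0%R, (3 ^+ N)%R[) (F x)%:E <= Bd%:E)%E.
  apply: le_trans (ball N) _; rewrite lee_fin lerD2l ler_wpM2l// ler_pdivrMr// mulVf ?gt_eqF//.
  by rewrite gerBl exprn_ge0// ltW.
pose D (N : nat) : set R := `[0, 3 ^+ N[%classic.
have UD : \bigcup_N D N = `[0, +oo[%classic.
  apply/seteqP; split=> [x [n _]|x]; rewrite /D /= !in_itv/= ?andbT; first by move=> /andP[].
  move=> x0; exists (Num.bound x) => //=; rewrite in_itv/= x0/=.
  apply: lt_le_trans (archi_boundP x0) _; rewrite -natrX ler_nat.
  exact/ltnW/ltn_expl.
have ndD : nondecreasing_seq D.
  apply/nondecreasing_seqP => n; apply/subsetPset => x; rewrite /D /= !in_itv/=.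
  move=> /andP[-> x1] /=; apply: lt_le_trans x1 _.
  by rewrite exprS ler_peMl ?exprn_ge0// ler1n.
apply: le_lt_trans (ltry Bd).
have H := @ge0_nondecreasing_set_cvg_integral _ (measurableTypeR R) R D (fun x => (F x)%:E) leb.
rewrite UD in H; apply: (cvge_to_le (H _ _ _ _)) => //.
- by move=> n; exact: measurable_itv.
- by move=> n; exact: measurable_funTS.
- by apply: nearW => n; exact: ballB.
Qed.

(* Otherwise [3^(-n s) phi] on [0, 3^n[ has integral bounded below, although it
   tends to 0 and is dominated by an integrable function. *)
Lemma self_similar_infinite (G : R -> R) (s x0 : R) : leb.-integrable setT (EFin \o G) ->
  (forall x, 0 <= G x) -> 0 < s -> 1 <= x0 ->
  (forall x, x0 <= x -> phi x * x `^ (- s) <= G x) ->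
  3 * 3 `^ (- s) * growth_rate < 1.
Proof.
move=> iG G0 s0 x01 HG; rewrite ltNge; apply/negP; set e := 3 `^ (- s) => c1.
have e0 : 0 < e by exact: powR_gt0.
have e1 : e < 1.
  rewrite /e powRN invf_lt1 ?powR_gt0//; apply: (@le_lt_trans _ _ (1 `^ s)); first by rewrite powR1.
  by apply: gt0_ltr_powR; rewrite ?nnegrE ?ltr1n.
pose D (n : nat) : set R := `[0, 3 ^+ n[%classic.
have mD n : measurable (D n : set (measurableTypeR R)) by exact: measurable_itv.
pose f (n : nat) (x : R) := e ^+ n * (phi \_ (D n)) x.
(* Up to [x0] the bound [phi <= 2] is used. Beyond [x0] and below 3^n, [e ^+ n] is at most x^(-s),
   so [G] dominates. *)
pose dom (x : R) := ((fun=> 2 : R) \_ (`[0, x0]%classic : set R)) x + G x.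
have mf n : measurable_fun setT (f n).
  by apply: measurable_funM => //; apply: (measurable_restrictT phi (mD n)).1; exact: measurable_funTS.
have f0 n x : 0 <= f n x.
  by rewrite mulr_ge0 ?exprn_ge0 ?(ltW e0)// patchE; case: ifP.
have lim : \int[leb]_x f n x @[n --> \oo] --> \int[leb]_x (cst 0 x : R).
  apply: (@cvg_Rintegral_dominated _ f (cst 0) dom) => //.
  - move=> x; apply: (@squeeze_cvgr _ _ _ _ (fun=> 0) (fun n => e ^+ n * 2)); last 2 first.
    + exact: cvg_cst.
    + rewrite -[X in _ --> X](mul0r 2); apply: cvgM; last exact: cvg_cst.
      by apply: cvg_expr; rewrite gtr0_norm.
    apply: nearW => n; rewrite f0/= ler_wpM2l ?exprn_ge0 ?(ltW e0)//.
    by rewrite patchE; case: ifP.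
  - have mI : measurable (`[0, x0]%classic : set (measurableTypeR R)) by exact: measurable_itv.
    have h : leb.-integrable (`[0, x0]%classic : set (measurableTypeR R)) (fun=> (2 : R)%:E).
      apply/integrableP; split; first exact: measurable_cst.
      under eq_integral do rewrite /=.
      have L : (leb `[0%R, x0] < +oo)%E.
        by rewrite lebesgue_measure_itv/= lte_fin (lt_le_trans ltr01 x01) -EFinB ltry.
      by rewrite integral_cst//; apply: lte_mul_pinfty.
    have := integrableD measurableT ((integrable_mkcond (fun=> (2 : R)%:E) mI).1 h) iG.
    apply: eq_integrable => // x _; rewrite /dom /= !patchE.
    by case: ifP.
  - move=> n x; rewrite ger0_norm// /f /dom !patchE !mem_setE !in_itv/=.
    case: ifPn => [/andP[x1 x2]|_]; last first.
      by rewrite mulr0 addr_ge0//; case: ifP.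
    rewrite x1/=; case: ifPn => [_|].
      rewrite -[leLHS]addr0 lerD//; apply: (@le_trans _ _ (1 * 2)); last by rewrite mul1r.
      by apply: ler_pM; rewrite ?exprn_ge0 ?(ltW e0)// exprn_ile1// ltW.
    rewrite -ltNge add0r => x0x; apply: le_trans (HG x (ltW x0x)).
    rewrite mulrC ler_wpM2l// /e -powR_expn !powRN.
    have xp : 0 < x by apply: lt_trans x0x; exact: lt_le_trans x01.
    rewrite lef_pV2 ?posrE ?powR_gt0//.
    by apply: ge0_ler_powR; rewrite ?nnegrE ?(ltW s0) ?(ltW x2)// ltW.
have fJ n : ((\int[leb]_x f n x)%:E = (e ^+ n)%:E * J n)%E.
  have [|K K0 HK] := @self_similar_integral_le (growth_rate + 1); first by rewrite ltrDl.
  have mD0 : measurable_fun setT (phi \_ (D n)).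
    by apply: (measurable_restrictT phi (mD n)).1; exact: measurable_funTS.
  have E : (\int[leb]_x (f n x)%:E = (e ^+ n)%:E * J n)%E.
    transitivity (\int[leb]_x ((e ^+ n)%:E * ((phi \_ (D n)) x)%:E))%E; first by [].
    rewrite ge0_integralZl//; last 3 first.
    - exact/measurable_EFinP.
    - by move=> x _; rewrite lee_fin patchE; case: ifP.
    - by rewrite lee_fin exprn_ge0// ltW.
    rewrite /J [in RHS]integral_mkcond; congr (_ * _)%E; apply: eq_integral => x _.
    by rewrite !patchE; case: ifP.
  rewrite /Rintegral fineK// E ge0_fin_numE.
    apply: lte_mul_pinfty => //; first by rewrite lee_fin exprn_ge0// ltW.
    exact: le_lt_trans (HK n) (ltry _).
  apply: mule_ge0; first by rewrite lee_fin exprn_ge0// ltW.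
  by apply: integral_ge0 => x _; rewrite lee_fin.
have c2 : 1 <= e * (3 * growth_rate).
  by have -> : e * (3 * growth_rate) = 3 * e * growth_rate by ring.
(* The lower bound for [J n] has no loss in its base, so 1/512 survives even when
   [e * (3 * growth_rate)] equals 1. This excludes the critical exponent. *)
have fge n : 512^-1 <= \int[leb]_x f n x.
  rewrite -lee_fin fJ; apply: le_trans (lee_wpmul2l _ (self_similar_integral_ge n)); last first.
    by rewrite lee_fin exprn_ge0// ltW.
  rewrite -EFinM lee_fin mulrA -exprMn.
  have h512 : 0 <= 512^-1 :> R by rewrite invr_ge0 ler0n.
  rewrite -[leLHS]mul1r; apply: ler_wpM2r => //.
  exact: exprn_ege1 c2.
have : 512^-1 <= \int[leb]_x (cst 0 x : R).
  by apply: (cvgr_to_ge lim); exact: nearW.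
rewrite (_ : \int[leb]_x _ = 0); last by rewrite /Rintegral integral0.
by rewrite leNgt invr_gt0 ltr0n.
Qed.
End self_similar_integral.

(** * The multiplier criterion *)

Section cantor_multiplier.
Context {R : realType}.
Notation leb := (@lebesgue_measure R).
Variables (mu : probability (measurableTypeR R) R) (chi : R -> R[i]) (delta : R).
Hypotheses (hmu : cantor_measure mu) (hchi : test_function chi).
Hypothesis chi_neq0 : exists x : R, chi x <> 0.
Hypothesis chi_hat_ge0 : forall xi : R, 0 <= fourier chi xi.
Hypothesis delta0 : 0 < delta.

Let p := delta - alpha R.

Let h (u : R) : R[i] := chi u * (`|u| `^ p)%:C.

Let H (x : R) := cintegral leb (fun u => cis (pi * x * u) * h u).

Let phi (x : R) := normc (mu_hat mu x).

Let ln3 : 0 < ln (3 : R). Proof. by rewrite ln_gt0// ltr1n. Qed.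

Let alpha1 : alpha R < 1.
Proof. by rewrite /alpha ltr_pdivrMr// mul1r ltr_ln ?posrE// ltr_nat. Qed.

Let p1 : -1 < p. Proof. by rewrite /p ltrBrDl; apply: lt_trans delta0; rewrite subr_lt0. Qed.

Lemma m_deltaE : m_delta mu chi delta =
  (fun xi => cintegral mu (fun eta : measurableTypeR R => h (xi - eta))).
Proof.
apply/funext => xi; apply: eq_cintegral => eta.
by rewrite -fmorphV/= -powRN opprB.
Qed.

Let ih : cintegrable leb h := cintegrable_kernel p1 hchi.

Let im : cintegrable leb (m_delta mu chi delta).
Proof. by rewrite m_deltaE; exact: cintegrable_measure_convolution. Qed.

Let KE x : normc (inv_fourier (m_delta mu chi delta) x) = 2^-1 * (phi x * normc (H x)).
Proof.
rewrite m_deltaE inv_fourier_measure_convolution// !ComplexField.Normc.normcM normc_real.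
by rewrite ger0_norm.
Qed.

Let multiplierP : Lp_fourier_multiplier 1 (m_delta mu chi delta) <->
  (\int[leb]_x (normc (inv_fourier (m_delta mu chi delta) x))%:E < +oo)%E.
Proof.
rewrite (L1_multiplierP hchi chi_neq0 im); apply: cintegrableP.
exact: cmeasurable_inv_fourier.
Qed.

Let phi_ge0 x : 0 <= phi x. Proof. exact: normc_ge0. Qed.

Let phi3 x : phi (3 * x) = `|cos (pi * x)| * phi x.
Proof. by rewrite /phi mu_hat3// ComplexField.Normc.normcM normc_real. Qed.

Let mphi : measurable_fun setT phi.
Proof. exact: measurable_normc_mu_hat. Qed.

Let c0 := @growth_rate_gt0 R.

(** The product 3 * 3^(-(p+1)) is 3^(-p) with p = delta - alpha; the condition follows by taking
    logarithms and dividing by ln 3. *)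
Let thresholdE : (3 * 3 `^ (- (p + 1)) * growth_rate < 1) =
  (ln 2 / ln 3 + ln (growth_rate : R) / ln 3 < delta).
Proof.
have e0 : 0 < 3 `^ (- (p + 1)) :> R by exact: powR_gt0.
have p3 : 0 < 3 * 3 `^ (- (p + 1)) * growth_rate :> R by rewrite !mulr_gt0.
rewrite -(ltr_ln p3) ?posrE// ln1 !lnM ?posrE ?mulr_gt0// ln_powR.
have aE : alpha R * ln 3 = ln 2 by rewrite /alpha divfK// gt_eqF.
rewrite -mulrDl [in RHS]ltr_pdivrMr// -[RHS]subr_lt0 -aE /p.
by congr (_ < _); ring.
Qed.

Lemma multiplier_of_threshold : ln 2 / ln 3 + ln (growth_rate : R) / ln 3 < delta ->
  Lp_fourier_multiplier 1 (m_delta mu chi delta).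
Proof.
rewrite -thresholdE => thr; apply/multiplierP.
have [C C0 HC] := fourier_kernel_decay p1 hchi.
pose s := Num.min 1 (p + 1).
have p10 : 0 < p + 1 by have := p1; lra.
pose K := inv_fourier (m_delta mu chi delta).
have mK : measurable_fun setT (fun x => normc (K x)).
  exact: measurable_normc (cmeasurable_inv_fourier im).
(* The sign [e] treats both half-lines at once: the modulus of [mu_hat] is even and the decay of [H]
   is two-sided. *)
pose F (e x : R) := normc (K (e * x)).
have mF e : measurable_fun setT (F e).
  by apply: (@measurableT_comp _ _ _ _ _ _ (fun x => normc (K x)) _ (fun x : R => e * x)) => //; exact: measurable_funM.
(* If [p + 1] is at least 1, the decay exponent is 1 and the condition becomes [growth_rate < 1],
   known from the numerical bounds. *)
have thr' : 3 * 3 `^ (- s) * growth_rate < 1 :> R.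
  rewrite /s; have [h1|h1] := leP 1 (p + 1); last exact: thr.
  rewrite powRN powRr1// mulfV ?pnatr_eq0// mul1r.
  by have /andP[_] := @growth_rate_bounds R; lra.
have fin (e : R) : `|e| = 1 -> (\int[leb]_(x in `[0%R, +oo[) (F e x)%:E < +oo)%E.
  move=> e1; have phie x : phi (e * x) = phi x.
    have [e0|e0] := leP 0 e; first by rewrite -(ger0_norm e0) e1 mul1r.
    by move: e1; rewrite ltr0_norm// => /eqP; rewrite eqr_oppLR => /eqP ->; rewrite mulN1r /phi normc_mu_hatN.
  apply: (@self_similar_finite _ phi mphi phi_ge0 _ phi3 (F e) C s) => //.
  - by move=> x; exact: normc_mu_hat_le.
  - by move=> x; exact: normc_ge0.
  - by rewrite le_min ler01 ltW.
  - move=> x x0; rewrite /F KE phie; have [h1 _] := HC (e * x).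
    rewrite mulrCA mulrC ler_wpM2r// -[leRHS]mul1r ler_pM ?normc_ge0//.
    by rewrite invf_le1// ler1n.
  - move=> x x1; rewrite /F KE phie; have [_ h1] := HC (e * x).
    have ex : `|e * x| = x by rewrite normrM e1 mul1r ger0_norm// (le_trans ler01).
    have := h1; rewrite ex => /(_ x1) h2.
    rewrite mulrCA [C * _]mulrC -mulrA ler_wpM2l//; apply: le_trans h2.
    by rewrite ler_piMl ?normc_ge0// invf_le1// ler1n.
have mKE : measurable_fun setT (fun x => (normc (K x))%:E) by exact/measurable_EFinP.
have K0 x : (0 <= (normc (K x))%:E)%E by rewrite lee_fin normc_ge0.
rewrite (_ : [set: _] = `]-oo, 0[%classic `|` `[0, +oo[%classic :> set R); last first.
  by apply/seteqP; split => // x _ /=; rewrite !in_itv/= andbT; case: (ltP x 0); [left|right].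
rewrite ge0_integral_setU//; last 2 first.
- exact: measurable_funTS.
- by apply/disj_setPS => y [/=]; rewrite !in_itv/= andbT leNgt => ->.
apply: lte_add_pinfty; last first.
  apply: le_lt_trans (fin 1 (normr1 _)); apply: le_eq_integral => x _.
  by rewrite /F mul1r.
rewrite (@ge0_integral_affine_set _ (-1) 0)// ?oppr_eq0 ?oner_eq0// normrN normr1 mul1e.
apply: le_lt_trans (fin (-1) _); last by rewrite normrN normr1.
apply: (@le_trans _ _ (\int[leb]_(x in (fun x : R => (-1 * x + 0)%R) @^-1` `]-oo, 0%R[) (F (-1) x)%:E)%E).
  by apply: le_eq_integral => x _; rewrite /F addr0.
apply: ge0_subset_integral => //.
- rewrite -[X in measurable X]setTI; exact: measurable_affine.
- by apply: measurable_funTS; apply/measurable_EFinP; exact: mF.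
- by move=> x _; rewrite lee_fin normc_ge0.
- by move=> x /=; rewrite !in_itv/= addr0 mulN1r andbT oppr_lt0 => /ltW.
Qed.

Lemma threshold_of_multiplier : Lp_fourier_multiplier 1 (m_delta mu chi delta) ->
  ln 2 / ln 3 + ln (growth_rate : R) / ln 3 < delta.
Proof.
(* For nonnegative [p], outside the range of [fourier_kernel_ge], delta is at least alpha, and the
   threshold lies below alpha because [growth_rate < 1] has a negative logarithm. *)
move=> /multiplierP fin; have [pneg|ppos] := ltP p 0; last first.
  have : ln (growth_rate : R) < 0.
    rewrite ln_lt0// c0/=; have /andP[_] := @growth_rate_bounds R; lra.
  move=> lc; apply: (@lt_le_trans _ _ (alpha R)); last by move: ppos; rewrite /p subr_ge0.
  by rewrite -[ltRHS]addr0 ltrD2l pmulr_llt0// invr_gt0.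
rewrite -thresholdE.
have [c [x0 [cp x01 Hx]]] := fourier_kernel_ge p1 hchi pneg chi_neq0 chi_hat_ge0.
pose K := inv_fourier (m_delta mu chi delta).
have iK : cintegrable leb K.
  by apply/(cintegrableP leb (cmeasurable_inv_fourier im)).
(* The factor undoes the 1/2 of [KE] and the constant [c] of the lower bound for [H]. *)
pose G x := 2 / c * normc (K x).
have c2 : 0 <= 2 / c by rewrite divr_ge0// ltW.
apply: (@self_similar_infinite _ phi mphi phi_ge0 _ _ phi3 G (p + 1) x0).
- by move=> x; exact: normc_mu_hat_le.
- by move=> x; exact: normc_mu_hat_ge.
- have := integrableZl measurableT (2 / c) (cintegrable_normc iK).
  exact: eq_integrable.
- by move=> x; rewrite mulr_ge0 ?normc_ge0.
- by have := p1; lra.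
- exact: x01.
move=> x /Hx hx; rewrite /G KE.
have -> : 2 / c * (2^-1 * (phi x * normc (H x))) = phi x * (normc (H x) / c) by field; rewrite gt_eqF.
by rewrite ler_wpM2l// ler_pdivlMr// mulrC.
Qed.
End cantor_multiplier.

Theorem theorem6p1 (R : realType) (mu : probability (measurableTypeR R) R)
    (hmu : cantor_measure mu) (chi : R -> R[i]) (hchi : test_function chi)
    (chi_neq0 : exists x : R, chi x <> 0)
    (chi_hat_ge0 : forall xi : R, 0 <= fourier chi xi) :
  (forall delta : R, 0 < delta ->
     (Lp_fourier_multiplier 1 (m_delta mu chi delta) <->
      delta > ln 2 / ln 3 + ln (c1 R) / ln 3)) /\
  (236 / 1000 <= ln (2 : R) / ln 3 + ln (c1 R) / ln 3 < 237 / 1000).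
Proof.
rewrite c1E; split; last exact: threshold_bounds.
move=> delta delta0; split.
- exact: threshold_of_multiplier.
- exact: multiplier_of_threshold.
Qed.
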